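(* Let $\boldsymbol{f}\in\boldsymbol{L}^2(\Omega)$ and assume that $\sigma>0$ is sufficiently large to guarantee discrete coercivity of $a_h$. Let $(\boldsymbol{u}_h,p_h)\in\boldsymbol{V}_h\times Q_h$ be the solution of the stabilized DG method with $\gamma>0$, i.e. for all $(\boldsymbol{v}_h,q_h)\in\boldsymbol{V}_h\times Q_h$ $$\nu a_h(\boldsymbol{u}_h,\boldsymbol{v}_h)+b_h(\boldsymbol{v}_h,p_h)+\gamma j_h(\boldsymbol{u}_h,\boldsymbol{v}_h)=(\boldsymbol{f},\boldsymbol{v}_h),\qquad -b_h(\boldsymbol{u}_h,q_h)=0,$$ and let $(\widehat{\boldsymbol{u}}_h,\widehat{p}_h)\in\boldsymbol{W}_h\times Q_h$ be the solution of the weakly divergence-free $\boldsymbol{H}(\mathrm{div})$-DG method, i.e. for all $(\boldsymbol{w}_h,q_h)\in\boldsymbol{W}_h\times Q_h$ $$\nu a_h(\widehat{\boldsymbol{u}}_h,\boldsymbol{w}_h)+b(\boldsymbol{w}_h,\widehat{p}_h)-b(\widehat{\boldsymbol{u}}_h,q_h)=(\boldsymbol{f},\boldsymbol{w}_h).$$ Then there exists a constant $C>0$, independent of $\gamma$, such that $$|||\boldsymbol{u}_h-\widehat{\boldsymbol{u}}_h|||_e\le C\gamma^{-1}\|\boldsymbol{f}\|_{\boldsymbol{L}^2(\Omega)},\qquad \|p_h-\widehat{p}_h\|_{L^2(\Omega)}\le C\gamma^{-1}\nu\,\|\boldsymbol{f}\|_{\boldsymbol{L}^2(\Omega)}.$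$
   Context: Setting. $\Omega\subset\mathbb{R}^d$, $d\in\{2,3\}$, is a simply connected set with smooth boundary or a convex polygon; $\nu>0$ is a constant viscosity; $k\ge1$ is an integer. Bold symbols denote vector-valued functions and spaces; $(\cdot,\cdot)$ is the $L^2(\Omega)$ inner product; $L^2_0(\Omega)$ is the space of $L^2(\Omega)$ functions with zero mean. $\mathcal{T}_h$ is a shape-regular simplicial partition of $\Omega$ without hanging nodes, with mesh size $h$. $\mathcal{F}_h=\mathcal{F}_h^i\cup\mathcal{F}_h^\partial$ is the set of all facets (interior and boundary facets), $h_F$ is the diameter of $F\in\mathcal{F}_h$, and $\boldsymbol{n}_F$ is a fixed unit normal on $F$ (outer normal $\boldsymbol{n}$ on boundary facets). On an interior facet $F$ shared by $K^+$ and $K^-$, the jump and average of a piecewise smooth function $\phi$ with traces $\phi^\pm$ are $[\![\phi]\!]=\phi^+-\phi^-$ and $\{\!\{\phi\}\!\}=\frac12(\phi^++\phi^-)$; on a boundary facet $[\![\phi]\!]=\{\!\{\phi\}\!\}=\phi$. $\nabla_h$ and $\nabla_h\cdot$ are the elementwise (broken) gradient and divergence. $\boldsymbol{H}_0(\mathrm{div};\Omega)=\{\boldsymbol{w}\in\boldsymbol{L}^2(\Omega):\nabla\cdot\boldsymbol{w}\in L^2(\Omega),\ \boldsymbol{w}\cdot\boldsymbol{n}|_{\partial\Omega}=0\}$. Discrete spaces. With $\mathbb{P}_k(K)$ the scalar, and $\boldsymbol{\mathbb{P}}_k(K)$ the vector-valued, polynomials of degree at most $k$ on $K$: $\boldsymbol{V}_h=\{\boldsymbol{v}_h\in\boldsymbol{L}^2(\Omega):\boldsymbol{v}_h|_K\in\boldsymbol{\mathbb{P}}_k(K)\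 \forall K\in\mathcal{T}_h\}$, $Q_h=\{q_h\in L^2_0(\Omega):q_h|_K\in\mathbb{P}_{k-1}(K)\ \forall K\in\mathcal{T}_h\}$, and $\boldsymbol{W}_h=\boldsymbol{V}_h\cap\boldsymbol{H}_0(\mathrm{div};\Omega)$ (the Brezzi–Douglas–Marini space of order $k$). Forms. $$a_h(\boldsymbol{w},\boldsymbol{v})=\int_\Omega\nabla_h\boldsymbol{w}:\nabla_h\boldsymbol{v}\,d\boldsymbol{x}+\sum_{F\in\mathcal{F}_h}\frac{\sigma}{h_F}\oint_F[\![\boldsymbol{w}]\!]\cdot[\![\boldsymbol{v}]\!]\,d\boldsymbol{s}-\sum_{F\in\mathcal{F}_h}\oint_F\{\!\{\nabla\boldsymbol{w}\}\!\}\boldsymbol{n}_F\cdot[\![\boldsymbol{v}]\!]\,d\boldsymbol{s}-\sum_{F\in\mathcal{F}_h}\oint_F[\![\boldsymbol{w}]\!]\cdot\{\!\{\nabla\boldsymbol{v}\}\!\}\boldsymbol{n}_F\,d\boldsymbol{s},$$ $$b(\boldsymbol{w},q)=-\int_\Omega q\,(\nabla\cdot\boldsymbol{w})\,d\boldsymbol{x},\qquad b_h(\boldsymbol{w},q)=-\int_\Omega q\,(\nabla_h\cdot\boldsymbol{w})\,d\boldsymbol{x}+\sum_{F\in\mathcal{F}_h}\oint_F\{\!\{q\}\!\}([\![\boldsymbol{w}]\!]\cdot\boldsymbol{n}_F)\,d\boldsymbol{s},$$ $$j_h(\boldsymbol{w},\boldsymbol{v})=\sum_{F\in\mathcal{F}_h}\frac1{h_F}\oint_F([\![\boldsymbol{w}]\!]\cdot\boldsymbol{n}_F)([\![\boldsymbol{v}]\!]\cdot\boldsymbol{n}_F)\,d\boldsymbol{s}.$$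 Energy norm: $|||\boldsymbol{w}|||_e^2=\|\nabla_h\boldsymbol{w}\|_{\boldsymbol{L}^2(\Omega)}^2+\sum_{F\in\mathcal{F}_h}\frac{\sigma}{h_F}\|[\![\boldsymbol{w}]\!]\|_{\boldsymbol{L}^2(F)}^2$. Standing assumption on $\sigma$: $\sigma\ge1$ and $\sigma$ is large enough for discrete coercivity, i.e. there is $C_\sigma>0$ independent of $h$ with $a_h(\boldsymbol{v}_h,\boldsymbol{v}_h)\ge C_\sigma|||\boldsymbol{v}_h|||_e^2$ for all $\boldsymbol{v}_h\in\boldsymbol{V}_h$. The pairs $\boldsymbol{W}_h/Q_h$ and $\boldsymbol{V}_h/Q_h$ are inf-sup stable: there is $\beta^*>0$ independent of $h$ such that for all $q_h\in Q_h$, $\beta^*\|q_h\|_{L^2(\Omega)}\le\sup_{\boldsymbol{w}_h\in\boldsymbol{W}_h\setminus\{\boldsymbol{0}\}}b(\boldsymbol{w}_h,q_h)/|||\boldsymbol{w}_h|||_e\le\sup_{\boldsymbol{v}_h\in\boldsymbol{V}_h\setminus\{\boldsymbol{0}\}}b_h(\boldsymbol{v}_h,q_h)/|||\boldsymbol{v}_h|||_e$. The constant $C$ in the claim is allowed to depend on the mesh. *)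

(* Defs.v *)
From HB Require Import structures.
From mathcomp Require Import all_boot all_order all_algebra.
From mathcomp Require Import all_classical all_reals all_analysis.
Set Implicit Arguments.
Unset Strict Implicit.
Unset Printing Implicit Defensive.
Import Order.TTheory GRing.Theory Num.Theory.
Import numFieldNormedType.Exports.
Local Open Scope classical_set_scope.
Local Open Scope ring_scope.

Section LebesgueRV.
Variable R : realType.

(* 'rV[R]_n carries the sigma-algebra generated by the coordinates. *)
Section Structure.
Variable n : nat.

Let coord : 'I_n -> 'rV[R]_n -> R := fun i x => x ord0 i.

Let coord_set0 : g_sigma_preimage coord set0.
Proof. exact: sigma_algebra0. Qed.

Let coord_setC A : g_sigma_preimage coord A -> g_sigma_preimage coord (~` A).
Proof. exact: sigma_algebraC. Qed.

Let coord_bigcup (F : _^nat) : (forall i, g_sigma_preimage coord (F i)) ->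
  g_sigma_preimage coord (\bigcup_i (F i)).
Proof. exact: sigma_algebra_bigcup. Qed.

HB.instance Definition _ := @isMeasurable.Build default_measure_display
  'rV[R]_n (g_sigma_preimage coord) coord_set0 coord_setC coord_bigcup.

End Structure.

Lemma measurable_coord n (i : 'I_n) :
  measurable_fun [set: 'rV[R]_n] (fun x : 'rV[R]_n => x ord0 i).
Proof.
move=> _ Y mY; rewrite setTI; apply: sub_sigma_algebra => /=.
rewrite -bigcup_seq/=; exists i => /=; first by rewrite mem_index_enum.
by exists Y => //; rewrite setTI.
Qed.

Lemma measurable_rVP d (T : measurableType d) n (f : T -> 'rV[R]_n) :
  (forall i, measurable_fun [set: T] (fun t => f t ord0 i)) ->
  measurable_fun [set: T] f.
Proof.
move=> mf; suff : g_sigma_preimage (fun i t => f t ord0 i) `<=` measurable.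
  move=> sub _ Y mY; rewrite setTI; apply: sub.
  have -> : (fun i t => f t ord0 i) =
      (fun i => (fun x : 'rV[R]_n => x ord0 i) \o f) by [].
  by rewrite g_sigma_preimage_comp; exists Y => //; rewrite setTI.
apply: smallest_sub; first exact: sigma_algebra_measurable.
case: n => [|n] in f mf *; first by rewrite big_ord0.
rewrite -bigcup_mkord_ord; apply: bigcup_sub => i Ii.
by move=> A [B mB <-]; exact: mf.
Qed.

Definition cons_rv n (p : R * 'rV[R]_n) : 'rV[R]_n.+1 :=
  \row_i oapp (p.2 ord0) p.1 (unlift ord0 i).

Definition uncons_rv n (x : 'rV[R]_n.+1) : R * 'rV[R]_n :=
  (x ord0 ord0, \row_i x ord0 (lift ord0 i)).

Lemma cons_rvK n : cancel (@cons_rv n) (@uncons_rv n).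
Proof.
case=> a x; rewrite /uncons_rv mxE unlift_none /=; congr (_, _).
by apply/rowP => i; rewrite !mxE liftK.
Qed.

Lemma measurable_cons_rv n : measurable_fun [set: R * 'rV[R]_n] (@cons_rv n).
Proof.
apply: measurable_rVP => i; under eq_fun do rewrite mxE.
case: unliftP => [j _|_] /=; last exact: measurable_fst.
exact: measurableT_comp (measurable_coord j) measurable_snd.
Qed.

Lemma measurable_uncons_rv n : measurable_fun [set: 'rV[R]_n.+1] (@uncons_rv n).
Proof.
apply: measurable_fun_pair; first exact: measurable_coord.
apply: measurable_rVP => i; under eq_fun do rewrite mxE.
exact: measurable_coord.
Qed.

Section Step.
Variables (n : nat) (mu : {sigma_finite_measure set 'rV[R]_n -> \bar R}).

Definition lebesgue_step : set 'rV[R]_n.+1 -> \bar R :=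
  pushforward (lebesgue_measure \x mu)%E (@cons_rv n).

Let step0 : lebesgue_step set0 = 0%E.
Proof. by rewrite /lebesgue_step /pushforward preimage_set0 measure0. Qed.

Let step_ge0 A : (0 <= lebesgue_step A)%E.
Proof. by rewrite /lebesgue_step /pushforward; exact: measure_ge0. Qed.

Let mpre A : measurable A -> measurable (@cons_rv n @^-1` A).
Proof.
by move=> mA; rewrite -[X in measurable X]setTI; exact: measurable_cons_rv.
Qed.

Let step_sigma_additive : semi_sigma_additive lebesgue_step.
Proof.
move=> F mF tF mUF; rewrite /lebesgue_step /pushforward preimage_bigcup.
apply: measure_semi_sigma_additive.
- by move=> i; exact: mpre.
- apply/trivIsetP => /= i j _ _ ij; rewrite -preimage_setI.
  by move/trivIsetP : tF => /(_ _ _ _ _ ij) ->//; rewrite preimage_set0.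
- by rewrite -preimage_bigcup; exact: mpre.
Qed.

HB.instance Definition _ := isMeasure.Build _ _ _ lebesgue_step
  step0 step_ge0 step_sigma_additive.

Let step_sigma_finite : sigma_finite setT lebesgue_step.
Proof.
have /sigma_finiteP[F [TF ndF Foo]] := sigma_finiteT (@lebesgue_measure R).
have /sigma_finiteP[G [TG ndG Goo]] := sigma_finiteT mu.
exists (fun i => @uncons_rv n @^-1` (F i `*` G i)).
  rewrite -preimage_bigcup -[LHS](preimage_setT (@uncons_rv n)); congr preimage.
  rewrite -setXTT TF TG predeqE => -[x y]; split.
    move=> [/= [i _ Fix] [k _ Gky]]; exists (maxn i k) => //; split.
    - by move: x Fix; exact/subsetPset/ndF/leq_maxl.
    - by move: y Gky; exact/subsetPset/ndG/leq_maxr.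
  by move=> [i _ []/= ? ?]; split; exists i.
move=> i; have [mF Fi] := Foo i; have [mG Gi] := Goo i; split.
  rewrite -[X in measurable X]setTI; apply: measurable_uncons_rv => //.
  exact: measurableX.
rewrite /lebesgue_step /pushforward -comp_preimage.
rewrite (_ : _ \o _ = id); last by apply/funext => p /=; rewrite cons_rvK.
by rewrite preimage_id product_measure1E// lte_mul_pinfty// ge0_fin_numE.
Qed.

HB.instance Definition _ := Measure_isSigmaFinite.Build _ _ _ lebesgue_step
  step_sigma_finite.

End Step.

Fixpoint lebesgue_rV n : {sigma_finite_measure set 'rV[R]_n -> \bar R} :=
  match n with
  | 0 => \d_(0 : 'rV[R]_0)
  | m.+1 => lebesgue_step (lebesgue_rV m)
  end.

End LebesgueRV.

Section Euclidean.
Context {R : realType}.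

(* Frobenius product; on row vectors it is the Euclidean dot product. *)
Definition mxdot m n (A B : 'M[R]_(m, n)) : R := \tr (A *m B^T).

(* The canonical norm of 'rV[R]_n is the maximum norm, hence this one. *)
Definition enorm n (x : 'rV[R]_n) : R := Num.sqrt (mxdot x x).

Definition diameter n (A : set 'rV[R]_n) : R :=
  sup [set enorm (z.1 - z.2) | z in A `*` A].

Definition inradius n (A : set 'rV[R]_n) : R :=
  sup [set r | exists x, [set y | enorm (y - x) <= r] `<=` A].

Definition conv_hull n (I : finType) (p : I -> 'rV[R]_n) (S : {set I}) :
    set 'rV[R]_n :=
  [set x | exists c : I -> R, [/\ forall i, 0 <= c i,
     \sum_(i in S) c i = 1 & x = \sum_(i in S) c i *: p i]].

End Euclidean.

Section Domains.
Context {R : realType} {d : nat}.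
Local Notation E := 'rV[R]_d.
Implicit Types Omega U : set E.

Definition partial (i : 'I_d) (phi : E -> R) : E -> R :=
  fun x => 'D_(delta_mx 0 i) phi x.

Definition smooth_on U (phi : E -> R) := forall (s : seq 'I_d) (x : E), U x ->
  {for x, continuous (foldr partial phi s)} /\
  forall i, derivable (foldr partial phi s) x (delta_mx 0 i).

Definition gradient (phi : E -> R) (x : E) : E := \row_i partial i phi x.

Definition smooth_boundary Omega := forall x, (closure Omega `\` Omega) x ->
  exists (U : set E) (phi : E -> R),
    [/\ open U, U x, smooth_on U phi,
        forall y, U y -> gradient phi y != 0 &
        U `&` Omega = U `&` [set y | phi y < 0]].

Definition path_in Omega (g : R -> E) :=
  {within `[0, 1], continuous g} /\ forall t, `[0, 1]%classic t -> Omega (g t).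

Definition simply_connected Omega :=
  (forall x y, Omega x -> Omega y ->
     exists g, [/\ path_in Omega g, g 0 = x & g 1 = y]) /\
  (forall g, path_in Omega g -> g 0 = g 1 ->
     exists H : R * R -> E,
       [/\ {within `[0, 1] `*` `[0, 1], continuous H},
           forall z, (`[0, 1] `*` `[0, 1])%classic z -> Omega (H z),
           forall s, `[0, 1]%classic s -> H (s, 0) = g s,
           forall s, `[0, 1]%classic s -> H (s, 1) = g 0 &
           forall t, `[0, 1]%classic t -> H (0, t) = g 0 /\ H (1, t) = g 0]).

Definition convex_polytope Omega := Omega !=set0 /\
  exists (m : nat) (p : 'I_m -> E), Omega = (conv_hull p [set: 'I_m])°.

Definition admissible_domain Omega :=
  [/\ open Omega, bounded_set Omega, Omega !=set0, simply_connected Omega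
    & smooth_boundary Omega] \/ convex_polytope Omega.

End Domains.

Section Lebesgue_spaces.
Context {R : realType} {d : nat}.
Local Notation E := 'rV[R]_d.
Local Notation mu := (lebesgue_rV R d).
Implicit Types Omega : set E.

Definition L2 Omega (g : E -> R) := measurable_fun Omega g /\
  (\int[mu]_(x in Omega) ((g x) ^+ 2)%:E < +oo)%E.

Definition L2_0 Omega (q : E -> R) := L2 Omega q /\ \int[mu]_(x in Omega) q x = 0.

Definition L2v Omega (v : E -> E) := forall i, L2 Omega (fun x => v x ord0 i).

Definition ipL2 Omega (v w : E -> E) : R :=
  \int[mu]_(x in Omega) mxdot (v x) (w x).

Definition normL2 Omega (q : E -> R) : R :=
  Num.sqrt (\int[mu]_(x in Omega) (q x) ^+ 2).

Definition normL2v Omega (v : E -> E) : R := Num.sqrt (ipL2 Omega v v).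

Definition ae_zero Omega (v : E -> E) :=
  {ae mu, forall x, Omega x -> v x = 0}.

(* Compactly supported C^1 test functions determine the same weak divergence as
   smooth ones. *)
Definition support_closure (phi : E -> R) : set E :=
  closure [set x | phi x != 0].

Definition test_fun (phi : E -> R) :=
  [/\ forall x, differentiable phi x,
      forall i, continuous (partial i phi)
    & compact (support_closure phi)].

Definition is_weak_div Omega (w : E -> E) (g : E -> R) :=
  forall phi, test_fun phi -> support_closure phi `<=` Omega ->
  \int[mu]_(x in Omega) mxdot (w x) (gradient phi x) =
  - \int[mu]_(x in Omega) (g x * phi x).

(* <w . n, phi> over the boundary, defined by Green's formula for w with
   weak divergence g. *)
Definition normal_trace Omega (w : E -> E) (g phi : E -> R) : R :=
  \int[mu]_(x in Omega) mxdot (w x) (gradient phi x) +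
  \int[mu]_(x in Omega) (g x * phi x).

Definition H0div Omega (w : E -> E) := L2v Omega w /\
  exists g, [/\ L2 Omega g, is_weak_div Omega w g &
                forall phi, test_fun phi -> normal_trace Omega w g phi = 0].

(* The weak divergence in L^2, unique almost everywhere. *)
Definition weak_div Omega (w : E -> E) : E -> R :=
  xget (fun=> 0) [set g | L2 Omega g /\ is_weak_div Omega w g].

End Lebesgue_spaces.

(* Cells and facets are represented by their vertex sets. For a facet F,
   plus F and minus F are K^+ and K^- (on a boundary facet only plus F is
   meaningful and is the adjacent cell), and normal F is n_F. *)
Record mesh (R : realType) (d : nat) (V : finType) := Mesh {
  vtx : V -> 'rV[R]_d;
  cells : {set {set V}};
  plus : {set V} -> {set V};
  minus : {set V} -> {set V};
  normal : {set V} -> 'rV[R]_d }.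

Section Meshes.
Context {R : realType} {d : nat} {V : finType}.
Local Notation E := 'rV[R]_d.
Variable M : mesh R d V.
Implicit Types (K F S : {set V}).

Definition hull S : set E := conv_hull (vtx M) S.

Definition vertices S : seq E := [seq vtx M v | v <- enum S].

Definition edges m S : 'M[R]_(m, d) :=
  \matrix_(i < m) ((vertices S)`_i.+1 - (vertices S)`_0).

Definition cells_at F : {set {set V}} := [set K in cells M | F \subset K].

Definition facets : {set {set V}} :=
  [set F : {set V} | (#|F| == d) && (cells_at F != finset.set0)].

Definition interior_facet F := (1 < #|cells_at F|)%N.

(* Conformity, stated as K ∩ K' = the common face, excludes hanging nodes. *)
Definition simplicial_partition (Omega : set E) :=
  [/\ forall K, K \in cells M -> #|K| = d.+1 /\ row_free (edges d K),
      forall K K', K \in cells M -> K' \in cells M ->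
        hull K `&` hull K' = hull (K :&: K')%SET
    & closure Omega = \bigcup_(K in [set` cells M]) hull K].

Definition shape_regular (kappa : R) :=
  forall K, K \in cells M -> diameter (hull K) <= kappa * inradius (hull K).

Definition facet_data :=
  forall F, F \in facets ->
  [/\ plus M F \in cells_at F,
      interior_facet F -> minus M F \in cells_at F /\ minus M F != plus M F,
      enorm (normal M F) = 1,
      forall x y, hull F x -> hull F y -> mxdot (normal M F) (x - y) = 0
    & ~~ interior_facet F ->
      forall x y, hull (plus M F) x -> hull F y -> mxdot (normal M F) (x - y) <= 0].

Definition hF F : R := diameter (hull F).

(* Surface integral over a facet through its affine parametrization by the
   reference simplex; the square root is the area element. *)
Definition ref_simplex m : set 'rV[R]_m :=
  [set t | (forall i, 0 <= t ord0 i) /\ \sum_i t ord0 i <= 1].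

Definition facet_int F (g : E -> R) : R :=
  let e := edges d.-1 F in
  Num.sqrt (\det (e *m e^T)) *
  \int[lebesgue_rV R d.-1]_(t in @ref_simplex d.-1) g ((vertices F)`_0 + t *m e).

Definition broken_int (g : E -> R) : R :=
  \sum_(K in cells M) \int[lebesgue_rV R d]_(x in (hull K)°) g x.

Section Traces.
Context {W : normedModType R}.

(* Discrete functions have values fixed only in the open cells; the trace is
   the limit from inside the cell. *)
Definition trace K (g : E -> W) (x : E) : W :=
  lim (g y @[y --> within (hull K)° (nbhs x)]).

Definition jump F (g : E -> W) (x : E) : W :=
  if interior_facet F then trace (plus M F) g x - trace (minus M F) g x
  else trace (plus M F) g x.

Definition avg F (g : E -> W) (x : E) : W :=
  if interior_facet F
  then 2^-1 *: (trace (plus M F) g x + trace (minus M F) g x)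
  else trace (plus M F) g x.

End Traces.

(* In 'J w x the row index is the differentiation index, so that
   n *m 'J w x is the derivative of w in direction n. Evaluated in open cells,
   'J w and div are the elementwise gradient and divergence. *)
Definition div (w : E -> E) (x : E) : R := \tr ('J w x).

Definition avg_flux F (w : E -> E) (x : E) : E :=
  normal M F *m avg F (fun y => 'J w y) x.

Definition normal_jump F (w : E -> E) (x : E) : R :=
  mxdot (jump F w x) (normal M F).

Section Forms.
Variable sigma : R.
Implicit Types (w v : E -> E) (q : E -> R).

Definition a_h w v : R :=
  broken_int (fun x => mxdot ('J w x) ('J v x))
  + \sum_(F in facets)
      sigma / hF F * facet_int F (fun x => mxdot (jump F w x) (jump F v x))
  - \sum_(F in facets) facet_int F (fun x => mxdot (avg_flux F w x) (jump F v x))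
  - \sum_(F in facets) facet_int F (fun x => mxdot (jump F w x) (avg_flux F v x)).

Definition b_h w q : R :=
  - broken_int (fun x => q x * div w x)
  + \sum_(F in facets) facet_int F (fun x => avg F q x * normal_jump F w x).

Definition j_h w v : R :=
  \sum_(F in facets)
    (hF F)^-1 * facet_int F (fun x => normal_jump F w x * normal_jump F v x).

Definition energy_norm w : R :=
  Num.sqrt (broken_int (fun x => mxdot ('J w x) ('J w x))
    + \sum_(F in facets)
        sigma / hF F * facet_int F (fun x => mxdot (jump F w x) (jump F w x))).

End Forms.
End Meshes.

Definition b_cont {R : realType} {d : nat} (Omega : set 'rV[R]_d)
    (w : 'rV[R]_d -> 'rV[R]_d) (q : 'rV[R]_d -> R) : R :=
  - \int[lebesgue_rV R d]_(x in Omega) (q x * weak_div Omega w x).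

Section Spaces.
Context {R : realType} {d : nat} {V : finType}.
Local Notation E := 'rV[R]_d.
Variables (Omega : set E) (M : mesh R d V) (k : nat).

Definition poly_on (m : nat) (A : set E) (g : E -> R) :=
  exists c : {ffun 'I_d -> 'I_m.+1} -> R, forall x, A x ->
    g x = \sum_(a : {ffun 'I_d -> 'I_m.+1} | (\sum_i a i <= m)%N)
            c a * \prod_i x ord0 i ^+ a i.

Definition V_h : set (E -> E) :=
  [set v | L2v Omega v /\ forall K, K \in cells M ->
     forall i, poly_on k (hull M K)° (fun x => v x ord0 i)].

Definition Q_h : set (E -> R) :=
  [set q | L2_0 Omega q /\ forall K, K \in cells M ->
     poly_on k.-1 (hull M K)° q].

Definition W_h : set (E -> E) := V_h `&` H0div Omega.

Definition nonzero : set (E -> E) := ~` ae_zero Omega.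

Definition coercive (sigma Cs : R) := forall v, V_h v ->
  Cs * energy_norm M sigma v ^+ 2 <= a_h M sigma v v.

Definition inf_sup_stable (sigma beta : R) := forall q, Q_h q ->
  let supW := sup [set b_cont Omega w q / energy_norm M sigma w
                  | w in W_h `&` nonzero] in
  let supV := sup [set b_h M v q / energy_norm M sigma v
                  | v in V_h `&` nonzero] in
  beta * normL2 Omega q <= supW /\ supW <= supV.

Definition stabilized_DG (sigma nu gamma : R) (f u : E -> E) (p : E -> R) :=
  [/\ V_h u, Q_h p & forall v q, V_h v -> Q_h q ->
    nu * a_h M sigma u v + b_h M v p + gamma * j_h M u v = ipL2 Omega f v /\
    - b_h M u q = 0].

Definition Hdiv_DG (sigma nu : R) (f u : E -> E) (p : E -> R) :=
  [/\ W_h u, Q_h p & forall w q, W_h w -> Q_h q ->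
    nu * a_h M sigma u w + b_cont Omega w p - b_cont Omega u q = ipL2 Omega f w].

End Spaces.

(* Main.v *)
(* The error e = u_h - uhat_h satisfies b_h(e, q) = 0 for all q in Q_h and
   a_h(e, w) = 0 for all divergence-free w in W_h, since j_h vanishes on W_h; let X be
   the space of fields in V_h with these two properties. Testing the stabilized equation
   with e gives gamma j_h(e, e) <= (f, e). A field of X with zero normal jumps belongs to
   W_h, hence is a_h-orthogonal to itself and has zero energy by coercivity; the stabilized
   equation then shows that (f, .) vanishes on it as well. X being finite-dimensional up to
   null sets, the energy norm is therefore at most C1 sqrt(j_h) on X, and |(f, .)| at most
   C2 ||f|| sqrt(j_h), so that sqrt(j_h(e, e)) <= C2 ||f|| / gamma and the velocity
   estimate follows. On W_h, b(w, p_h - phat_h) = - nu a_h(e, w), and the inf-sup condition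
   yields the pressure estimate.

   That W_h consists of the fields of V_h without normal jumps is Green's formula: summed
   over the cells, it leaves integrals of normal jumps over the facets, and a facet is
   isolated from the others by a bump function. Cutting test functions off inside a cell
   identifies the weak divergence with the elementwise one. *)

(* The constant must be fixed before [nu], [gamma] and [f], yet [(f, .)] is known to vanish on the
   kernel of [j_h] only because a discrete solution exists. Therefore a finite [j_h]-orthogonal
   family spanning the defect space is chosen first. A seminorm vanishing on the kernel is bounded
   by the sum of its values on the family divided by the [j_h]-lengths; for [|(f, .)|],
   Cauchy-Schwarz on each member extracts the norm of [f]. In the Gram-Schmidt process used instead,
   members of length 0 contribute nothing. The same device with the energy form as reference makes
   [a_h] continuous without inverse or trace inequalities, at the price of a mesh-dependent
   constant.

   Recovering normal jumps from the weak identities of [H0div] requires that the facet terms of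
   neighbouring cells combine into jumps. This rests on a geometric fact extracted from conformity
   alone: two cells with a common facet lie on opposite sides of it, so that their conormals are
   opposite and at most two cells meet there. *)
Require Import Defs.
From HB Require Import structures.
From mathcomp Require Import all_boot all_order all_algebra fingroup perm.
From mathcomp Require Import all_classical all_reals all_analysis.
From mathcomp Require Import measurable_realfun ring lra.
Set Implicit Arguments.
Unset Strict Implicit.
Unset Printing Implicit Defensive.
Import Order.TTheory GRing.Theory Num.Theory.
Import numFieldNormedType.Exports.
Local Open Scope classical_set_scope.
Local Open Scope ring_scope.

(** * Lebesgue measure on row vectors *)

Section MeasurabilityRV.
Context {R : realType}.

Lemma rV_ball n (x y : 'rV[R]_n) (e : R) : 0 < e ->
  ball x e y <-> forall i, `|x ord0 i - y ord0 i| < e.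
Proof.
move=> e0; split=> [[_ xy] i|xy]; first exact: xy.
by split=> // a i; rewrite (ord1 a); exact: xy.
Qed.

Lemma measurable_rV_ball n (x : 'rV[R]_n) (e : R) : measurable (ball x e).
Proof.
have [e0|e0] := ltP 0 e; last first.
  rewrite (_ : ball x e = set0) ?predeqE // => y; split=> // -[].
  by rewrite ltNge e0.
have -> : ball x e = \bigcap_(i in setT)
    [set y : 'rV[R]_n | `|x ord0 i - y ord0 i| < e].
  rewrite predeqE => y; rewrite rV_ball //.
  by split=> [h i _|h i]; [exact: h|exact: (h i I)].
apply: fin_bigcap_measurable => // i _.
rewrite (_ : mkset _ = (fun y : 'rV[R]_n => y ord0 i) @^-1` (ball (x ord0 i) e)) //.
rewrite -[X in measurable X]setTI; apply: (measurable_coord i) => //.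
by rewrite ball_itv; exact: measurable_itv.
Qed.

(** Measurability refers to the coordinates, not to the topology. The balls with rational centre and
    radius [1 / (m + 1)] form a countable base that links the two. *)
Lemma open_measurable_rV n (A : set 'rV[R]_n) : open A -> measurable A.
Proof.
move=> oA; pose B (z : 'rV[rat]_n * nat) := ball (map_mx ratr z.1 : 'rV[R]_n) z.2.+1%:R^-1.
have -> : A = \bigcup_(z in [set z | B z `<=` A]) B z.
  rewrite predeqE => x; split=> [Ax|[z /= zA Bz]]; last exact: zA.
  have /nbhs_ballP[e /= e0 eA] : nbhs x A by move: oA; rewrite openE; exact.
  have [m me] : exists m : nat, m.+1%:R^-1 < e / 2.
    have e2 : 0 < e / 2 by rewrite divr_gt0.
    near \oo => m; exists m; near: m.
    exact: (near_infty_natSinv_lt (PosNum e2)).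
  have m0 : 0 < m.+1%:R^-1 :> R by rewrite invr_gt0.
  have qx i : exists q : rat, `|ratr q - x ord0 i| < m.+1%:R^-1.
    have /rat_in_itvoo[q] : x ord0 i - m.+1%:R^-1 < x ord0 i + m.+1%:R^-1.
      by rewrite ltrBlDr -addrA ltrDl addr_gt0.
    by rewrite in_itv /= => qi; exists q; rewrite ltr_distl.
  pose q : 'rV[rat]_n := \row_i sval (cid (qx i)).
  have qxb : B (q, m) x.
    by apply/(rV_ball _ _ m0) => i; rewrite !mxE; case: cid.
  exists (q, m) => //= y /(rV_ball _ _ m0) qy; apply: eA.
  apply/rV_ball => // i; move/(rV_ball _ _ m0) : qxb => /(_ i) qi.
  rewrite -(subrKA (ratr (q ord0 i))) (le_lt_trans (ler_normD _ _)) //.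
  rewrite [e]splitr ltrD //; apply: lt_trans me.
    by rewrite distrC; move: qi; rewrite !mxE.
  by move: (qy i); rewrite !mxE.
rewrite bigcup_mkcond; apply: countable_bigcupT_measurable => // z.
by case: ifP => _; [exact: measurable_rV_ball|exact: measurable0].
Unshelve. all: by end_near. Qed.

Lemma closed_measurable_rV n (A : set 'rV[R]_n) : closed A -> measurable A.
Proof.
move=> cA; rewrite -(setCK A); apply: measurableC; apply: open_measurable_rV.
exact: closed_openC.
Qed.

Lemma continuous_measurable_rV n (f : 'rV[R]_n -> R) :
  continuous f -> measurable_fun setT f.
Proof.
move=> /continuousP cf; apply: (measurability _ (RGenOpens.measurableE R)).
move=> _ [_ [a [b ->] <-]]; rewrite setTI; apply: open_measurable_rV.
exact/cf/interval_open.
Qed.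

End MeasurabilityRV.

Section Tonelli.
Context {R : realType}.
Local Notation leb := (@lebesgue_measure R).
Local Open Scope ereal_scope.

(** The hypothesis on [mu] says that it is [c] times its own image under [phi], so the formula
    combines those for pushforwards and for scaled measures. *)
Lemma ge0_integral_scaled_preimage d (T : measurableType d)
    (mu : {measure set T -> \bar R}) (phi : T -> T) (c : {nonneg R}) :
  measurable_fun setT phi ->
  (forall A, measurable A -> c%:num%:E * mu (phi @^-1` A) = mu A) ->
  forall f : T -> \bar R, measurable_fun setT f -> (forall x, 0 <= f x) ->
  \int[mu]_x f x = c%:num%:E * \int[mu]_x f (phi x).
Proof.
move=> mphi cmu f mf f0.
have := @ge0_integral_pushforward _ _ _ _ _ _ mphi mu setT f measurableT mf
  (fun x _ => f0 x).
rewrite preimage_setT /= => <-.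
rewrite -(ge0_integral_mscale (pushforward mu phi) measurableT c) //.
by apply: eq_measure_integral => A mA _; rewrite -cmu.
Qed.

(** Uniqueness of Lebesgue measure: the scaled pushforward has the right value on every interval
    []x, y]]. *)
Lemma lebesgue_affine_preimage (a b : R) (A : set R) : (a != 0)%R ->
  measurable A ->
  (`|a|%:E * leb ((fun s => a * s + b)%R @^-1` A)) = leb A.
Proof.
move=> a0 mA.
pose phi (s : measurableTypeR R) : measurableTypeR R := (a * s + b)%R.
have mphi : measurable_fun setT phi.
  by apply: measurable_funD => //; exact: measurable_funM.
pose c : {nonneg R} := NngNum (normr_ge0 a).
pose m : {measure set (measurableTypeR R) -> \bar R} :=
  mscale c (pushforward leb phi).
suff -> : leb A = m mphi A by [].
apply: lebesgue_measure_unique => // _ [[x y]] _ <-.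
change (leb `]x, y]%classic = `|a|%:E * leb (phi @^-1` `]x, y]%classic)).
have [ap|an] : (0 < a \/ a < 0)%R by apply/orP; rewrite -neq_lt eq_sym.
  rewrite (_ : _ @^-1` _ = `]((x - b) / a)%R, ((y - b) / a)%R]%classic); last first.
    rewrite predeqE => s /=; rewrite !in_itv /=.
    by rewrite ltr_pdivrMr // ler_pdivlMr // ltrBlDr lerBrDr mulrC.
  rewrite !lebesgue_measure_itv /= !lte_fin ltr_pM2r ?invr_gt0 // ltrD2r.
  case: ifP => xy; last by rewrite mule0.
  by rewrite gtr0_norm // -!EFinB -EFinM; congr EFin; field.
(* A decreasing map exchanges the open and the closed end of the interval. *)
rewrite (_ : _ @^-1` _ = `[((y - b) / a)%R, ((x - b) / a)%R[%classic); last first.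
  rewrite predeqE => s /=; rewrite !in_itv /=.
  by rewrite ler_ndivrMr // ltr_ndivlMr // ltrBlDr lerBrDr mulrC andbC.
rewrite !lebesgue_measure_itv /= !lte_fin ltr_nM2r ?invr_lt0 // ltrD2r.
case: ifP => xy; last by rewrite mule0.
by rewrite ltr0_norm // -!EFinB -EFinM; congr EFin; field.
Qed.

Lemma ge0_lebesgue_affine (a b : R) (f : R -> \bar R) : (a != 0)%R ->
  measurable_fun setT f -> (forall x, 0 <= f x) ->
  \int[leb]_s f s = `|a|%:E * \int[leb]_s f (a * s + b)%R.
Proof.
move=> a0 mf f0.
apply: (@ge0_integral_scaled_preimage _ (measurableTypeR R) leb
  (fun s => a * s + b)%R (NngNum (normr_ge0 a))) => //.
  apply: measurable_funD => //; exact: measurable_funM.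
by move=> A mA; exact: lebesgue_affine_preimage.
Qed.

Section Cons.
Variable n : nat.
Implicit Type f : 'rV[R]_n.+1 -> \bar R.

Lemma measurable_fun_cons_rv f : measurable_fun setT f ->
  measurable_fun setT (f \o @cons_rv R n).
Proof. by move=> mf; exact: measurableT_comp mf (@measurable_cons_rv R n). Qed.

Lemma ge0_integral_cons_rv f : measurable_fun setT f -> (forall x, 0 <= f x) ->
  \int[lebesgue_rV R n.+1]_x f x =
  \int[leb \x lebesgue_rV R n]_z f (cons_rv z).
Proof.
move=> mf f0.
pose phi (z : measurableTypeR R * 'rV[R]_n) : 'rV[R]_n.+1 := cons_rv z.
have mphi : measurable_fun setT phi by exact: measurable_cons_rv.
have := ge0_integral_pushforward mphi (leb \x lebesgue_rV R n) measurableT mf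
  (fun x _ => f0 x).
by rewrite preimage_setT => <-; apply: eq_measure_integral.
Qed.

Lemma tonelli_rV2 f : measurable_fun setT f -> (forall x, 0 <= f x) ->
  \int[lebesgue_rV R n.+1]_x f x =
  \int[lebesgue_rV R n]_y \int[leb]_s f (cons_rv (s, y)).
Proof.
move=> mf f0; rewrite ge0_integral_cons_rv // fubini_tonelli2 //.
exact: measurable_fun_cons_rv.
Qed.

Lemma tonelli_rV1 f : measurable_fun setT f -> (forall x, 0 <= f x) ->
  \int[lebesgue_rV R n.+1]_x f x =
  \int[leb]_s \int[lebesgue_rV R n]_y f (cons_rv (s, y)).
Proof.
move=> mf f0; rewrite ge0_integral_cons_rv // fubini_tonelli1 //.
exact: measurable_fun_cons_rv.
Qed.

End Cons.
End Tonelli.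

(** * Linear and affine changes of variables *)

Section LinearChange.
Context {R : realType}.
Local Notation leb := (@lebesgue_measure R).
Local Open Scope ereal_scope.

Lemma measurable_affine_rV m n (A : 'M[R]_(m, n)) (b : 'rV[R]_n) :
  measurable_fun setT (fun x : 'rV[R]_m => (x *m A + b)%R).
Proof.
apply: measurable_rVP => i; under eq_fun do rewrite !mxE.
apply: measurable_funD => //; apply: measurable_sum => j.
by apply: measurable_funM => //; exact: measurable_coord.
Qed.

Lemma measurable_comp_affine_rV m n (A : 'M[R]_(m, n)) (b : 'rV[R]_n)
    (f : 'rV[R]_n -> \bar R) :
  measurable_fun setT f -> measurable_fun setT (fun x : 'rV[R]_m => f (x *m A + b)%R).
Proof. by move=> mf; exact: measurableT_comp mf (measurable_affine_rV A b). Qed.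

Lemma measurable_comp_lin_rV m n (A : 'M[R]_(m, n)) (f : 'rV[R]_n -> \bar R) :
  measurable_fun setT f -> measurable_fun setT (fun x : 'rV[R]_m => f (x *m A)%R).
Proof.
move=> mf; under eq_fun do rewrite -(addr0 (_ *m _)%R).
exact: measurable_comp_affine_rV.
Qed.

Lemma measurable_slice_rV1 n (f : 'rV[R]_n.+1 -> \bar R) y :
  measurable_fun setT f -> measurable_fun setT (fun s => f (cons_rv (s, y))).
Proof.
move=> mf; apply: (measurableT_comp (measurable_fun_cons_rv mf)).
exact: pair2_measurable.
Qed.

Lemma measurable_slice_rV2 n (f : 'rV[R]_n.+1 -> \bar R) s :
  measurable_fun setT f -> measurable_fun setT (fun y => f (cons_rv (s, y))).
Proof.
move=> mf; apply: (measurableT_comp (measurable_fun_cons_rv mf)).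
exact: pair1_measurable.
Qed.

Lemma measurable_integral_cons_rv1 n (f : 'rV[R]_n.+1 -> \bar R) :
  measurable_fun setT f -> (forall x, 0 <= f x) ->
  measurable_fun setT (fun y => \int[leb]_s f (cons_rv (s, y))).
Proof.
move=> mf f0; pose g (z : measurableTypeR R * 'rV[R]_n) := f (cons_rv z).
have mg : measurable_fun setT g by exact: measurable_fun_cons_rv.
by apply: (@measurable_fun_fubini_tonelli_G _ _ _ _ _ leb g) => // z; exact: f0.
Qed.

Lemma measurable_integral_cons_rv2 n (f : 'rV[R]_n.+1 -> \bar R) :
  measurable_fun setT f -> (forall x, 0 <= f x) ->
  measurable_fun setT (fun s => \int[lebesgue_rV R n]_y f (cons_rv (s, y))).
Proof.
move=> mf f0; pose g (z : measurableTypeR R * 'rV[R]_n) := f (cons_rv z).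
have mg : measurable_fun setT g by exact: measurable_fun_cons_rv.
by apply: (@measurable_fun_fubini_tonelli_F _ _ _ _ _ (lebesgue_rV R n) g) => // z; exact: f0.
Qed.

Lemma cons_rvD n (s t : R) (x y : 'rV[R]_n) :
  (cons_rv (s, x) + cons_rv (t, y) = cons_rv (s + t, x + y))%R.
Proof. by apply/rowP => i; rewrite !mxE; case: unliftP => [j|] _ /=; rewrite ?mxE. Qed.

Lemma cons_rv_row_mx n (s : R) (x : 'rV[R]_n) :
  cons_rv (s, x) = row_mx (s%:M : 'M[R]_1) x :> 'rV[R]_(1 + n).
Proof.
apply/rowP => i; rewrite !mxE; case: splitP => j ij.
  rewrite (_ : i = ord0) ?unlift_none /= ?mxE ?(ord1 j) //.
  by apply/val_inj; rewrite /= ij (ord1 j).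
by rewrite (_ : i = lift ord0 j) ?liftK //; apply/val_inj; rewrite /= ij.
Qed.

Lemma cons_rv_mul_ublock n (s a : R) (x b : 'rV[R]_n) (D : 'M[R]_n) :
  ((cons_rv (s, x) : 'rV_(1 + n)) *m block_mx a%:M b 0 D =
   cons_rv ((a * s)%R, (x *m D + s *: b)%R) :> 'rV[R]_(1 + n))%R.
Proof.
rewrite !cons_rv_row_mx mul_row_block mulmx0 addr0 -scalar_mxM mulrC.
by rewrite mul_scalar_mx addrC.
Qed.

Lemma cons_rv_mul_lblock n (s a : R) (x : 'rV[R]_n) (c : 'cV[R]_n) (D : 'M[R]_n) :
  ((cons_rv (s, x) : 'rV_(1 + n)) *m block_mx a%:M 0 c D =
   cons_rv ((a * s + (x *m c) ord0 ord0)%R, (x *m D)%R) :> 'rV[R]_(1 + n))%R.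
Proof.
rewrite !cons_rv_row_mx mul_row_block mulmx0 add0r -scalar_mxM mulrC.
by rewrite [in LHS](mx11_scalar (x *m c)) -raddfD.
Qed.

Lemma ge0_integral_rV_translation n (b : 'rV[R]_n) (f : 'rV[R]_n -> \bar R) :
  measurable_fun setT f -> (forall x, 0 <= f x) ->
  \int[lebesgue_rV R n]_x f x = \int[lebesgue_rV R n]_x f (x + b)%R.
Proof.
elim: n b f => [|n IH] b f mf f0.
  by apply: eq_integral => x _; rewrite (thinmx0 x) (thinmx0 b) addr0.
have mfb : measurable_fun setT (fun x : 'rV[R]_n.+1 => f (x + b)%R).
  have := measurable_comp_affine_rV 1%:M b mf.
  by under eq_fun do rewrite mulmx1.
have -> : b = cons_rv (b ord0 ord0, (uncons_rv b).2).
  apply/rowP => i; rewrite !mxE; case: unliftP => [j ->|->] //=.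
  by rewrite mxE.
set t := b ord0 ord0; set c := (uncons_rv b).2.
have mfb' : measurable_fun setT (fun x : 'rV[R]_n.+1 => f (x + cons_rv (t, c))%R).
  have := measurable_comp_affine_rV 1%:M (cons_rv (t, c)) mf.
  by under eq_fun do rewrite mulmx1.
rewrite !tonelli_rV2 //.
under [RHS]eq_integral => y _ do under eq_integral => s _ do
  rewrite cons_rvD.
pose h y := \int[leb]_s f (cons_rv (s, y)).
rewrite (IH c h); first last.
- by move=> y; exact: integral_ge0.
- exact: measurable_integral_cons_rv1.
apply: eq_integral => y _; rewrite /h.
rewrite (ge0_lebesgue_affine t (oner_neq0 _) (measurable_slice_rV1 (y + c)%R mf)) //.
by rewrite normr1 mul1e; apply: eq_integral => s _; rewrite mul1r.
Qed.

Definition linear_change n (A : 'M[R]_n) := forall f : 'rV[R]_n -> \bar R,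
  measurable_fun setT f -> (forall x, 0 <= f x) ->
  \int[lebesgue_rV R n]_x f x =
  `|\det A|%:E * \int[lebesgue_rV R n]_x f (x *m A)%R.

Lemma linear_changeM n (A B : 'M[R]_n) :
  linear_change A -> linear_change B -> linear_change (A *m B)%R.
Proof.
move=> hA hB f mf f0; rewrite hB // (hA (fun x => f (x *m B)%R)) //.
  rewrite muleA -EFinM -normrM det_mulmx mulrC.
  by under [in RHS]eq_integral do rewrite mulmxA.
exact: measurable_comp_lin_rV.
Qed.

(** For a fixed first coordinate [s], the others undergo [D] followed by the translation by
    [s *: b], so they are integrated first; the first coordinate is only scaled. *)
Lemma linear_change_ublock n (a : R) (b : 'rV[R]_n) (D : 'M[R]_n) :
  (a != 0)%R -> linear_change D ->
  linear_change (block_mx a%:M b 0 D : 'M[R]_(1 + n)).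
Proof.
move=> a0 hD f mf f0; rewrite tonelli_rV1 // tonelli_rV1 //; last first.
  exact: measurable_comp_lin_rV.
have det1 : \det (a%:M : 'M[R]_1) = a by rewrite det_scalar expr1.
rewrite det_ublock det1.
pose h s := \int[lebesgue_rV R n]_y f (cons_rv (s, y)).
have mh : measurable_fun setT h.
  exact: measurable_integral_cons_rv2.
rewrite (ge0_lebesgue_affine 0 a0 mh); last by move=> s; exact: integral_ge0.
rewrite normrM EFinM -muleA; congr (_ * _).
rewrite -ge0_integralZl //; first last.
- by move=> s _; exact: integral_ge0.
- apply: (@measurable_integral_cons_rv2 n
    (fun x : 'rV[R]_(1 + n) => f (x *m block_mx a%:M b 0 D)%R)) => //.
  exact: measurable_comp_lin_rV.
apply: eq_integral => s _; rewrite addr0 /h.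
under [in RHS]eq_integral do rewrite cons_rv_mul_ublock.
have ms := measurable_slice_rV2 (a * s)%R mf.
rewrite (ge0_integral_rV_translation (s *: b)%R ms) //.
rewrite (hD (fun y => f (cons_rv ((a * s)%R, (y + s *: b)%R)))) //.
by have := measurable_comp_affine_rV 1%:M (s *: b)%R ms;
  under eq_fun do rewrite mulmx1.
Qed.

(** Here the first coordinate is integrated first: for fixed [y] it undergoes the affine map sending
    [s] to [a * s + y *m c], and [D] acts on [y] alone. *)
Lemma linear_change_lblock n (a : R) (c : 'cV[R]_n) (D : 'M[R]_n) :
  (a != 0)%R -> linear_change D ->
  linear_change (block_mx a%:M 0 c D : 'M[R]_(1 + n)).
Proof.
move=> a0 hD f mf f0; rewrite tonelli_rV2 // tonelli_rV2 //; last first.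
  exact: measurable_comp_lin_rV.
have det1 : \det (a%:M : 'M[R]_1) = a by rewrite det_scalar expr1.
rewrite det_lblock det1.
pose h y := \int[leb]_s f (cons_rv (s, y)).
have mh : measurable_fun setT h.
  exact: measurable_integral_cons_rv1.
rewrite (hD h mh); last by move=> s; exact: integral_ge0.
rewrite normrM mulrC EFinM -muleA; congr (_ * _).
rewrite -ge0_integralZl //; first last.
- by move=> s _; exact: integral_ge0.
- apply: (@measurable_integral_cons_rv1 n
    (fun x : 'rV[R]_(1 + n) => f (x *m block_mx a%:M 0 c D)%R)) => //.
  exact: measurable_comp_lin_rV.
apply: eq_integral => y _; rewrite /h.
under [in RHS]eq_integral do rewrite cons_rv_mul_lblock.
rewrite (ge0_lebesgue_affine ((y *m c) ord0 ord0) a0) //.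
exact: measurable_slice_rV1.
Qed.

(* If the upper left entry vanishes, adding a suitable row to the first one makes
   it a pivot; then block elimination reduces to the Schur complement. *)
Lemma linear_change_unitmx n (A : 'M[R]_n) : A \in unitmx -> linear_change A.
Proof.
elim: n A => [A _ f mf f0|n IH A uA].
  rewrite det_mx00 normr1 mul1e; apply: eq_integral => x _.
  by rewrite (thinmx0 x) mul0mx.
have id1 : linear_change (1%:M : 'M[R]_n) by apply: IH; exact: unitmx1.
have pivot (B : 'M[R]_(1 + n)) : B \in unitmx -> (ulsubmx B ord0 ord0 != 0)%R ->
    linear_change B.
  move=> uB; set a := ulsubmx B ord0 ord0 => a0.
  pose S := (drsubmx B - dlsubmx B *m (a^-1 *: ursubmx B))%R.
  have BE : B = (block_mx 1%:M 0 (a^-1 *: dlsubmx B) 1%:M *m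
                 block_mx a%:M (ursubmx B) 0 S)%R.
    rewrite mulmx_block !mul1mx !mul0mx !addr0.
    rewrite mul_mx_scalar scalerA divff // scale1r /S.
    rewrite -scalemxAl -scalemxAr addrC subrK -[LHS]submxK.
    by congr block_mx; exact: mx11_scalar.
  have uS : S \in unitmx.
    move: uB; rewrite {1}BE unitmx_mul => /andP[_].
    by rewrite !unitmxE det_ublock unitrM => /andP[].
  rewrite BE; apply: linear_changeM.
    by apply: linear_change_lblock => //; exact: oner_neq0.
  by apply: linear_change_ublock => //; exact: IH.
have [a0|] := eqVneq (ulsubmx (A : 'M[R]_(1 + n)) ord0 ord0) 0%R; last exact: pivot.
have [i ci] : exists i, (dlsubmx (A : 'M[R]_(1 + n)) i ord0 != 0)%R.
  apply/existsP; rewrite -negb_forall; apply/negP => /forallP c0.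
  move: uA; rewrite unitmxE -[A](@submxK _ 1 n 1 n).
  rewrite (_ : ulsubmx _ = 0%R); last first.
    by apply/matrixP => k l; rewrite !ord1 a0 mxE.
  rewrite (_ : dlsubmx _ = 0%R); last first.
    by apply/matrixP => k l; rewrite ord1 (eqP (c0 k)) mxE.
  by rewrite (@det_ublock _ 1 n) det0 // mul0r unitr0.
pose U r := block_mx 1%:M r 0 1%:M : 'M[R]_(1 + n).
have AE : A = (U (- delta_mx 0 i)%R *m (U (delta_mx 0 i) *m A))%R.
  rewrite mulmxA mulmx_block !mul1mx !mul0mx !mulmx0 !mulmx1 !addr0 add0r subrr.
  by rewrite -scalar_mx_block mul1mx.
have hU r : linear_change (U r).
  by apply: linear_change_ublock => //; exact: oner_neq0.
rewrite AE; apply: linear_changeM => //; apply: pivot.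
  by rewrite unitmx_mul uA andbT unitmxE det_ublock !det1 mulr1 unitr1.
have ulU (B : 'M[R]_(1 + n)) r :
    ulsubmx (U r *m B)%R = (ulsubmx B + r *m dlsubmx B)%R.
  by rewrite -{1}[B]submxK mulmx_block block_mxKul mul1mx.
by rewrite ulU -rowE mxE a0 add0r mxE.
Qed.

Lemma ge0_integral_affine n (A : 'M[R]_n) (b : 'rV[R]_n) (f : 'rV[R]_n -> \bar R) :
  A \in unitmx -> measurable_fun setT f -> (forall x, 0 <= f x) ->
  \int[lebesgue_rV R n]_x f x =
  `|\det A|%:E * \int[lebesgue_rV R n]_x f (x *m A + b)%R.
Proof.
move=> uA mf f0; rewrite (ge0_integral_rV_translation b mf) //.
apply: (linear_change_unitmx uA) => //.
by have := measurable_comp_affine_rV 1%:M b mf; under eq_fun do rewrite mulmx1.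
Qed.

End LinearChange.

(** * Cubes, bounded sets and integrability of continuous functions *)

Section Cubes.
Context {R : realType}.
Variable n : nat.
Implicit Types (x y : 'rV[R]_n) (r : R) (D : set 'rV[R]_n).

(** The closed ball of the maximum norm: compact, unlike [ball], and a product of intervals. *)
Definition cube x r : set 'rV[R]_n := [set y | forall i, `|x ord0 i - y ord0 i| <= r].

Lemma subset_cube_ball x r e : r < e -> 0 < e -> cube x r `<=` ball x e.
Proof. by move=> re e0 y xy; apply/rV_ball => // i; exact: le_lt_trans re. Qed.

Lemma closed_cube x r : closed (cube x r).
Proof.
rewrite (_ : cube x r = \bigcap_(i in setT)
   ((fun y : 'rV[R]_n => `|x ord0 i - y ord0 i|) @^-1` [set t | t <= r])).
  apply: closed_bigI => i _; apply: (@preimage_closed _ _ (fun y : 'rV[R]_n => `|x ord0 i - y ord0 i|)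
    [set t | t <= r]); last exact: closed_le.
  move=> y _; apply: (@continuous_comp _ _ _
    (fun y : 'rV[R]_n => x ord0 i - y ord0 i) (@Num.Def.normr _ R)).
    apply: continuousB; first exact: cst_continuous.
    exact: coord_continuous.
  exact: norm_continuous.
by rewrite predeqE => y; split=> [h i _|h i]; [exact: h|exact: (h i I)].
Qed.

Lemma compact_cube x r : compact (cube x r).
Proof.
apply: (subclosed_compact (@closed_cube x r)
  (@rV_compact _ n (fun i => `[x ord0 i - r, x ord0 i + r]%classic) _)).
  by move=> i; exact: segment_compact.
by move=> y xy i /=; rewrite in_itv /= -ler_distlC; exact: xy.
Qed.

Lemma rV_norm_coord x i : `|x ord0 i| <= `|x|.
Proof.
have -> : `|x| = mx_norm x by [].
by rewrite mx_normrE; apply/bigmax_geP; right => /=; exists (ord0, i).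
Qed.

Lemma rV_norm_le x r : 0 <= r -> (forall i, `|x ord0 i| <= r) -> `|x| <= r.
Proof.
move=> r0 xr; have -> : `|x| = mx_norm x by [].
by rewrite mx_normrE; apply/bigmax_leP; split=> // -[i j] _; rewrite (ord1 i).
Qed.

Lemma bounded_set_cube D : bounded_set D <-> exists r, D `<=` cube 0 r.
Proof.
split=> [[M [_ MD]]|[r Dr]].
  exists (M + 1) => x Dx i; rewrite mxE sub0r normrN.
  apply: le_trans (rV_norm_coord x i) _; apply: MD Dx; by rewrite ltrDl.
exists (Num.max 0 r); split; first exact: num_real.
move=> M rM x /Dr xr; apply: rV_norm_le => [|i].
  by rewrite ltW // (le_lt_trans _ rM) // le_max lexx.
rewrite (le_trans _ (ltW rM)) // le_max; apply/orP; right.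
by move: (xr i); rewrite mxE sub0r normrN.
Qed.

Lemma bounded_continuous_cube (f : 'rV[R]_n -> R) r : continuous f ->
  exists M, forall x, cube 0 r x -> `|f x| <= M.
Proof.
move=> cf.
have ne : cube 0 `|r| !=set0 by exists 0 => i; rewrite subrr normr0.
have cw : {within cube 0 `|r|, continuous (fun x => `|f x|)}.
  apply: continuous_subspaceT => x.
  by apply: continuous_comp; [exact: cf|exact: norm_continuous].
have [c _ fc] := EVT_max_rV ne (@compact_cube 0 `|r|) cw.
exists `|f c| => x xr; apply: fc; rewrite inE => i.
by rewrite (le_trans (xr i)) // ler_norm.
Qed.

End Cubes.

Section CubeMeasure.
Context {R : realType}.
Local Open Scope ereal_scope.

Lemma measurable_cube n (x : 'rV[R]_n) (r : R) : measurable (cube x r).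
Proof. by apply: closed_measurable_rV; exact: closed_cube. Qed.

Lemma lebesgue_rV_cube n (x : 'rV[R]_n) (r : R) : (0 <= r)%R ->
  lebesgue_rV R n (cube x r) = ((r + r) ^+ n)%:E.
Proof.
move=> r0; elim: n x => [|n IH] x.
  rewrite /= diracE (_ : _ \in _) //; apply/mem_set => -[] //.
have -> : lebesgue_rV R n.+1 (cube x r) =
   (lebesgue_measure \x lebesgue_rV R n) (@cons_rv R n @^-1` cube x r) by [].
rewrite (_ : _ @^-1` _ = `[x ord0 ord0 - r, x ord0 ord0 + r]%classic%R `*`
    cube (uncons_rv x).2 r).
  rewrite product_measure1E //; last exact: measurable_cube.
  rewrite IH exprS EFinM; congr (_ * _).
  rewrite [LHS]lebesgue_measure_itv /= lte_fin.
  case: ltP => h; first by rewrite -EFinB; congr EFin; ring.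
  by congr EFin; move: h r0; lra.
rewrite predeqE => -[s y]; split=> [h|[/= hs hy] i].
  split=> /=; first by have := h ord0; rewrite mxE unlift_none /= in_itv /= -ler_distlC.
  by move=> j; have := h (lift ord0 j); rewrite !mxE liftK.
rewrite !mxE; case: unliftP => [j ->|->] /=; first by have := hy j; rewrite mxE.
by move: hs; rewrite in_itv /= -ler_distlC.
Qed.

Lemma lebesgue_rV_bounded_lty n (D : set 'rV[R]_n) : measurable D ->
  bounded_set D -> lebesgue_rV R n D < +oo.
Proof.
move=> mD /bounded_set_cube[r Dr].
have Dr' : D `<=` cube 0 `|r|%R.
  by move=> x /Dr xr i; rewrite (le_trans (xr i)) // ler_norm.
apply: le_lt_trans (ltry ((`|r| + `|r|) ^+ n)).
rewrite -(lebesgue_rV_cube (0 : 'rV[R]_n)) //; apply: le_measure => //; rewrite inE //.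
exact: measurable_cube.
Qed.

Lemma lebesgue_rV_open_gt0 n (D : set 'rV[R]_n) : open D -> D !=set0 ->
  0 < lebesgue_rV R n D.
Proof.
move=> oD [x Dx].
have /nbhs_ballP[e /= e0 eD] : nbhs x D by move: oD; rewrite openE; exact.
have e2 : (0 < e / 2)%R by rewrite divr_gt0.
apply: (@lt_le_trans _ _ (lebesgue_rV R n (cube x (e / 2)))).
  by rewrite lebesgue_rV_cube ?(ltW e2) // lte_fin exprn_gt0 // addr_gt0.
apply: le_measure; rewrite ?inE.
- exact: measurable_cube.
- exact: open_measurable_rV.
apply: subset_trans eD; apply: subset_cube_ball => //.
by rewrite ltr_pdivrMr // ltr_pMr // ltr1n.
Qed.

(** Continuity holds on the whole space, so [f] is bounded on a closed cube around [D]; this serves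
    for open cells as well as for closed simplices. *)
Lemma integrable_continuous_bounded n (D : set 'rV[R]_n) (f : 'rV[R]_n -> R) :
  measurable D -> bounded_set D -> continuous f ->
  (lebesgue_rV R n).-integrable D (EFin \o f).
Proof.
move=> mD bD cf; apply: measurable_bounded_integrable => //.
- exact: lebesgue_rV_bounded_lty.
- by apply: measurable_funTS; exact: continuous_measurable_rV.
have [r Dr] := (bounded_set_cube _).1 bD.
have [M fM] := bounded_continuous_cube r cf.
exists M; split; first exact: num_real.
by move=> N MN x Dx /=; rewrite (le_trans (fM _ (Dr _ Dx))) // ltW.
Qed.

End CubeMeasure.

Section AffineIntegral.
Context {R : realType}.
Variable n : nat.
Local Notation mu := (lebesgue_rV R n).

Lemma integrable_affine (A : 'M[R]_n) (b : 'rV[R]_n) (f : 'rV[R]_n -> \bar R) :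
  A \in unitmx -> mu.-integrable setT f ->
  mu.-integrable setT (fun x => f (x *m A + b)).
Proof.
move=> uA /integrableP[mf foo].
have mfA := measurable_comp_affine_rV A b mf.
apply/integrableP; split => //; move: foo.
rewrite (ge0_integral_affine b uA) //; last first.
  by apply: measurableT_comp.
have detA : 0 < `|\det A| by rewrite normr_gt0 -unitfE -unitmxE.
move=> h; rewrite ltey; apply/eqP => e; move: h; rewrite e.
by rewrite mulry gtr0_sg // mul1e ltxx.
Qed.

(** Extension by zero replaces [D] by the whole space, where the nonnegative formula applies to the
    positive and to the negative part. *)
Lemma Rintegral_affine (A : 'M[R]_n) (b : 'rV[R]_n) (D : set 'rV[R]_n)
    (f : 'rV[R]_n -> R) :
  A \in unitmx -> measurable D -> mu.-integrable D (EFin \o f) ->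
  \int[mu]_(x in D) f x =
  `|\det A| * \int[mu]_(x in [set x | D (x *m A + b)]) f (x *m A + b).
Proof.
move=> uA mD intf.
rewrite Rintegral_mkcond [in RHS]Rintegral_mkcond.
have -> : (fun x => f (x *m A + b)) \_ [set x | D (x *m A + b)] =
    (fun x => (f \_ D) (x *m A + b)).
  apply/funext => x; rewrite !patchE.
  by congr (if _ then _ else _); apply/idP/idP => /set_mem h; apply/mem_set.
have intg : mu.-integrable setT (EFin \o (f \_ D)).
  by rewrite -restrict_EFin; apply: (integrable_mkcond _ mD).1.
move: (f \_ D) intg => g intg.
have intA := integrable_affine b uA intg.
rewrite /Rintegral (_ : `|\det A| = fine `|\det A|%:E) // -fineM //; last first.
  exact: integrable_fin_num intA.
congr fine.
rewrite (integralE mu setT (EFin \o g)).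
rewrite (integralE mu setT (fun x => (EFin \o g) (x *m A + b))).
have detA : 0 < `|\det A| by rewrite normr_gt0 -unitfE -unitmxE.
have mg : measurable_fun setT (EFin \o g) by case/integrableP: intg.
rewrite (ge0_integral_affine b uA (measurable_funepos mg)) //.
rewrite (ge0_integral_affine b uA (measurable_funeneg mg)) //.
(* Multiplication distributes over a difference of extended reals once the subtrahend is finite,
   which integrability ensures for the negative part. *)
have mulB (P N : \bar R) : N \is a fin_num ->
    (`|\det A|%:E * P - `|\det A|%:E * N)%E = (`|\det A|%:E * (P - N))%E.
  by move=> Nfin; rewrite muleBr // fin_num_adde_defl // fin_numN.
rewrite -[RHS]mulB.
  congr (_ * _ - _ * _)%E; apply: eq_integral => x _.
    by rewrite !funeposE.
  by rewrite !funenegE.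
apply: integrable_fin_num => //.
exact: (integrable_funeneg _ intA).
Qed.

Lemma lebesgue_rV_affine (A : 'M[R]_n) (b : 'rV[R]_n) (D : set 'rV[R]_n) :
  A \in unitmx -> measurable D ->
  mu D = (`|\det A|%:E * mu [set x | D (x *m A + b)%R])%E.
Proof.
move=> uA mD.
have mD' : measurable [set x | D (x *m A + b)].
  by rewrite -[X in measurable X]setTI; apply: measurable_affine_rV.
have mind : measurable_fun setT (fun x : 'rV[R]_n => (\1_D x : R)%:E).
  by apply/measurable_EFinP.
have ind0 (x : 'rV[R]_n) : (0 <= (\1_D x : R)%:E)%E by rewrite lee_fin.
have := ge0_integral_affine b uA mind ind0.
rewrite integral_indic // setIT => ->; congr (_ * _)%E.
rewrite -[in RHS](setIT [set x | _]) -integral_indic //.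
Qed.

End AffineIntegral.

(** Bernoulli's inequality: the volume lost in a contraction by [1 - e] is at most linear in [e]. *)
Lemma expr_onem_ge {R : realType} (e : R) n : 0 <= e <= 1 ->
  1 - n%:R * e <= (1 - e) ^+ n.
Proof.
move=> /andP[e0 e1]; elim: n => [|n IH]; first by rewrite mul0r subr0 expr0.
rewrite exprS -[n.+1]add1n natrD mulrDl mul1r.
have : (1 - e) * (1 - n%:R * e) <= (1 - e) * (1 - e) ^+ n.
  by apply: ler_wpM2l => //; rewrite subr_ge0.
apply: le_trans.
have : 0 <= n%:R * e * e by rewrite !mulr_ge0.
nra.
Qed.

Section Shrinking.
Context {R : realType}.
Variable n : nat.
Local Notation mu := (lebesgue_rV R n).

(* A set that contains all the contractions of [A] towards [c] has full measure
   in [A], since contracting by [1 - e] multiplies volumes by [(1 - e) ^+ n]. *)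
Lemma lebesgue_rV_shrink (A B : set 'rV[R]_n) (c : 'rV[R]_n) :
  measurable A -> measurable B -> B `<=` A -> bounded_set A ->
  (forall e : R, 0 < e < 1 -> forall x, A x -> B ((1 - e) *: x + e *: c)) ->
  mu (A `\` B) = 0%E.
Proof.
move=> mA mB BA bA shr.
have bB : bounded_set B.
  move: bA => /bounded_set_cube[r Ar]; apply/bounded_set_cube; exists r.
  exact: subset_trans Ar.
have Afin : mu A \is a fin_num by rewrite ge0_fin_numE ?lebesgue_rV_bounded_lty.
have Bfin : mu B \is a fin_num by rewrite ge0_fin_numE ?lebesgue_rV_bounded_lty.
have key e : 0 < e < 1 -> (1 - n%:R * e) * fine (mu A) <= fine (mu B).
  move=> /andP[e0 e1].
  have e1' : 1 - e != 0 by rewrite subr_eq0 gt_eqF.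
  have uM : (1 - e)%:M \in @unitmx R n.
    by rewrite unitmxE det_scalar unitrX // unitfE.
  have pe : 0 <= (1 - e) ^+ n by rewrite exprn_ge0 // subr_ge0 ltW.
  apply: (@le_trans _ _ ((1 - e) ^+ n * fine (mu A))).
    by rewrite ler_wpM2r ?fine_ge0 // expr_onem_ge // !ltW.
  rewrite -lee_fin EFinM !fineK //.
  rewrite (lebesgue_rV_affine (e *: c) uM mB) det_scalar ger0_norm //.
  rewrite lee_wpmul2l ?lee_fin //; apply: le_measure; rewrite ?inE //.
    by rewrite -[X in measurable X]setTI; apply: measurable_affine_rV.
  by move=> x Ax /=; rewrite mul_mx_scalar; apply: shr => //; rewrite e0.
have AB : fine (mu A) <= fine (mu B).
  apply/ler_addgt0Pr => e e0.
  (* With [e' <= e / k] the loss [n * e' * mu A] stays below [e]; the [+ 1] keeps [k] positive when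
     the product vanishes. *)
  pose k := n%:R * fine (mu A) + 1.
  have k0 : 0 < k by rewrite ltr_wpDl // mulr_ge0 // fine_ge0.
  pose e' := Num.min (1 / 2) (e / k).
  have e'1 : 0 < e' < 1.
    rewrite lt_min gt_min !divr_gt0 //= ltr_pdivrMr // mul1r.
    by rewrite ltr1n.
  have := key _ e'1.
  have : e' * k <= e by rewrite -ler_pdivlMr // ge_min lexx orbT.
  move: e'1 => /andP[e'0 _]; rewrite /k.
  have := fine_ge0 (measure_ge0 mu A).
  nra.
have BA' : (mu B <= mu A)%E by apply: le_measure; rewrite ?inE.
have -> : mu (A `\` B) = (mu A - mu (A `&` B))%E.
  by apply: measureD => //; exact: lebesgue_rV_bounded_lty.
rewrite (setIidr BA) -(fineK Afin) -(fineK Bfin) -EFinB; congr EFin.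
apply/eqP; rewrite subr_eq0 eq_le AB /=.
by rewrite -lee_fin !fineK.
Qed.

End Shrinking.

Section FubiniCons.
Context {R : realType}.
Variable n : nat.
Local Notation leb := (@lebesgue_measure R).

(** Integrability is asked of every slice, not of almost every one: then the real inner integral
    agrees everywhere with the extended one that Fubini's theorem handles. *)
Lemma Rintegral_cons_rv (D : set 'rV[R]_n.+1) (f : 'rV[R]_n.+1 -> R) :
  measurable D -> (lebesgue_rV R n.+1).-integrable D (EFin \o f) ->
  (forall y, leb.-integrable [set s | D (cons_rv (s, y))]
     (fun s => (f (cons_rv (s, y)))%:E)) ->
  \int[lebesgue_rV R n.+1]_(x in D) f x =
  \int[lebesgue_rV R n]_y
     \int[leb]_(s in [set s | D (cons_rv (s, y))]) f (cons_rv (s, y)).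
Proof.
move=> mD intf intfy; rewrite Rintegral_mkcond.
have intg : (lebesgue_rV R n.+1).-integrable setT (EFin \o (f \_ D)).
  by rewrite -restrict_EFin; apply: (integrable_mkcond _ mD).1.
have {intfy} gy y : (\int[leb]_s ((f \_ D) (cons_rv (s, y)))%:E =
    (\int[leb]_(s in [set s | D (cons_rv (s, y))]) f (cons_rv (s, y)))%R%:E)%E.
  have mDy : measurable ([set s | D (cons_rv (s, y))] : set (measurableTypeR R)).
    have ms : measurable_fun setT (fun s : measurableTypeR R => cons_rv (s, y)).
      by apply: measurableT_comp (@measurable_cons_rv R n) _; exact: pair2_measurable.
    by rewrite -[X in measurable X]setTI; exact: ms.
  rewrite /Rintegral fineK; last exact: (integrable_fin_num mDy (intfy y)).
  rewrite [RHS]integral_mkcond; apply: eq_integral => s _.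
  rewrite !patchE (_ : (s \in [set s | _]) = (cons_rv (s, y) \in D)); last first.
    by apply/idP/idP => /set_mem h; apply/mem_set.
  by case: ifP.
move: (f \_ D) intg gy => g /integrableP[mg goo] gy.
rewrite /Rintegral; congr fine.
pose h (z : measurableTypeR R * 'rV[R]_n) := (g (cons_rv z))%:E.
have mh : measurable_fun setT h by exact: (measurable_fun_cons_rv mg).
have mcons : measurable_fun setT
    (fun z : measurableTypeR R * 'rV[R]_n => cons_rv z).
  exact: measurable_cons_rv.
have inth : (leb \x lebesgue_rV R n)%E.-integrable setT h.
  apply/integrableP; split => //; move: goo.
  by rewrite ge0_integral_cons_rv //; exact: measurableT_comp.
under [RHS]eq_integral => y _ do rewrite -gy.
rewrite -[RHS]/(\int[lebesgue_rV R n]_y fubini_G leb h y)%E.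
rewrite (integral21_prod_meas1 inth).
have := @integral_pushforward _ _ _ _ _ _ mcons (leb \x lebesgue_rV R n)%E setT
  (EFin \o g) mg.
rewrite preimage_setT => <- //.
Qed.

End FubiniCons.

(** * Calculus of C1 functions *)

Section SquarePlus.
Context {R : realType}.

(** Test functions have to be C1 only, so the squared positive part is regular enough to build every
    cutoff and bump. *)
Definition sqplus (t : R) : R := Num.max 0 t ^+ 2.

Lemma sqplus_ge0 t : 0 <= sqplus t. Proof. exact: sqr_ge0. Qed.

Lemma sqplus_eq0 t : t <= 0 -> sqplus t = 0.
Proof. by move=> t0; rewrite /sqplus max_l // expr0n. Qed.

Lemma sqplus_gt0 t : 0 < t -> 0 < sqplus t.
Proof. by move=> t0; rewrite /sqplus max_r ?exprn_gt0 // ltW. Qed.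

Lemma is_derive_sqplus (t : R) : is_derive t 1 sqplus (Num.max 0 t *+ 2).
Proof.
have [t0|t0|t0] := ltgtP 0 t.
- apply: (@near_eq_is_derive _ _ _ (fun s : R => s ^+ 2)).
    near=> s; rewrite /sqplus max_r // ltW //; near: s; exact: lt_nbhsr.
  by apply: is_derive_eq; rewrite [t%:A]mulr1.
- rewrite mul0rn.
  apply: (@near_eq_is_derive _ _ _ (cst 0)).
  near=> s; rewrite sqplus_eq0 // ltW //; near: s; exact: lt_nbhsl.
rewrite -{}t0 mul0rn.
(* At 0 the difference quotient is at most [|h|] in absolute value. *)
have cvg0 : h^-1 *: ((sqplus \o shift 0) (h *: 1) - sqplus 0) @[h --> 0^'] --> 0.
  apply/cvgrPdist_le => e e0; near=> h.
  rewrite sub0r normrN /= addr0 [h *: 1]mulr1 [sqplus 0]sqplus_eq0 // subr0.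
  have h0 : h != 0 by near: h; exact: nbhs_dnbhs_neq.
  have hle : `|sqplus h| <= `|h| ^+ 2.
    rewrite /sqplus normrX ler_sqr ?nnegrE //.
    by have [h1|h1] := leP 0 h; rewrite ?normr0.
  rewrite normrM normfV ler_pdivrMl ?normr_gt0 // (le_trans hle) // expr2 ler_wpM2l //.
  near: h; apply: dnbhs0_le => //.
by apply: DeriveDef; [apply/cvg_ex; exists 0|apply: cvg_lim].
Unshelve. all: by end_near. Qed.

Lemma continuous_sqplus' : continuous (fun t : R => Num.max 0 t *+ 2).
Proof.
have cmax : continuous (fun t : R => Num.max 0 t).
  move=> t; apply: (@continuous_max R R (cst 0) id) => //.
  exact: cst_continuous.
under eq_fun do rewrite mulr2n.
by move=> t; apply: continuousD; exact: cmax.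
Qed.

End SquarePlus.

Section ContinuousReal.
Context {R : realType} {T : topologicalType}.
Implicit Types f g : T -> R.

Lemma cont_add f g : continuous f -> continuous g -> continuous (fun x => f x + g x).
Proof. by move=> cf cg x; exact: (@continuousD _ _ _ f g x (cf x) (cg x)). Qed.

Lemma cont_mul f g : continuous f -> continuous g -> continuous (fun x => f x * g x).
Proof. by move=> cf cg x; exact: (@continuousM _ _ f g x (cf x) (cg x)). Qed.

Lemma cont_opp f : continuous f -> continuous (fun x => - f x).
Proof. by move=> cf x; exact: (@continuousN _ _ _ f x (cf x)). Qed.

Lemma cont_sub f g : continuous f -> continuous g -> continuous (fun x => f x - g x).
Proof. by move=> cf cg; apply: cont_add => //; exact: cont_opp. Qed.

Lemma cont_inv f : (forall x, f x != 0) -> continuous f ->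
  continuous (fun x => (f x)^-1).
Proof. by move=> f0 cf x; exact: (@continuousV _ _ f x (f0 x) (cf x)). Qed.

Lemma cont_cst (c : R) : continuous (fun _ : T => c).
Proof. exact: cst_continuous. Qed.

Lemma cont_sum (I : Type) (r : seq I) (P : pred I) (f : I -> T -> R) :
  (forall i, P i -> continuous (f i)) ->
  continuous (fun x => \sum_(i <- r | P i) f i x).
Proof.
move=> cf; elim: r => [|i r IH].
  by under eq_fun do rewrite big_nil; exact: cont_cst.
under eq_fun do rewrite big_cons.
by case: (boolP (P i)) => // Pi; apply: cont_add => //; exact: cf.
Qed.

End ContinuousReal.

Section C1Functions.
Context {R : realType} {d : nat}.
Local Notation E := 'rV[R]_d.
Implicit Types (g h : E -> R) (x v : E).

Definition C1 g := (forall x, differentiable g x) /\ forall i, continuous (partial i g).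

Lemma C1_differentiable g x : C1 g -> differentiable g x.
Proof. by case. Qed.

Lemma C1_continuous g : C1 g -> continuous g.
Proof. by move=> [dg _] x; exact: differentiable_continuous. Qed.

Lemma derive_partial g x v : differentiable g x ->
  'D_v g x = \sum_i v ord0 i * partial i g x.
Proof.
move=> dg; rewrite deriveE // [in LHS](row_sum_delta v) linear_sum.
by apply: eq_bigr => i _; rewrite linearZ /partial deriveE.
Qed.

Lemma partial_near i g h x : (\near x, g x = h x) -> partial i g x = partial i h x.
Proof. exact: near_eq_derive. Qed.

Lemma partial_cst i (c : R) x : partial i (cst c) x = 0.
Proof. exact: derive_cst. Qed.

Lemma partialD i g h x : differentiable g x -> differentiable h x ->
  partial i (fun x => g x + h x) x = partial i g x + partial i h x.
Proof. by move=> dg dh; apply: deriveD; exact: diff_derivable. Qed.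

Lemma partialM i g h x : differentiable g x -> differentiable h x ->
  partial i (fun x => g x * h x) x = g x * partial i h x + h x * partial i g x.
Proof. by move=> dg dh; apply: deriveM; exact: diff_derivable. Qed.

Lemma partial_coord i j x : partial i (fun y : E => y ord0 j) x = (i == j)%:R.
Proof.
rewrite /partial deriveE; last exact: differentiable_coord.
have lin : linear (fun y : E => y ord0 j) by move=> a u w; rewrite !mxE.
pose f : {linear E -> R} := HB.pack (fun y : E => y ord0 j)
  (GRing.isLinear.Build _ _ _ _ _ lin).
rewrite -[fun y => _]/(f : E -> R) diff_lin; last exact: coord_continuous.
by rewrite /= mxE eqxx eq_sym.
Qed.

Lemma C1_cst (c : R) : C1 (cst c).
Proof.
split=> [x|i]; first exact: differentiable_cst.
rewrite (_ : partial i _ = cst 0); first exact: cst_continuous.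
by apply/funext => x; rewrite partial_cst.
Qed.

Lemma C1_coord j : C1 (fun x => x ord0 j).
Proof.
split=> [x|i]; first exact: differentiable_coord.
rewrite (_ : partial i _ = cst (i == j)%:R); first exact: cst_continuous.
by apply/funext => x; rewrite partial_coord.
Qed.

Lemma C1D g h : C1 g -> C1 h -> C1 (fun x => g x + h x).
Proof.
move=> [dg cg] [dh ch]; split=> [x|i]; first exact: differentiableD.
rewrite (_ : partial i _ = fun x => partial i g x + partial i h x).
  exact: cont_add (cg i) (ch i).
by apply/funext => x; rewrite partialD.
Qed.

Lemma C1M g h : C1 g -> C1 h -> C1 (fun x => g x * h x).
Proof.
move=> g1 h1; move: (g1) (h1) => [dg cg] [dh ch].
split=> [x|i]; first exact: differentiableM.
rewrite (_ : partial i _ = fun x => g x * partial i h x + h x * partial i g x).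
  by apply: cont_add; apply: cont_mul => //; exact: C1_continuous.
by apply/funext => x; rewrite partialM.
Qed.

Lemma C1N g : C1 g -> C1 (fun x => - g x).
Proof.
move=> g1; rewrite (_ : (fun x => _) = fun x => cst (-1) x * g x).
  by apply: C1M => //; exact: C1_cst.
by apply/funext => x; rewrite mulN1r.
Qed.

Lemma C1B g h : C1 g -> C1 h -> C1 (fun x => g x - h x).
Proof. by move=> g1 h1; apply: C1D => //; exact: C1N. Qed.

Lemma C1_sum (I : Type) (r : seq I) (P : pred I) (g : I -> E -> R) :
  (forall i, P i -> C1 (g i)) -> C1 (fun x => \sum_(i <- r | P i) g i x).
Proof.
move=> g1; elim: r => [|i r IH].
  rewrite (_ : (fun x => _) = cst 0); first exact: C1_cst.
  by apply/funext => x; rewrite big_nil.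
case Pi : (P i).
  rewrite (_ : (fun x => _) = fun x => g i x + \sum_(i <- r | P i) g i x).
    by apply: C1D => //; exact: g1.
  by apply/funext => x; rewrite big_cons Pi.
rewrite (_ : (fun x => _) = fun x => \sum_(i <- r | P i) g i x) //.
by apply/funext => x; rewrite big_cons Pi.
Qed.

Lemma C1_prod (I : Type) (r : seq I) (P : pred I) (g : I -> E -> R) :
  (forall i, P i -> C1 (g i)) -> C1 (fun x => \prod_(i <- r | P i) g i x).
Proof.
move=> g1; elim: r => [|i r IH].
  rewrite (_ : (fun x => _) = cst 1); first exact: C1_cst.
  by apply/funext => x; rewrite big_nil.
case Pi : (P i).
  rewrite (_ : (fun x => _) = fun x => g i x * \prod_(i <- r | P i) g i x).
    by apply: C1M => //; exact: g1.
  by apply/funext => x; rewrite big_cons Pi.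
rewrite (_ : (fun x => _) = fun x => \prod_(i <- r | P i) g i x) //.
by apply/funext => x; rewrite big_cons Pi.
Qed.

Lemma C1X g n : C1 g -> C1 (fun x => g x ^+ n).
Proof.
move=> g1; elim: n => [|n IH].
  rewrite (_ : (fun x => _) = cst 1); first exact: C1_cst.
  by apply/funext => x; rewrite expr0.
rewrite (_ : (fun x => _) = fun x => g x * g x ^+ n); first exact: C1M.
by apply/funext => x; rewrite exprS.
Qed.

Lemma C1_comp (f f' : R -> R) g : (forall t : R, is_derive t 1 f (f' t)) ->
  {in range g, continuous f'} -> C1 g -> C1 (fun x => f (g x)).
Proof.
move=> df cf g1; have [dg cg] := g1.
have dfx t : differentiable f t by apply/derivable1_diffP; case: (df t).
split=> [x|i]; first exact: differentiable_comp.
rewrite (_ : partial i _ = fun x => f' (g x) * partial i g x).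
  apply: cont_mul; last exact: cg.
  move=> x; apply: (@continuous_comp _ _ _ g f'); first exact: C1_continuous.
  by apply: cf; rewrite inE; exists x.
apply/funext => x; rewrite /partial deriveE; last exact: differentiable_comp.
rewrite diff_comp // diff1E // derive1E /= -deriveE //.
by case: (df (g x)) => _ ->; rewrite mulrC.
Qed.

Lemma C1_sqplus g : C1 g -> C1 (fun x => sqplus (g x)).
Proof.
apply: (C1_comp is_derive_sqplus) => t _; exact: continuous_sqplus'.
Qed.

Lemma C1V g : (forall x, g x != 0) -> C1 g -> C1 (fun x => (g x)^-1).
Proof.
move=> g0 [dg cg]; have gc : continuous g by exact: C1_continuous.
split=> [x|i]; first exact: differentiableV.
rewrite (_ : partial i _ = fun x => - (g x)^-1 ^+ 2 * partial i g x).
  apply: cont_mul; last exact: cg.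
  rewrite (_ : (fun x => _) = fun x => (-1) * ((g x)^-1 * (g x)^-1)).
    by do 2 (apply: cont_mul; first by [exact: cst_continuous|exact: cont_inv]);
      exact: cont_inv.
  by apply/funext => x; rewrite mulN1r expr2.
apply/funext => x; rewrite /partial deriveV //; last exact: diff_derivable.
by rewrite exprVn.
Qed.

End C1Functions.

Section FrobeniusProduct.
Context {R : realType} {m n : nat}.
Implicit Types A B C : 'M[R]_(m, n).

Lemma mxdotE A B : mxdot A B = \sum_i \sum_j A i j * B i j.
Proof.
rewrite /mxdot /mxtrace; apply: eq_bigr => i _; rewrite mxE.
by apply: eq_bigr => j _; rewrite mxE.
Qed.

Lemma mxdotC A B : mxdot A B = mxdot B A.
Proof.
by rewrite !mxdotE; apply: eq_bigr => i _; apply: eq_bigr => j _; rewrite mulrC.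
Qed.

Lemma mxdotDl A B C : mxdot (A + B) C = mxdot A C + mxdot B C.
Proof. by rewrite /mxdot mulmxDl mxtraceD. Qed.

Lemma mxdotZl a A B : mxdot (a *: A) B = a * mxdot A B.
Proof. by rewrite /mxdot -scalemxAl mxtraceZ. Qed.

Lemma mxdotNl A B : mxdot (- A) B = - mxdot A B.
Proof. by rewrite -scaleN1r mxdotZl mulN1r. Qed.

Lemma mxdotBl A B C : mxdot (A - B) C = mxdot A C - mxdot B C.
Proof. by rewrite mxdotDl mxdotNl. Qed.

Lemma mxdotDr A B C : mxdot A (B + C) = mxdot A B + mxdot A C.
Proof. by rewrite mxdotC mxdotDl !(mxdotC _ A). Qed.

Lemma mxdotZr a A B : mxdot A (a *: B) = a * mxdot A B.
Proof. by rewrite mxdotC mxdotZl mxdotC. Qed.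

Lemma mxdotNr A B : mxdot A (- B) = - mxdot A B.
Proof. by rewrite mxdotC mxdotNl mxdotC. Qed.

Lemma mxdotBr A B C : mxdot A (B - C) = mxdot A B - mxdot A C.
Proof. by rewrite mxdotDr mxdotNr. Qed.

Lemma mxdot0l A : mxdot 0 A = 0.
Proof. by rewrite /mxdot mul0mx mxtrace0. Qed.

Lemma mxdot0r A : mxdot A 0 = 0.
Proof. by rewrite mxdotC mxdot0l. Qed.

Lemma mxdot_suml (I : Type) (r : seq I) (P : pred I) (F : I -> 'M[R]_(m, n)) A :
  mxdot (\sum_(i <- r | P i) F i) A = \sum_(i <- r | P i) mxdot (F i) A.
Proof.
elim/big_rec2 : _ => [|i x y _ <-]; first exact: mxdot0l.
by rewrite mxdotDl.
Qed.

Lemma mxdot_ge0 A : 0 <= mxdot A A.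
Proof.
rewrite mxdotE; apply: sumr_ge0 => i _; apply: sumr_ge0 => j _.
by rewrite -expr2 sqr_ge0.
Qed.

Lemma mxdot_eq0 A : mxdot A A = 0 -> A = 0.
Proof.
move/eqP; rewrite mxdotE psumr_eq0 => [/allP A0|i _]; last first.
  by apply: sumr_ge0 => j _; rewrite -expr2 sqr_ge0.
apply/matrixP => i j; have := A0 i (mem_index_enum i).
rewrite /= psumr_eq0 => [/allP/(_ j (mem_index_enum j))/=|k _]; last first.
  by rewrite -expr2 sqr_ge0.
by rewrite mulf_eq0 orbb mxE => /eqP.
Qed.

End FrobeniusProduct.

Lemma mxdot_rV {R : realType} n (x y : 'rV[R]_n) :
  mxdot x y = \sum_i x ord0 i * y ord0 i.
Proof. by rewrite mxdotE big_ord1. Qed.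

Section ContinuousMatrix.
Context {R : realType} {T : topologicalType} {m n : nat}.
Implicit Types A B : T -> 'M[R]_(m, n).

Lemma cont_mx A : (forall i j, continuous (fun x => A x i j)) -> continuous A.
Proof.
move=> cA x; apply/cvg_ballP => e e0; near=> y.
split=> //; near: y; apply: filter_forall => i; apply: filter_forall => j.
by have /cvg_ballP := cA i j x; apply.
Unshelve. all: by end_near. Qed.

Lemma cont_mx_coord A i j : continuous A -> continuous (fun x => A x i j).
Proof.
move=> cA x; apply: (@continuous_comp _ _ _ A (fun M => M i j)); first exact: cA.
exact: coord_continuous.
Qed.

Lemma cont_mxdot A B : continuous A -> continuous B ->
  continuous (fun x => mxdot (A x) (B x)).
Proof.
move=> cA cB; under eq_fun do rewrite mxdotE.
by apply: cont_sum => i _; apply: cont_sum => j _; apply: cont_mul;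
  exact: cont_mx_coord.
Qed.

End ContinuousMatrix.

(** Discrete fields coincide with a polynomial field only inside a cell; differentiability and the
    differential are inherited because they depend on the germ alone. *)
Lemma near_eq_diff {R : numFieldType} {V W : normedModType R} (f g : V -> W) (x : V) :
  (\near x, f x = g x) -> differentiable g x ->
  differentiable f x /\ 'd f x = 'd g x :> (V -> W).
Proof.
move=> fg dg; have [cg Eg] := (diff_locallyP x g).1 dg.
have fgx : f x = g x by exact: nbhs_singleton fg.
have Ef : f \o shift x = cst (f x) + 'd g x +o_ 0 id.
  apply/eqaddoP => e e0; have /eqaddoP/(_ e e0) := Eg.
  have : \forall h \near (0 : V), f (h + x) = g (h + x).
    by move: fg; rewrite (near_shift 0) subr0.
  move=> n1 n2; apply: filterS2 n1 n2 => h fgh.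
  by rewrite !fctE /= fgh fgx.
have dE : 'd f x = 'd g x :> (V -> W) by exact: diff_unique cg Ef.
by split; [apply/diff_locallyP; rewrite dE|].
Qed.

Section VectorFields.
Context {R : realType} {d : nat}.
Local Notation E := 'rV[R]_d.
Implicit Types (w g : E -> E) (x : E) (phi : E -> R).

Definition C1v w := forall j, C1 (fun x => w x ord0 j).

Lemma differentiable_rV w x :
  (forall j, differentiable (fun y => w y ord0 j) x) -> differentiable w x.
Proof.
move=> dw; rewrite (_ : w = \sum_(j < d) (fun y => w y ord0 j *: delta_mx ord0 j)).
  by apply: differentiable_sum => j; exact: differentiableZl.
apply/funext => y; rewrite [LHS]row_sum_delta.
by elim/big_ind2 : _ => // f1 f2 g1 g2 -> ->.
Qed.

Lemma C1v_differentiable w x : C1v w -> differentiable w x.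
Proof. by move=> w1; apply: differentiable_rV => j; exact: C1_differentiable. Qed.

Lemma C1v_continuous w : C1v w -> continuous w.
Proof. by move=> w1 x; apply: differentiable_continuous; exact: C1v_differentiable. Qed.

Lemma diff_coord x (j : 'I_d) :
  'd (fun y : E => y ord0 j) x = (fun y : E => y ord0 j) :> (E -> R).
Proof.
have lin : linear (fun y : E => y ord0 j) by move=> a u w; rewrite !mxE.
pose f : {linear E -> R} := HB.pack (fun y : E => y ord0 j)
  (GRing.isLinear.Build _ _ _ _ _ lin).
by rewrite -[fun y => _]/(f : E -> R) diff_lin; last exact: coord_continuous.
Qed.

Lemma jacobian_partial w x i j : differentiable w x ->
  'J w x i j = partial i (fun y => w y ord0 j) x.
Proof.
move=> dw; have dj : differentiable (fun y => w y ord0 j) x.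
  apply: (@differentiable_comp _ _ _ _ w (fun M : E => M ord0 j)) => //.
  exact: differentiable_coord.
rewrite /partial deriveE // (@diff_comp _ _ _ _ w (fun M : E => M ord0 j)) //.
  by rewrite diff_coord /= -deriveE // deriveEjacobian // -rowE [RHS]mxE.
exact: differentiable_coord.
Qed.

Lemma jacobian_near w g x : (\near x, w x = g x) -> differentiable g x ->
  differentiable w x /\ 'J w x = 'J g x.
Proof.
move=> wg dg; have [dw dE] := near_eq_diff wg dg.
by split; [exact: dw|exact: (congr1 (@lin1_mx R d d) dE)].
Qed.

Lemma C1v_jacobian w x i j : C1v w ->
  'J w x i j = partial i (fun y => w y ord0 j) x.
Proof. by move=> w1; apply: jacobian_partial; exact: C1v_differentiable. Qed.

Lemma C1v_continuous_jacobian w : C1v w -> continuous (fun x => 'J w x).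
Proof.
move=> w1; apply: cont_mx => i j.
under eq_fun do rewrite C1v_jacobian //.
by have [_] := w1 j; exact.
Qed.

Lemma C1vD w g : C1v w -> C1v g -> C1v (fun x => w x + g x).
Proof.
by move=> w1 g1 j; under eq_fun do rewrite mxE; apply: C1D; [exact: w1|exact: g1].
Qed.

Lemma C1vZ (c : R) w : C1v w -> C1v (fun x => c *: w x).
Proof.
move=> w1 j; under eq_fun do rewrite mxE.
by apply: (@C1M _ _ (cst c)); [exact: C1_cst|exact: w1].
Qed.

Lemma C1v_scale phi w : C1 phi -> C1v w -> C1v (fun x => phi x *: w x).
Proof.
by move=> p1 w1 j; under eq_fun do rewrite mxE; apply: C1M => //; exact: w1.
Qed.

Lemma C1_mxdot_cst w (c : E) : C1v w -> C1 (fun x => mxdot (w x) c).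
Proof.
move=> w1; under eq_fun do rewrite mxdot_rV; apply: C1_sum => i _.
by apply: C1M; [exact: w1|exact: (@C1_cst _ _ (c ord0 i))].
Qed.

Lemma C1v_div w x : C1v w -> div w x = \sum_i partial i (fun y => w y ord0 i) x.
Proof.
by move=> w1; rewrite /div /mxtrace; apply: eq_bigr => i _; rewrite C1v_jacobian.
Qed.

Lemma C1v_continuous_div w : C1v w -> continuous (div w).
Proof.
move=> w1; rewrite (_ : div w = fun x => \sum_i partial i (fun y => w y ord0 i) x).
  by apply: cont_sum => i _; have [_] := w1 i; exact.
by apply/funext => x; exact: C1v_div.
Qed.

Lemma C1_continuous_gradient phi : C1 phi -> continuous (gradient phi).
Proof.
move=> [_ cp]; apply: cont_mx => i j; rewrite /gradient.
by under eq_fun do rewrite mxE; exact: cp.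
Qed.

Lemma div_scale phi w x : C1 phi -> C1v w ->
  div (fun x => phi x *: w x) x = phi x * div w x + mxdot (w x) (gradient phi x).
Proof.
move=> p1 w1; rewrite !C1v_div //; last exact: C1v_scale.
rewrite mxdot_rV mulr_sumr -big_split /=; apply: eq_bigr => i _.
under [X in partial i X]eq_fun do rewrite mxE.
rewrite partialM; [by rewrite mxE|exact: C1_differentiable|].
exact: C1_differentiable.
Qed.

End VectorFields.

(** * Green's formula on a simplex *)

Section Barycentric.
Context {R : realType}.
Variable n : nat.
Local Notation simplex_n := (@ref_simplex R n).
Implicit Types (t : 'rV[R]_n) (i : 'I_n.+1).

(** Barycentric coordinates on the reference simplex: [ord0] stands for the origin and [lift ord0 j]
    for the [j]-th unit vector. *)
Definition bary t i : R :=
  if unlift ord0 i is Some j then t ord0 j else 1 - \sum_j t ord0 j.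

Definition of_bary (c : 'I_n.+1 -> R) : 'rV[R]_n := \row_j c (lift ord0 j).

Lemma bary0 t : bary t ord0 = 1 - \sum_j t ord0 j.
Proof. by rewrite /bary unlift_none. Qed.

Lemma bary_lift t j : bary t (lift ord0 j) = t ord0 j.
Proof. by rewrite /bary liftK. Qed.

Lemma sum_bary t : \sum_i bary t i = 1.
Proof.
rewrite big_ord_recl; under eq_bigr do rewrite bary_lift.
by rewrite bary0 subrK.
Qed.

Lemma bary_of_bary c : \sum_i c i = 1 -> bary (of_bary c) =1 c.
Proof.
move=> c1 i; case: (unliftP ord0 i) => [j ->|->].
  by rewrite bary_lift mxE.
rewrite bary0; under eq_bigr do rewrite mxE.
by rewrite -c1 big_ord_recl addrK.
Qed.

Lemma bary_inj s t : bary s =1 bary t -> s = t.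
Proof. by move=> st; apply/rowP => j; have := st (lift ord0 j); rewrite !bary_lift. Qed.

Lemma cont_bary i : continuous (bary ^~ i).
Proof.
rewrite /bary; case: (unlift ord0 i) => [j|]; first exact: coord_continuous.
apply: cont_sub; first exact: cont_cst.
by apply: cont_sum => j _; exact: coord_continuous.
Qed.

Definition open_simplex : set 'rV[R]_n := [set t | forall i, 0 < bary t i].

Lemma ref_simplexE : simplex_n = [set t | forall i, 0 <= bary t i].
Proof.
rewrite predeqE => t; split=> [[t0 t1] i|t0].
  by case: (unliftP ord0 i) => [j ->|->]; [rewrite bary_lift|rewrite bary0 subr_ge0].
split=> [j|]; first by rewrite -bary_lift.
by rewrite -subr_ge0 -bary0.
Qed.

Lemma sub_open_simplex : open_simplex `<=` simplex_n.
Proof. by rewrite ref_simplexE => t ot i; exact/ltW/ot. Qed.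

Lemma open_open_simplex : open open_simplex.
Proof.
rewrite openE => t ot.
apply: (@filter_forall _ 'I_n.+1 (fun i => [set s | 0 < bary s i]) (nbhs t)
  (nbhs_filter t)) => i.
have /open_nbhs_nbhs : open_nbhs (bary t i) [set r : R | 0 < r].
  by split; [exact: open_gt|exact: ot].
exact: cont_bary.
Qed.

Lemma closed_ref_simplex : closed simplex_n.
Proof.
rewrite ref_simplexE.
rewrite (_ : mkset _ = \bigcap_(i in setT) (bary ^~ i @^-1` [set r | 0 <= r])).
  apply: closed_bigI => i _; apply: preimage_closed => [t _|].
    exact: cont_bary.
  exact: closed_ge.
by rewrite predeqE => t; split=> [h i _|h i]; [exact: h|exact: (h i I)].
Qed.

Lemma bary_le1 t i : simplex_n t -> bary t i <= 1.
Proof.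
rewrite ref_simplexE => t0; rewrite -(sum_bary t) (bigD1 i) //= lerDl.
by apply: sumr_ge0 => j _; exact: t0.
Qed.

Lemma bounded_ref_simplex : bounded_set simplex_n.
Proof.
apply/bounded_set_cube; exists 1 => t St j.
rewrite mxE sub0r normrN -bary_lift ger0_norm ?bary_le1 //.
by move: St; rewrite ref_simplexE; exact.
Qed.

Lemma measurable_ref_simplex : measurable simplex_n.
Proof. by apply: closed_measurable_rV; exact: closed_ref_simplex. Qed.

Lemma measurable_open_simplex : measurable open_simplex.
Proof. by apply: open_measurable_rV; exact: open_open_simplex. Qed.

Definition barycenter : 'rV[R]_n := of_bary (fun=> n.+1%:R^-1).

Lemma bary_barycenter i : bary barycenter i = n.+1%:R^-1.
Proof.
by rewrite bary_of_bary // sumr_const card_ord -[_ *+ _]mulr_natl divff.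
Qed.

Lemma bary_comb (a b : R) s t i : a + b = 1 ->
  bary (a *: s + b *: t) i = a * bary s i + b * bary t i.
Proof.
move=> ab; case: (unliftP ord0 i) => [j ->|->]; first by rewrite !bary_lift !mxE.
rewrite !bary0.
under eq_bigr do rewrite !mxE.
by rewrite big_split /= -!mulr_sumr -[X in X - _ = _]ab; ring.
Qed.

(** Any proper contraction towards the barycenter makes all barycentric coordinates positive, so
    [lebesgue_rV_shrink] applies. *)
Lemma ref_simplex_boundary0 :
  lebesgue_rV R n (simplex_n `\` open_simplex) = 0%E.
Proof.
apply: (@lebesgue_rV_shrink _ _ _ _ barycenter).
- exact: measurable_ref_simplex.
- exact: measurable_open_simplex.
- exact: sub_open_simplex.
- exact: bounded_ref_simplex.
move=> e /andP[e0 e1] t; rewrite ref_simplexE => t0 i.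
rewrite bary_comb ?subrK // bary_barycenter ltr_wpDl //.
  by rewrite mulr_ge0 // subr_ge0 ltW.
by rewrite mulr_gt0 // invr_gt0.
Qed.

Lemma Rintegral_ref_simplex_open (f : 'rV[R]_n -> R) : continuous f ->
  \int[lebesgue_rV R n]_(t in simplex_n) f t =
  \int[lebesgue_rV R n]_(t in open_simplex) f t.
Proof.
move=> cf; rewrite /Rintegral; congr fine.
have mB : measurable (simplex_n `\` open_simplex).
  by apply: measurableD; [exact: measurable_ref_simplex|exact: measurable_open_simplex].
rewrite (negligible_integral mB measurable_ref_simplex _ ref_simplex_boundary0).
  by rewrite setDD (setIidr sub_open_simplex).
apply: integrable_continuous_bounded => //.
- exact: measurable_ref_simplex.
- exact: bounded_ref_simplex.
Qed.

Lemma ref_simplex_measure_gt0 : (0 < lebesgue_rV R n simplex_n)%E.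
Proof.
apply: (@lt_le_trans _ _ (lebesgue_rV R n open_simplex)).
  apply: lebesgue_rV_open_gt0; first exact: open_open_simplex.
  by exists barycenter => i; rewrite bary_barycenter invr_gt0.
apply: le_measure; rewrite ?inE.
- exact: measurable_open_simplex.
- exact: measurable_ref_simplex.
- exact: sub_open_simplex.
Qed.

End Barycentric.

Section SimplexPoint.
Context {R : realType}.
Variables (n m : nat).
Local Notation simplex_n := (@ref_simplex R n).
Implicit Types (y : 'I_n.+1 -> 'rV[R]_m) (t : 'rV[R]_n).

Definition simplex_pt y t : 'rV[R]_m := \sum_i bary t i *: y i.

Definition edge_mx y : 'M[R]_(n, m) := \matrix_(j < n) (y (lift ord0 j) - y ord0).

Lemma simplex_ptE y t : simplex_pt y t = t *m edge_mx y + y ord0.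
Proof.
rewrite /simplex_pt big_ord_recl mulmx_sum_row.
under [in RHS]eq_bigr do rewrite rowK scalerBr.
rewrite big_split /= sumrN -scaler_suml.
under [in LHS]eq_bigr do rewrite bary_lift.
rewrite bary0 scalerBl scale1r.
by rewrite [LHS]addrC [LHS]addrA [LHS]addrAC.
Qed.

Lemma cont_simplex_pt y : continuous (simplex_pt y).
Proof.
apply: cont_mx => i j; rewrite /simplex_pt.
under eq_fun do rewrite summxE.
apply: cont_sum => k _; under eq_fun do rewrite mxE.
by apply: cont_mul; [exact: cont_bary|exact: cont_cst].
Qed.

Definition int_simplex y (g : 'rV[R]_m -> R) : R :=
  \int[lebesgue_rV R n]_(t in simplex_n) g (simplex_pt y t).

Lemma integrable_simplex y (g : 'rV[R]_m -> R) : continuous g ->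
  (lebesgue_rV R n).-integrable simplex_n (fun t => (g (simplex_pt y t))%:E).
Proof.
move=> cg; apply: (@integrable_continuous_bounded _ _ _ (g \o simplex_pt y)).
- exact: measurable_ref_simplex.
- exact: bounded_ref_simplex.
- by move=> t; apply: continuous_comp; [exact: cont_simplex_pt|exact: cg].
Qed.

End SimplexPoint.

(** * Invariance under renumbering of the vertices *)

Section Relabelling.
Context {R : realType}.
Variable n : nat.
Local Notation simplex_n := (@ref_simplex R n).
Implicit Types (s : 'S_n.+1) (t : 'rV[R]_n).

(** Cells and facets are numbered independently by the enumeration of [V]. Integrals over a face
    must therefore be invariant under permutations of its vertices, which act on the reference
    simplex as affine bijections. *)
Definition relabel s t : 'rV[R]_n := of_bary (fun i => bary t (s i)).

Lemma bary_relabel s t i : bary (relabel s t) i = bary t (s i).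
Proof.
rewrite bary_of_bary // -(sum_bary t) [in RHS](reindex_inj (@perm_inj _ s)) //.
Qed.

(** The image of the [k]-th vertex of the reference simplex under [relabel s]; these images give the
    matrix of that affine map. *)
Definition relabel_vtx s (k : 'I_n.+1) : 'rV[R]_n := \row_j (k == s (lift ord0 j))%:R.

Lemma relabelE s t : relabel s t = t *m edge_mx (relabel_vtx s) + relabel_vtx s ord0.
Proof.
rewrite -simplex_ptE; apply/rowP => j.
rewrite mxE summxE (bigD1 (s (lift ord0 j))) //= !mxE eqxx mulr1 big1 ?addr0 //.
by move=> k /negbTE ks; rewrite !mxE ks mulr0.
Qed.

Lemma relabel_unitmx s : edge_mx (relabel_vtx s) \in unitmx.
Proof.
have relK t : relabel s^-1 (relabel s t) = t.
  by apply: bary_inj => i; rewrite !bary_relabel permKV.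
have h t : t *m (edge_mx (relabel_vtx s) *m edge_mx (relabel_vtx s^-1)) = t.
  have := relK t; have := relK 0; rewrite !relabelE !mulmxDl -!mulmxA mul0mx add0r.
  by rewrite -addrA => ->; rewrite addr0.
suff /mulmx1_unit[] : edge_mx (relabel_vtx s) *m edge_mx (relabel_vtx s^-1) = 1%:M by [].
by apply/row_matrixP => i; rewrite rowE h row1.
Qed.

Lemma preimage_relabel s :
  [set t | simplex_n (t *m edge_mx (relabel_vtx s) + relabel_vtx s ord0)] =
  simplex_n.
Proof.
rewrite ref_simplexE predeqE => t /=; rewrite -relabelE.
split=> h i; last by rewrite bary_relabel.
by have := h (s^-1%g i); rewrite bary_relabel permKV.
Qed.

(** The map sends the reference simplex onto itself, and that simplex has finite positive
    measure. *)
Lemma det_relabel s : `|\det (edge_mx (relabel_vtx s) : 'M[R]_n)| = 1.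
Proof.
have := lebesgue_rV_affine (relabel_vtx s ord0) (relabel_unitmx s)
  (@measurable_ref_simplex R n).
rewrite preimage_relabel.
have muS := @lebesgue_rV_bounded_lty R n _ (@measurable_ref_simplex R n)
  (@bounded_ref_simplex R n).
have muS0 := @ref_simplex_measure_gt0 R n.
have muf : lebesgue_rV R n simplex_n \is a fin_num by rewrite ge0_fin_numE.
rewrite -(fineK muf) -EFinM => -[] /eqP.
rewrite -subr_eq0 -[X in X - _]mul1r -mulrBl mulf_eq0 => /orP[|].
  by rewrite subr_eq0 eq_sym => /eqP.
by rewrite gt_eqF // fine_gt0 // muS0.
Qed.

Lemma simplex_pt_relabel m (y : 'I_n.+1 -> 'rV[R]_m) s t :
  simplex_pt (y \o s) (relabel s t) = simplex_pt y t.
Proof.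
rewrite /simplex_pt [RHS](reindex_inj (@perm_inj _ s)) /=.
by apply: eq_bigr => i _; rewrite bary_relabel.
Qed.

Lemma int_simplex_relabel m (y : 'I_n.+1 -> 'rV[R]_m) s (g : 'rV[R]_m -> R) :
  continuous g -> int_simplex (y \o s) g = int_simplex y g.
Proof.
move=> cg; rewrite /int_simplex.
have int_g := integrable_simplex (y \o s) cg.
rewrite (Rintegral_affine (relabel_vtx s ord0) (relabel_unitmx s)
  (@measurable_ref_simplex R n) int_g).
rewrite det_relabel mul1r preimage_relabel.
by apply: eq_Rintegral => t _; rewrite -relabelE simplex_pt_relabel.
Qed.

(** The two numberings give affine parametrizations of the same simplex that differ by [relabel s];
    the identity compares their linear parts. *)
Lemma edge_mx_relabel m (y : 'I_n.+1 -> 'rV[R]_m) s :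
  edge_mx y = edge_mx (relabel_vtx s) *m edge_mx (y \o s).
Proof.
have h t : t *m edge_mx y = t *m (edge_mx (relabel_vtx s) *m edge_mx (y \o s)).
  have := simplex_pt_relabel y s t; have := simplex_pt_relabel y s 0.
  rewrite !simplex_ptE !relabelE !mulmxDl !mul0mx !add0r -!mulmxA => <-.
  by rewrite -!addrA => /addIr.
by apply/row_matrixP => i; rewrite !rowE h.
Qed.

End Relabelling.

Lemma injective_same_range (T : eqType) n (f1 f2 : 'I_n -> T) :
  injective f1 -> (forall i, exists j, f1 i = f2 j) ->
  exists s : 'S_n, f1 =1 f2 \o s.
Proof.
move=> f1i f12.
have ex i : exists j, f2 j == f1 i by have [j ->] := f12 i; exists j.
pose s i := xchoose (ex i).
have f2s i : f2 (s i) = f1 i by apply/eqP; exact: (xchooseP (ex i)).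
have si : injective s by move=> i j /(congr1 f2); rewrite !f2s => /f1i.
by exists (perm si) => i /=; rewrite permE f2s.
Qed.

Section GreenTwoFaces.
Context {R : realType}.
Variable n : nat.
Local Notation E := 'rV[R]_n.+1.
Local Notation leb := (@lebesgue_measure R).
Implicit Types (y : 'I_n.+2 -> E) (t : 'rV[R]_n).

Lemma bary_cons_rv (s : R) t (i : 'I_n.+2) :
  bary (cons_rv (s, t) : 'rV[R]_n.+1) i =
  if unlift ord0 i is Some j then
    (if unlift ord0 j is Some k then t ord0 k else s)
  else 1 - \sum_j t ord0 j - s.
Proof.
rewrite /bary; case: (unlift ord0 i) => [j|].
  by rewrite mxE; case: unlift.
rewrite big_ord_recl mxE unlift_none /= opprD addrA addrAC; congr (_ - _ - _).
by apply: eq_bigr => j _; rewrite mxE liftK.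
Qed.

(** For fixed [t] the point starts, at [s = 0], on the face opposite to vertex 1 and moves parallel
    to the first edge. *)
Lemma simplex_pt_cons_rv y (s : R) t :
  simplex_pt y (cons_rv (s, t)) =
  s *: (y (lift ord0 ord0) - y ord0) + simplex_pt (y \o lift (lift ord0 ord0)) t.
Proof.
rewrite /simplex_pt big_ord_recl big_ord_recl [in RHS]big_ord_recl /=.
rewrite !bary_cons_rv unlift_none liftK unlift_none bary0.
have l0 : lift (lift ord0 ord0) ord0 = ord0 :> 'I_n.+2 by apply/val_inj.
rewrite l0 scalerBl scalerBr !addrA; congr (_ + _).
  by rewrite addrC addrA addrAC.
apply: eq_bigr => j _; rewrite bary_cons_rv !liftK bary_lift.
by congr (_ *: y _); apply/val_inj.
Qed.

(** At the largest admissible [s] the coordinate of vertex 0 is used up: the line leaves through the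
    face opposite to that vertex. *)
Lemma simplex_pt_cons_rv_last y t :
  simplex_pt y (cons_rv (1 - \sum_j t ord0 j, t)) = simplex_pt (y \o lift ord0) t.
Proof.
rewrite /simplex_pt big_ord_recl bary_cons_rv unlift_none subrr scale0r add0r.
apply: eq_bigr => j _; rewrite bary_cons_rv liftK /bary.
by case: (unlift ord0 j).
Qed.

Lemma open_simplex_cons_rv (s : R) t : open_simplex (cons_rv (s, t)) <->
  open_simplex t /\ s \in `]0, 1 - \sum_j t ord0 j[.
Proof.
split=> [h|[ht]]; last first.
  rewrite in_itv /= => /andP[s0 s1] i; rewrite bary_cons_rv.
  case: (unliftP ord0 i) => [j _|_]; last by rewrite subr_gt0.
  case: (unliftP ord0 j) => [k _|_] //.
  by rewrite -bary_lift; exact: ht.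
have s0 : 0 < s.
  by have := h (lift ord0 ord0); rewrite bary_cons_rv liftK unlift_none.
have s1 : s < 1 - \sum_j t ord0 j.
  by have := h ord0; rewrite bary_cons_rv unlift_none subr_gt0.
split; last by rewrite in_itv /= s0 s1.
move=> i; case: (unliftP ord0 i) => [j ->|->].
  have := h (lift ord0 (lift ord0 j)); rewrite bary_cons_rv !liftK.
  by rewrite bary_lift.
by rewrite bary0 (lt_trans s0).
Qed.

Lemma is_derive_line m (g : 'rV[R]_m -> R) (p v : 'rV[R]_m) (s : R) :
  (forall x, differentiable g x) ->
  is_derive s 1 (fun s => g (s *: v + p)) ('D_v g (s *: v + p)).
Proof.
move=> dg; set x := s *: v + p.
have e : (fun h => h^-1 *: (((fun s => g (s *: v + p)) \o shift s) (h *: 1) - g x)) =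
    (fun h => h^-1 *: ((g \o shift x) (h *: v) - g x)).
  apply/funext => h /=; congr (_ *: (g _ - _)).
  by rewrite [h%:A]mulr1 scalerDl addrA.
have dF : derivable g x v by exact: diff_derivable.
move: dF; rewrite /derivable -e => dF.
by apply: DeriveDef => //; rewrite /derive -e.
Qed.

Lemma Rintegral_line (g : E -> R) (p v : E) (b : R) : 0 < b -> C1 g ->
  \int[leb]_(s in `]0, b[) 'D_v g (s *: v + p) = g (b *: v + p) - g p.
Proof.
move=> b0 g1; have dg x := C1_differentiable x g1.
pose f (s : R) : R := 'D_v g (s *: v + p); pose F (s : R) : R := g (s *: v + p).
have cf : continuous f.
  have cp : continuous (fun s : R => s *: v + p).
    apply: cont_mx => i j; under eq_fun do rewrite !mxE.
    apply: cont_add; last exact: cont_cst.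
    by apply: cont_mul; [move=> z|exact: cont_cst].
  have cD : continuous (fun x => 'D_v g x).
    under eq_fun do rewrite derive_partial //.
    apply: cont_sum => i _; apply: cont_mul; first exact: cont_cst.
    by have [_] := g1; exact.
  move=> s; apply: (@continuous_comp _ _ _ (fun s : R => s *: v + p)
    (fun x => 'D_v g x)); [exact: cp|exact: cD].
have dF (s : R) : is_derive s 1 F (f s) by exact: is_derive_line.
have cF : continuous F.
  move=> s; apply: differentiable_continuous; apply/derivable1_diffP.
  by case: (dF s).
have FTC : (\int[leb]_(s in `[0%R, b]%classic) (f s)%:E = (F b)%:E - (F 0%R)%:E)%E.
  apply: continuous_FTC2 => //.
  - exact: continuous_subspaceT.
  - split=> [s _||]; first by case: (dF s).
    + by apply: cvg_at_right_filter; exact: cF.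
    + by apply: cvg_at_left_filter; exact: cF.
  - by move=> s _; rewrite derive1E; case: (dF s).
have intf : leb.-integrable `[0, b] (EFin \o f).
  apply: continuous_compact_integrable; first exact: segment_compact.
  exact: continuous_subspaceT.
rewrite -[LHS]/(\int[leb]_(s in `]0, b[) f s).
rewrite Rintegral_itv_bndo_bndc; last first.
  by apply: integrableS intf => //; exact: subset_itv_oo_cc.
rewrite Rintegral_itv_obnd_cbnd; last first.
  by apply: integrableS intf => //; exact: subset_itv_oc_cc.
by rewrite /Rintegral FTC /F scale0r add0r.
Qed.

Lemma cont_derive (g : E -> R) v : C1 g -> continuous (fun x => 'D_v g x).
Proof.
move=> g1; under eq_fun do rewrite (derive_partial _ (C1_differentiable _ g1)).
apply: cont_sum => i _; apply: cont_mul; first exact: cont_cst.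
by have [_] := g1; exact.
Qed.

(* The fundamental theorem of calculus along the lines parallel to the first edge. *)
Lemma green_ref_simplex y (g : E -> R) : C1 g ->
  \int[lebesgue_rV R n.+1]_(t in @open_simplex R n.+1)
     'D_(y (lift ord0 ord0) - y ord0) g (simplex_pt y t) =
  int_simplex (y \o lift ord0) g - int_simplex (y \o lift (lift ord0 ord0)) g.
Proof.
move=> g1; set v := _ - _; set y0 := y \o lift ord0; set y1 := y \o lift _.
have cg := C1_continuous g1.
pose h x := 'D_v g (simplex_pt y x).
have ch : continuous h.
  move=> x; apply: (@continuous_comp _ _ _ (simplex_pt y) (fun x => 'D_v g x)).
    exact: cont_simplex_pt.
  exact: cont_derive.
have sl t : [set s | open_simplex (cons_rv (s, t))] =
    if t \in @open_simplex R n then `]0, 1 - \sum_j t ord0 j[%classic else set0.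
  rewrite predeqE => s /=; rewrite open_simplex_cons_rv; case: ifPn => ht.
    by split=> [[]//|hs]; split=> //; exact/set_mem.
  by split=> // -[/mem_set]; rewrite (negbTE ht).
have hE s t : h (cons_rv (s, t)) = 'D_v g (s *: v + simplex_pt y1 t).
  by rewrite /h simplex_pt_cons_rv.
rewrite -[LHS]/(\int[lebesgue_rV R n.+1]_(t in @open_simplex R n.+1) h t).
rewrite Rintegral_cons_rv.
- transitivity (\int[lebesgue_rV R n]_(t in @open_simplex R n)
     (g (simplex_pt y0 t) - g (simplex_pt y1 t))).
    rewrite [RHS]Rintegral_mkcond; apply: eq_Rintegral => t _.
    rewrite sl patchE; case: ifPn => ht; last by rewrite Rintegral_set0.
    under eq_Rintegral do rewrite hE.
    rewrite Rintegral_line //; last first.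
      by have /set_mem/(_ ord0) := ht; rewrite bary0.
    rewrite -simplex_pt_cons_rv simplex_pt_cons_rv_last //.
  rewrite -Rintegral_ref_simplex_open; last first.
    apply: cont_sub => t; apply: continuous_comp; try exact: cont_simplex_pt.
      exact: cg.
    exact: cg.
  rewrite RintegralB //.
  + exact: measurable_ref_simplex.
  + exact: integrable_simplex.
  + exact: integrable_simplex.
- exact: measurable_open_simplex.
- apply: integrable_continuous_bounded => //.
    exact: measurable_open_simplex.
  have [r Sr] := (bounded_set_cube _).1 (@bounded_ref_simplex R n.+1).
  apply/bounded_set_cube; exists r; apply: subset_trans Sr.
  exact: sub_open_simplex.
move=> t; rewrite sl; case: ifPn => ht; last exact: integrable_set0.
have chs : continuous (fun s => h (cons_rv (s, t))).
  move=> s; apply: (@continuous_comp _ _ _ (fun s => cons_rv (s, t)) h); last exact: ch.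
  apply: cont_mx => {s} i j; under eq_fun do rewrite mxE.
  by case: unlift => [k|] /=; [exact: cont_cst|].
have int_cc : leb.-integrable `[0, 1 - \sum_j t ord0 j]%classic
    (EFin \o (fun s => h (cons_rv (s, t)))).
  apply: continuous_compact_integrable; first exact: segment_compact.
  exact: continuous_subspaceT.
by apply: integrableS int_cc => //; exact: subset_itv_oo_cc.
Qed.

End GreenTwoFaces.

(** * Barycentric coordinates of a nondegenerate simplex *)

Section Nondegenerate.
Context {R : realType}.
Variable n : nat.
Local Notation E := 'rV[R]_n.+1.
Variable y : 'I_n.+2 -> E.
Hypothesis uy : edge_mx y \in unitmx.
Implicit Types (x z : E) (i : 'I_n.+2) (t : 'rV[R]_n.+1).

Definition simplex_inv x : 'rV[R]_n.+1 := (x - y ord0) *m invmx (edge_mx y).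

Lemma simplex_invK x : simplex_pt y (simplex_inv x) = x.
Proof. by rewrite simplex_ptE mulmxKV // subrK. Qed.

Lemma simplex_ptK t : simplex_inv (simplex_pt y t) = t.
Proof. by rewrite /simplex_inv simplex_ptE addrK mulmxK. Qed.

(** Defined on the whole space as an affine function, so that the signs of the [lam i] describe the
    simplex and its interior. *)
Definition lam i x : R := bary (simplex_inv x) i.

Lemma sum_lam x : \sum_i lam i x = 1. Proof. exact: sum_bary. Qed.

Lemma sum_lam_vtx x : \sum_i lam i x *: y i = x.
Proof. exact: simplex_invK. Qed.

Lemma lam_unique (c : 'I_n.+2 -> R) i : \sum_i c i = 1 ->
  lam i (\sum_i c i *: y i) = c i.
Proof.
move=> c1; rewrite -(bary_of_bary c1) /lam; congr (bary _ i).
rewrite -[RHS]simplex_ptK; congr simplex_inv.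
by apply: eq_bigr => k _; rewrite bary_of_bary.
Qed.

Lemma lam_vtx i k : lam i (y k) = (i == k)%:R.
Proof.
pose c j : R := (j == k)%:R.
have c1 : \sum_j c j = 1.
  by rewrite (bigD1 k) //= big1 /c ?eqxx ?addr0 // => j /negbTE ->.
rewrite -[RHS]/(c i) -(lam_unique i c1); congr lam.
rewrite (bigD1 k) //= big1 /c ?eqxx ?scale1r ?addr0 // => j /negbTE ->.
by rewrite scale0r.
Qed.

(** The constant gradient of [lam i]. The case of [ord0] follows from the others because the
    coordinates add up to 1. *)
Definition grad_lam i : E :=
  if unlift ord0 i is Some j then (col j (invmx (edge_mx y)))^T
  else - \sum_j (col j (invmx (edge_mx y)))^T.

Lemma lam_sub i x z : lam i x - lam i z = mxdot (x - z) (grad_lam i).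
Proof.
have h j : simplex_inv x ord0 j - simplex_inv z ord0 j =
    mxdot (x - z) (col j (invmx (edge_mx y)))^T.
  rewrite mxdot_rV; have -> : x - z = (x - y ord0) - (z - y ord0).
    by rewrite opprB addrA subrK.
  rewrite /simplex_inv !mxE -sumrB; apply: eq_bigr => k _.
  by rewrite !mxE -mulrBl.
rewrite /lam /bary /grad_lam; case: (unlift ord0 i) => [j|]; first exact: h.
rewrite mxdotNr mxdotC mxdot_suml.
under [in RHS]eq_bigr do rewrite mxdotC -h.
by rewrite sumrB; ring.
Qed.

Lemma lam_affine i x : lam i x = lam i 0 + mxdot x (grad_lam i).
Proof. by rewrite -[X in mxdot X _](subr0 x) -lam_sub subrKC. Qed.

Lemma lam_comb (I : finType) (P : pred I) (c : I -> R) (p : I -> E) i :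
  \sum_(k | P k) c k = 1 ->
  lam i (\sum_(k | P k) c k *: p k) = \sum_(k | P k) c k * lam i (p k).
Proof.
move=> c1; rewrite lam_affine mxdot_suml.
under [in RHS]eq_bigr do rewrite lam_affine mulrDr.
rewrite big_split /= -mulr_suml c1 mul1r; congr (_ + _).
by apply: eq_bigr => k _; rewrite mxdotZl.
Qed.

Lemma C1_lam i : C1 (lam i).
Proof.
rewrite (_ : lam i = fun x => cst (lam i 0) x + mxdot x (grad_lam i)).
  apply: C1D; first exact: C1_cst.
  by apply: C1_mxdot_cst => j; exact: C1_coord.
by apply/funext => x; rewrite lam_affine.
Qed.

Lemma cont_lam i : continuous (lam i).
Proof. by apply: C1_continuous; exact: C1_lam. Qed.

Lemma image_simplexE : simplex_pt y @` (@ref_simplex R n.+1) =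
  [set x | forall i, 0 <= lam i x].
Proof.
rewrite ref_simplexE predeqE => x; split=> [[t t0 <-] i|x0].
  by rewrite /lam simplex_ptK; exact: t0.
by exists (simplex_inv x); [exact: x0|exact: simplex_invK].
Qed.

Lemma open_lam_gt0 : open [set x | forall i, 0 < lam i x].
Proof.
rewrite openE => x x0.
apply: (@filter_forall _ 'I_n.+2 (fun i => [set z | 0 < lam i z]) (nbhs x)
  (nbhs_filter x)) => i.
have /open_nbhs_nbhs : open_nbhs (lam i x) [set r : R | 0 < r].
  by split; [exact: open_gt|exact: x0].
exact: cont_lam.
Qed.

Lemma closed_lam_ge0 : closed [set x | forall i, 0 <= lam i x].
Proof.
rewrite (_ : mkset _ = \bigcap_(i in setT) (lam i @^-1` [set r | 0 <= r])).
  apply: closed_bigI => i _; apply: preimage_closed => [t _|].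
    exact: cont_lam.
  exact: closed_ge.
by rewrite predeqE => t; split=> [h i _|h i]; [exact: h|exact: (h i I)].
Qed.

Lemma interior_lam_ge0 :
  [set x | forall i, 0 <= lam i x]° = [set x | forall i, 0 < lam i x].
Proof.
rewrite eqEsubset; split=> [x|].
  move=> /nbhs_ballP[e /= e0 eA] i.
  have /(_ i) := eA x (ballxx x e0); rewrite le_eqVlt => /predU1P[lx|//].
  (* moving away from the vertex [y i] makes its coordinate negative *)
  pose v := x - y i; pose r := e / (1 + `|v|) / 2.
  have v0 : 0 < 1 + `|v| by rewrite ltr_pwDl.
  have r0 : 0 < r by rewrite !divr_gt0.
  have /eA/(_ i) : ball x e (x + r *: v).
    rewrite -ball_normE /= opprD addNKr normrN normrZ gtr0_norm //.
    rewrite /r mulrAC ltr_pdivrMr // mulrAC ltr_pdivrMr //.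
    rewrite -mulrA ltr_pM2l //.
    have := normr_ge0 v; nra.
  have := lam_sub i (x + r *: v) x; rewrite addrAC subrr add0r mxdotZl /v -lam_sub.
  rewrite lam_vtx eqxx -lx => /eqP; rewrite subr_eq => /eqP ->.
  by rewrite sub0r addr0 mulrN1 leNgt oppr_lt0 r0.
rewrite -open_subsetE; last exact: open_lam_gt0.
by move=> x x0 i; exact: ltW.
Qed.

Lemma bounded_lam_ge0 : bounded_set [set x | forall i, 0 <= lam i x].
Proof.
apply/bounded_set_cube; exists (\sum_i \sum_j `|y i ord0 j|) => x x0 j.
rewrite mxE sub0r normrN -[in leLHS](sum_lam_vtx x) summxE.
rewrite (le_trans (ler_norm_sum _ _ _)) //; apply: ler_sum => i _.
rewrite mxE normrM (@le_trans _ _ `|y i ord0 j|) //.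
  rewrite ler_piMl // ger0_norm; last exact: x0.
  by rewrite -(sum_lam x) (bigD1 i) //= lerDl; apply: sumr_ge0 => k _; exact: x0.
by rewrite (bigD1 j) //= lerDl; apply: sumr_ge0.
Qed.

Lemma lam_ge0_boundary0 : lebesgue_rV R n.+1
  ([set x | forall i, 0 <= lam i x] `\` [set x | forall i, 0 < lam i x]) = 0%E.
Proof.
pose c := simplex_pt y (@barycenter R n.+1).
apply: (@lebesgue_rV_shrink _ _ _ _ c).
- by apply: closed_measurable_rV; exact: closed_lam_ge0.
- by apply: open_measurable_rV; exact: open_lam_gt0.
- by move=> x x0 i; exact: ltW.
- exact: bounded_lam_ge0.
move=> e /andP[e0 e1] x x0 i.
have -> : lam i ((1 - e) *: x + e *: c) = (1 - e) * lam i x + e * lam i c.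
  by rewrite !(lam_affine i (_ + _)) mxdotDl !mxdotZl (lam_affine i x) (lam_affine i c); ring.
have -> : lam i c = n.+2%:R^-1 by rewrite /lam /c simplex_ptK bary_barycenter.
rewrite ltr_wpDl //; first by rewrite mulr_ge0 ?subr_ge0 ?(ltW e1) //; exact: x0.
by rewrite mulr_gt0 // invr_gt0.
Qed.

Lemma Rintegral_image_open_simplex (g : E -> R) : continuous g ->
  \int[lebesgue_rV R n.+1]_(x in [set x | forall i, 0 < lam i x]) g x =
  `|\det (edge_mx y)| *
  \int[lebesgue_rV R n.+1]_(t in @open_simplex R n.+1) g (simplex_pt y t).
Proof.
move=> cg; have mD : measurable [set x | forall i, 0 < lam i x].
  by apply: open_measurable_rV; exact: open_lam_gt0.
have bD : bounded_set [set x | forall i, 0 < lam i x].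
  have [r Sr] := (bounded_set_cube _).1 bounded_lam_ge0.
  apply/bounded_set_cube; exists r; apply: subset_trans Sr => x x0 i; exact: ltW.
rewrite (Rintegral_affine (y ord0) uy mD (integrable_continuous_bounded mD bD cg)).
have -> : [set t | [set x | forall i, 0 < lam i x] (t *m edge_mx y + y ord0)] =
    @open_simplex R n.+1.
  rewrite predeqE => t /=; rewrite -simplex_ptE.
  by split=> h i; have := h i; rewrite /lam simplex_ptK.
by congr (_ * _); apply: eq_Rintegral => t _; rewrite simplex_ptE.
Qed.

End Nondegenerate.

Section IntegralSums.
Context {R : realType}.

Lemma Rintegral_sum d (T : measurableType d) (mu : {measure set T -> \bar R})
    (D : set T) (I : Type) (r : seq I) (P : pred I) (f : I -> T -> R) :
  measurable D -> (forall i, P i -> mu.-integrable D (EFin \o f i)) ->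
  \int[mu]_(x in D) (\sum_(i <- r | P i) f i x) =
  \sum_(i <- r | P i) \int[mu]_(x in D) f i x.
Proof.
move=> mD intf.
suff [] : mu.-integrable D (EFin \o (fun x => \sum_(i <- r | P i) f i x)) /\
  \int[mu]_(x in D) (\sum_(i <- r | P i) f i x) =
  \sum_(i <- r | P i) \int[mu]_(x in D) f i x by [].
elim: r => [|i r [IHi IH]].
  split; last by under eq_Rintegral do rewrite big_nil; rewrite big_nil Rintegral_cst // mul0r.
  rewrite (_ : EFin \o _ = cst 0%E); first exact: integrable0.
  by apply/funext => x /=; rewrite big_nil.
rewrite big_cons; under eq_Rintegral do rewrite big_cons.
case: (boolP (P i)) => Pi; last first.
  split=> //; rewrite (_ : EFin \o _ = EFin \o (fun x => \sum_(i <- r | P i) f i x)) //.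
  by apply/funext => x /=; rewrite big_cons (negbTE Pi).
split; last by rewrite RintegralD ?IH //; exact: intf.
pose F x := \sum_(i <- r | P i) f i x.
rewrite (_ : EFin \o _ = ((EFin \o f i) \+ (EFin \o F))%E).
  by apply: integrableD => //; exact: intf.
by apply/funext => x /=; rewrite big_cons Pi.
Qed.

Variables (n m : nat).
Implicit Types (y : 'I_n.+1 -> 'rV[R]_m) (g : 'rV[R]_m -> R).

Lemma int_simplex_sum (I : Type) (r : seq I) (P : pred I) (g : I -> 'rV[R]_m -> R) y :
  (forall i, P i -> continuous (g i)) ->
  int_simplex y (fun x => \sum_(i <- r | P i) g i x) =
  \sum_(i <- r | P i) int_simplex y (g i).
Proof.
move=> cg; apply: (Rintegral_sum _ (f := fun i t => g i (simplex_pt y t))).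
  exact: measurable_ref_simplex.
by move=> i Pi; apply: integrable_simplex; exact: cg.
Qed.

Lemma int_simplexZ y (c : R) g : continuous g ->
  int_simplex y (fun x => c * g x) = c * int_simplex y g.
Proof.
move=> cg; apply: (RintegralZl (f := fun t => g (simplex_pt y t))).
  exact: measurable_ref_simplex.
exact: integrable_simplex.
Qed.

Lemma int_simplexN y g : continuous g ->
  int_simplex y (fun x => - g x) = - int_simplex y g.
Proof.
move=> cg; rewrite -mulN1r -int_simplexZ //.
by apply: eq_Rintegral => t _; rewrite mulN1r.
Qed.

End IntegralSums.

Section GreenSimplex.
Context {R : realType}.
Variable n : nat.
Local Notation E := 'rV[R]_n.+1.
Implicit Types (y : 'I_n.+2 -> E) (s : 'S_n.+2).

Lemma unit_edge_mx_relabel y s :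
  edge_mx y \in unitmx -> edge_mx (y \o s) \in unitmx.
Proof. by rewrite (edge_mx_relabel y s) unitmx_mul => /andP[]. Qed.

Lemma det_edge_mx_relabel y s : `|\det (edge_mx (y \o s))| = `|\det (edge_mx y)|.
Proof. by rewrite (edge_mx_relabel y s) det_mulmx normrM det_relabel mul1r. Qed.

Lemma lam_relabel y s i x : edge_mx y \in unitmx -> lam (y \o s) i x = lam y (s i) x.
Proof.
move=> uy; have uys := unit_edge_mx_relabel s uy.
have c1 : \sum_i lam y (s i) x = 1.
  by rewrite -(sum_lam y x) [RHS](reindex_inj (@perm_inj _ s)).
rewrite -[RHS](lam_unique uys i c1); congr lam.
by rewrite -[LHS](sum_lam_vtx uy) (reindex_inj (@perm_inj _ s)).
Qed.

(** Tested on the difference [v] of the two sides, the increments of the affine functions agree,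
    hence [mxdot v v = 0]. *)
Lemma grad_lam_ext y y' i i' (k : R) : (forall x, lam y i x = k * lam y' i' x) ->
  grad_lam y i = k *: grad_lam y' i'.
Proof.
move=> ll; apply/eqP; rewrite -subr_eq0; apply/eqP; apply: mxdot_eq0.
set v := _ - _; rewrite {2}/v mxdotBr mxdotZr.
have dE (y0 : 'I_n.+2 -> E) i0 : mxdot v (grad_lam y0 i0) = lam y0 i0 v - lam y0 i0 0.
  by rewrite lam_sub subr0.
by rewrite !dE !ll mulrBr subrr.
Qed.

Lemma grad_lam_relabel y s i : edge_mx y \in unitmx ->
  grad_lam (y \o s) i = grad_lam y (s i).
Proof.
by move=> uy; rewrite -[RHS]scale1r; apply: grad_lam_ext => x;
  rewrite mul1r lam_relabel.
Qed.

Lemma int_simplex_same_range m (T : eqType) (x : T -> 'rV[R]_m) k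
    (f1 f2 : 'I_k.+1 -> T) (g : 'rV[R]_m -> R) :
  continuous g -> injective f1 -> (forall i, exists j, f1 i = f2 j) ->
  int_simplex (x \o f1) g = int_simplex (x \o f2) g.
Proof.
move=> cg f1i f12; have [s fs] := injective_same_range f1i f12.
rewrite (_ : x \o f1 = (x \o f2) \o s); first exact: int_simplex_relabel.
by apply/funext => i /=; rewrite fs.
Qed.

(** A transposition turns the edge to vertex [lift ord0 j] into the first edge, for which
    [green_ref_simplex] is available. *)
Lemma green_edge y (j : 'I_n.+1) (g : E -> R) : edge_mx y \in unitmx -> C1 g ->
  \int[lebesgue_rV R n.+1]_(x in [set x | forall i, 0 < lam y i x])
     'D_(y (lift ord0 j) - y ord0) g x =
  `|\det (edge_mx y)| *
  (int_simplex (y \o lift ord0) g - int_simplex (y \o lift (lift ord0 j)) g).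
Proof.
move=> uy g1; have cg := C1_continuous g1.
pose s : 'S_n.+2 := tperm (lift ord0 ord0) (lift ord0 j).
have s0 : s ord0 = ord0 by rewrite tpermD // eq_sym neq_lift.
have s1 : s (lift ord0 ord0) = lift ord0 j by rewrite tpermL.
have uys := unit_edge_mx_relabel s uy.
rewrite (_ : [set x | _] = [set x | forall i, 0 < lam (y \o s) i x]); last first.
  rewrite predeqE => x /=; split=> h i; first by rewrite lam_relabel.
  by have := h (s^-1%g i); rewrite lam_relabel // permKV.
have -> : y (lift ord0 j) - y ord0 = (y \o s) (lift ord0 ord0) - (y \o s) ord0.
  by rewrite /= s0 s1.
rewrite Rintegral_image_open_simplex //; last exact: cont_derive.
rewrite green_ref_simplex // det_edge_mx_relabel; congr (_ * (_ - _)).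
- apply: (@int_simplex_same_range _ _ y _ (s \o lift ord0) (lift ord0)) => //.
    by apply: inj_comp; [exact: perm_inj|exact: lift_inj].
  move=> i /=; have [k ->|e] := unliftP ord0 (s (lift ord0 i)); first by exists k.
  have := neq_lift ord0 i; rewrite -(inj_eq (@perm_inj _ s)) s0 e eqxx //.
- apply: (@int_simplex_same_range _ _ y _ (s \o lift (lift ord0 ord0))
    (lift (lift ord0 j))) => //.
    by apply: inj_comp; [exact: perm_inj|exact: lift_inj].
  move=> i /=; have [k ->|e] := unliftP (lift ord0 j) (s (lift (lift ord0 ord0) i)).
    by exists k.
  have := neq_lift (lift ord0 ord0) i.
  by rewrite -(inj_eq (@perm_inj _ s)) s1 e eqxx.
Qed.

Lemma partial_mxdot_cst (psi : E -> E) (c : E) k x : C1v psi ->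
  partial k (fun x => mxdot (psi x) c) x =
  \sum_i partial k (fun x => psi x ord0 i) x * c ord0 i.
Proof.
move=> psi1; under [X in partial k X]eq_fun do rewrite mxdot_rV.
rewrite /partial (_ : (fun x => _) = \sum_(i < n.+1) (fun x => c ord0 i *: psi x ord0 i)).
  rewrite derive_sum => [|i]; last first.
    by apply: derivableZ; apply: diff_derivable; exact: C1_differentiable.
  apply: eq_bigr => i _; rewrite deriveZ /= ?[_ *: _]mulrC //.
  by apply: diff_derivable; exact: C1_differentiable.
apply/funext => z; rewrite fct_sumE.
by apply: eq_bigr => i _; rewrite [RHS]mulrC.
Qed.

(** The edges issuing from vertex [ord0] and the gradients of the remaining barycentric coordinates
    are dual bases, in which the trace of the Jacobian can be computed. *)
Lemma div_edges y (psi : E -> E) x : edge_mx y \in unitmx -> C1v psi ->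
  div psi x = \sum_(j < n.+1) 'D_(y (lift ord0 j) - y ord0)
    (fun x => mxdot (psi x) (grad_lam y (lift ord0 j))) x.
Proof.
move=> uy psi1; rewrite C1v_div //.
transitivity (\sum_(j < n.+1) \sum_k \sum_i
    edge_mx y j k * invmx (edge_mx y) i j * partial k (fun x => psi x ord0 i) x).
  rewrite exchange_big /=.
  apply: eq_bigr => k _; rewrite exchange_big /= (bigD1 k) //= [X in _ + X]big1 ?addr0.
    rewrite -mulr_suml; under eq_bigr do rewrite mulrC.
    have := congr1 (fun A : 'M[R]_n.+1 => A k k) (mulVmx uy).
    by rewrite !mxE eqxx => ->; rewrite mul1r.
  move=> i ik; rewrite -mulr_suml; under eq_bigr do rewrite mulrC.
  have := congr1 (fun A : 'M[R]_n.+1 => A i k) (mulVmx uy).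
  by rewrite !mxE (negbTE ik) => ->; rewrite mul0r.
apply: eq_bigr => j _.
rewrite derive_partial; last by apply: C1_differentiable; exact: C1_mxdot_cst.
apply: eq_bigr => k _.
rewrite partial_mxdot_cst // mulr_sumr; apply: eq_bigr => i _.
rewrite /grad_lam liftK !mxE; ring.
Qed.

(** Every edge contributes the face opposite to its end and, with the other sign, the face opposite
    to [ord0]. The latter terms add up to a single one since [grad_lam y ord0] is minus the sum of
    the other gradients. *)
Lemma green_simplex y (psi : E -> E) : edge_mx y \in unitmx -> C1v psi ->
  \int[lebesgue_rV R n.+1]_(x in [set x | forall i, 0 < lam y i x]) div psi x =
  - `|\det (edge_mx y)| *
  \sum_i int_simplex (y \o lift i) (fun x => mxdot (psi x) (grad_lam y i)).
Proof.
move=> uy psi1.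
pose g (j : 'I_n.+1) x := mxdot (psi x) (grad_lam y (lift ord0 j)).
have g1 j : C1 (g j) by exact: C1_mxdot_cst.
have mD : measurable [set x | forall i, 0 < lam y i x].
  by apply: open_measurable_rV; exact: open_lam_gt0.
have bD : bounded_set [set x | forall i, 0 < lam y i x].
  have [r Sr] := (bounded_set_cube _).1 (bounded_lam_ge0 uy).
  apply/bounded_set_cube; exists r; apply: subset_trans Sr => x x0 i; exact: ltW.
under eq_Rintegral do rewrite (div_edges _ uy psi1).
rewrite Rintegral_sum //; last first.
  move=> j _; apply: integrable_continuous_bounded => //.
  by apply: cont_derive; exact: g1.
under eq_bigr => j _ do rewrite (green_edge j uy (g1 j)).
rewrite -mulr_sumr mulNr -mulrN; congr (_ * _).
rewrite sumrB [X in _ = - X]big_ord_recl opprD; congr (_ - _).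
rewrite -int_simplex_sum; last by move=> j _; exact: C1_continuous.
rewrite -int_simplexN; last by apply: C1_continuous; exact: C1_mxdot_cst.
rewrite /int_simplex; apply: eq_Rintegral => t _.
by rewrite /grad_lam unlift_none mxdotNr opprK mxdotC mxdot_suml; apply: eq_bigr => j _;
  rewrite mxdotC /g /grad_lam liftK.
Qed.

End GreenSimplex.

(** * Simplicial meshes *)

Section Enumeration.
Context {V : finType}.
Variables (S : {set V}) (k : nat).
Hypothesis cS : #|S| = k.

Definition set_val (i : 'I_k) : V := enum_val (cast_ord (esym cS) i).

Lemma set_valP i : set_val i \in S. Proof. exact: enum_valP. Qed.

Lemma set_val_inj : injective set_val.
Proof. by move=> i j /enum_val_inj /cast_ord_inj. Qed.

Lemma set_val_onto v : v \in S -> exists i, v = set_val i.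
Proof.
move=> vS; exists (cast_ord cS (enum_rank_in vS v)).
by rewrite /set_val cast_ordK enum_rankK_in.
Qed.

Lemma big_set_val (T : Type) (idx : T) (op : Monoid.com_law idx) (F : V -> T) :
  \big[op/idx]_(v in S) F v = \big[op/idx]_i F (set_val i).
Proof.
rewrite big_enum_val (reindex (cast_ord (esym cS))) //.
by exists (cast_ord cS) => i _; rewrite ?cast_ordK ?cast_ordKV.
Qed.

End Enumeration.

Lemma sumV_set_val {V : finType} (U : nmodType) (S : {set V}) k (cS : #|S| = k)
    (F : V -> U) : \sum_(v in S) F v = \sum_i F (set_val cS i).
Proof. exact: big_set_val. Qed.

Section MeshHull.
Context {R : realType} {m : nat} {V : finType}.
Variable M : mesh R m V.
Implicit Types (S : {set V}).

Lemma vertices_nth S k (cS : #|S| = k) (i : 'I_k) :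
  (vertices M S)`_i = vtx M (set_val cS i).
Proof.
have iS : (i < size (enum S))%N by rewrite -cardE cS.
rewrite /vertices (nth_map (set_val cS i)) //; congr vtx.
by rewrite /set_val /enum_val; apply: set_nth_default.
Qed.

Lemma edges_edge_mx S k : edges M k S = edge_mx (fun i : 'I_k.+1 => (vertices M S)`_i).
Proof. by apply/matrixP => i j; rewrite !mxE. Qed.

Lemma hull_image S k (cS : #|S| = k.+1) :
  hull M S = simplex_pt (fun i : 'I_k.+1 => (vertices M S)`_i) @` (@ref_simplex R k).
Proof.
rewrite ref_simplexE predeqE => z; split.
  move=> [c [c0 c1 ->]]; exists (of_bary (c \o set_val cS)).
    by move=> i; rewrite bary_of_bary //= -(sumV_set_val cS).
  rewrite /simplex_pt (sumV_set_val cS); apply: eq_bigr => i _.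
  by rewrite bary_of_bary -?(sumV_set_val cS) // (vertices_nth cS).
move=> [t t0 <-].
pose c v := \sum_(i | set_val cS i == v) bary t i.
have cE i : c (set_val cS i) = bary t i.
  rewrite /c (eq_bigl (fun j => j == i)) ?big_pred1_eq // => j.
  by rewrite (inj_eq (@set_val_inj _ _ _ cS)).
exists c; split.
- by move=> v; apply: sumr_ge0 => i _; exact: t0.
- rewrite (sumV_set_val cS) -(sum_bary t); by apply: eq_bigr => i _; exact: cE.
- rewrite (sumV_set_val cS); apply: eq_bigr => i _.
  by rewrite cE (vertices_nth cS).
Qed.

Lemma compact_hull S k : #|S| = k.+1 -> compact (hull M S).
Proof.
move=> cS; rewrite (hull_image cS); apply: continuous_compact.
  by apply: continuous_subspaceT; exact: cont_simplex_pt.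
by apply: bounded_closed_compact; [exact: bounded_ref_simplex|exact: closed_ref_simplex].
Qed.

Lemma closed_hull S k : #|S| = k.+1 -> closed (hull M S).
Proof. by move=> cS; apply: compact_closed => //; exact: compact_hull cS. Qed.

Lemma hullS S S' : S \subset S' -> hull M S `<=` hull M S'.
Proof.
move=> /fintype.subsetP SS' z [c [c0 c1 ->]]; exists (fun v => if v \in S then c v else 0).
have E (U : nmodType) (F : V -> U) :
    \sum_(v in S') (if v \in S then F v else 0) = \sum_(v in S) F v.
  rewrite -big_mkcondr; apply: eq_bigl => v.
  by rewrite andb_idl //; exact: SS'.
split.
- by move=> v; case: ifP.
- by rewrite E.
- rewrite -[LHS](E _ (fun v => c v *: vtx M v)); apply: eq_bigr => v _.
  by case: ifP => //; rewrite scale0r.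
Qed.

Lemma hull_vtx S v : v \in S -> hull M S (vtx M v).
Proof.
move=> vS; exists (fun u => (u == v)%:R); split => //.
- by rewrite (bigD1 v) //= eqxx big1 ?addr0 // => u /andP[_ /negbTE ->].
- rewrite (bigD1 v) //= eqxx scale1r big1 ?addr0 // => u /andP[_ /negbTE ->].
  by rewrite scale0r.
Qed.

End MeshHull.

Section Cell.
Context {R : realType} {n : nat} {V : finType}.
Local Notation E := 'rV[R]_n.+1.
Variables (M : mesh R n.+1 V) (K : {set V}).
Implicit Types (v a : V) (x z : E) (S : {set V}).

Definition cell_pts : 'I_n.+2 -> E := fun i => (vertices M K)`_i.

(** For [v] outside [K] the index is out of range and [inord] returns [ord0]; the lemmas that tie it
    to a vertex assume [v \in K]. *)
Definition vidx v : 'I_n.+2 := inord (index v (enum K)).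

Definition blam v x : R := lam cell_pts (vidx v) x.

(** The outward normal of the face opposite to [v], scaled by the area element relative to the
    reference simplex. With this weight Green's formula contains no square roots. *)
Definition conormal v : E := - `|\det (edge_mx cell_pts)| *: grad_lam cell_pts (vidx v).

Hypothesis cK : #|K| = n.+2.
Hypothesis uK : row_free (edges M n.+1 K).

Lemma cell_unitmx : edge_mx cell_pts \in unitmx.
Proof. by rewrite -row_free_unit /cell_pts -edges_edge_mx. Qed.
Let uy := cell_unitmx.

Lemma vidx_set_val i : vidx (set_val cK i) = i.
Proof.
apply/val_inj; rewrite /vidx /set_val /enum_val /= index_uniq ?enum_uniq //.
  by rewrite inordK.
by rewrite -cardE cK.
Qed.

Lemma cell_pts_set_val i : cell_pts i = vtx M (set_val cK i).
Proof. exact: vertices_nth. Qed.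

Lemma cell_pts_vidx v : v \in K -> cell_pts (vidx v) = vtx M v.
Proof. by move=> /(set_val_onto cK)[i ->]; rewrite vidx_set_val cell_pts_set_val. Qed.

Lemma sum_blam x : \sum_(v in K) blam v x = 1.
Proof.
rewrite (sumV_set_val cK) /blam; under eq_bigr do rewrite vidx_set_val.
exact: sum_lam.
Qed.

Lemma sum_blam_vtx x : \sum_(v in K) blam v x *: vtx M v = x.
Proof.
rewrite (sumV_set_val cK) /blam -[RHS](sum_lam_vtx uy).
by apply: eq_bigr => i _; rewrite vidx_set_val cell_pts_set_val.
Qed.

Lemma blam_unique (c : V -> R) v : \sum_(u in K) c u = 1 -> v \in K ->
  blam v (\sum_(u in K) c u *: vtx M u) = c v.
Proof.
move=> c1 /(set_val_onto cK)[i ->]; rewrite /blam vidx_set_val.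
rewrite -[RHS]/((c \o set_val cK) i) -(lam_unique uy) /= -?(sumV_set_val cK) //.
congr lam; rewrite (sumV_set_val cK); apply: eq_bigr => j _.
by rewrite cell_pts_set_val.
Qed.

Lemma blam_comb (I : finType) (P : pred I) (c : I -> R) (p : I -> E) v :
  \sum_(k | P k) c k = 1 ->
  blam v (\sum_(k | P k) c k *: p k) = \sum_(k | P k) c k * blam v (p k).
Proof. exact: lam_comb. Qed.

Lemma blam_vtx v u : v \in K -> u \in K -> blam v (vtx M u) = (v == u)%:R.
Proof.
move=> vK uK'; rewrite /blam -(cell_pts_vidx uK') lam_vtx //; congr (nat_of_bool _)%:R.
apply/eqP/eqP => [|-> //] vu.
move: vK uK' vu => /(set_val_onto cK)[i ->] /(set_val_onto cK)[j ->].
by rewrite !vidx_set_val => ->.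
Qed.

Lemma C1_blam v : C1 (blam v). Proof. exact: C1_lam. Qed.

Lemma hull_blam : hull M K = [set x | forall i, 0 <= lam cell_pts i x].
Proof. by rewrite (hull_image M cK) image_simplexE. Qed.

Lemma interior_hull_blam : (hull M K)° = [set x | forall i, 0 < lam cell_pts i x].
Proof. by rewrite hull_blam interior_lam_ge0. Qed.

Lemma hull_blam_ge0 x v : hull M K x -> 0 <= blam v x.
Proof. by rewrite hull_blam; exact. Qed.

Lemma interior_hull_blam_gt0 x v : (hull M K)° x -> 0 < blam v x.
Proof. by rewrite interior_hull_blam; exact. Qed.

Lemma blam_gt0_interior x : (forall v, v \in K -> 0 < blam v x) -> (hull M K)° x.
Proof.
move=> h; rewrite interior_hull_blam => i.
by have := h _ (set_valP cK i); rewrite /blam vidx_set_val.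
Qed.

Lemma blam_ge0_hull x S : S \subset K -> (forall v, v \in K -> 0 <= blam v x) ->
  (forall v, v \in K -> v \notin S -> blam v x = 0) -> hull M S x.
Proof.
move=> /fintype.subsetP SK x0 xS; exists (fun v => if v \in K then blam v x else 0); split.
- by move=> v; case: ifP => // vK; exact: x0.
- rewrite -[RHS](sum_blam x) [RHS](bigID [in S]) /= [X in _ + X]big1 ?addr0.
    rewrite (eq_bigl [pred v | v \in K & v \in S]) => [|v]; last first.
      by rewrite /= andb_idl //; exact: SK.
    by apply: eq_bigr => v /andP[-> _].
  by move=> v /andP[]; exact: xS.
- rewrite -[LHS](sum_blam_vtx x) [LHS](bigID [in S]) /= [X in _ + X]big1 ?addr0.
    rewrite (eq_bigl [in S]) => [|v]; last first.
      by rewrite /= andb_idl //; exact: SK.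
    by apply: eq_bigr => v /SK ->.
  by move=> v /andP[vK vS]; rewrite (xS _ vK vS) scale0r.
Qed.

Lemma hull_sub_blam0 S x v : S \subset K -> hull M S x -> v \in K -> v \notin S ->
  blam v x = 0.
Proof.
move=> /fintype.subsetP SK [c [c0 c1 ->]] vK vS.
rewrite blam_comb // big1 // => u uS.
rewrite blam_vtx //; last exact: SK.
by rewrite (_ : (v == u) = false) ?mulr0 //; apply: contraNF vS => /eqP ->.
Qed.

Lemma bounded_hull_cell : bounded_set (hull M K).
Proof. by rewrite hull_blam; exact: bounded_lam_ge0. Qed.

Lemma bounded_interior_cell : bounded_set (hull M K)°.
Proof.
have [r Sr] := (bounded_set_cube _).1 bounded_hull_cell.
by apply/bounded_set_cube; exists r; apply: subset_trans Sr; exact: interior_subset.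
Qed.

Lemma measurable_interior_cell : measurable (hull M K)°.
Proof. by apply: open_measurable_rV; exact: open_interior. Qed.

Lemma hull_boundary0 : lebesgue_rV R n.+1 (hull M K `\` (hull M K)°) = 0%E.
Proof. by rewrite interior_hull_blam hull_blam; exact: lam_ge0_boundary0. Qed.

(** A small step towards the barycenter [c] enters the interior. This makes the filter that defines
    [trace] proper at all points of the closed cell. *)
Lemma hull_sub_closure_interior x : hull M K x -> closure (hull M K)° x.
Proof.
move=> Kx U /nbhs_ballP[e /= e0 eU].
pose c : E := \sum_(v in K) n.+2%:R^-1 *: vtx M v.
have c1 : \sum_(v in K) n.+2%:R^-1 = 1 :> R.
  by rewrite sumr_const cK -[_ *+ _]mulr_natl divff.
(* The first quotient keeps the step [r * |x - c|] below [e], the second one keeps [r] below 1. *)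
pose r := e / (1 + `|x - c|) / (1 + e).
have v0 : 0 < 1 + `|x - c| by rewrite ltr_pwDl.
have e1 : 0 < 1 + e by rewrite addr_gt0.
have r0 : 0 < r by rewrite !divr_gt0.
have r1 : r < 1.
  rewrite /r mulrAC ltr_pdivrMr // mul1r ltr_pdivrMr //.
  have := normr_ge0 (x - c); nra.
exists (x - r *: (x - c)); split; last first.
  apply: eU; rewrite -ball_normE /= opprB addrC subrK normrZ gtr0_norm //.
  rewrite /r mulrAC ltr_pdivrMr // mulrAC ltr_pdivrMr //.
  have := normr_ge0 (x - c); nra.
apply: blam_gt0_interior => v vK.
have -> : blam v (x - r *: (x - c)) = (1 - r) * blam v x + r * blam v c.
  rewrite /blam !(lam_affine _ _ (_ - _)) mxdotBl mxdotZl mxdotBl.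
  by rewrite (lam_affine _ _ x) (lam_affine _ _ c); ring.
rewrite (blam_unique (c := fun=> n.+2%:R^-1)) // ltr_wpDl //.
  by rewrite mulr_ge0 ?hull_blam_ge0 // subr_ge0 ltW.
by rewrite mulr_gt0 // invr_gt0.
Qed.

Definition face_int (F : {set V}) (g : E -> R) : R :=
  int_simplex (fun i : 'I_n.+1 => (vertices M F)`_i) g.

Lemma green_cell (psi : E -> E) : C1v psi ->
  \int[lebesgue_rV R n.+1]_(x in (hull M K)°) div psi x =
  \sum_(a in K) face_int (K :\ a) (fun x => mxdot (psi x) (conormal a)).
Proof.
move=> psi1; rewrite interior_hull_blam green_simplex // mulr_sumr.
rewrite (sumV_set_val cK); apply: eq_bigr => i _.
rewrite -int_simplexZ; last first.
  by apply: C1_continuous; exact: C1_mxdot_cst.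
have cF : #|K :\ set_val cK i| = n.+1.
  by have := cardsD1 (set_val cK i) K; rewrite set_valP cK add1n => -[].
set g := fun x => mxdot _ (conormal _).
rewrite (_ : (fun x => _ * _) = g); last first.
  by apply/funext => x; rewrite /g /conormal vidx_set_val mxdotZr.
have cg : continuous g by apply: C1_continuous; exact: C1_mxdot_cst.
rewrite /face_int.
(* The face inherits from the cell a numbering with one index skipped, whereas [vertices] numbers it
   afresh; both run through the same vertices. *)
rewrite (_ : cell_pts \o lift i = vtx M \o (set_val cK \o lift i)); last first.
  by apply/funext => j /=; rewrite cell_pts_set_val.
rewrite (_ : (fun _ => _) = vtx M \o set_val cF); last first.
  by apply/funext => j /=; rewrite (vertices_nth M cF).
apply: int_simplex_same_range => //.
  by apply: inj_comp; [exact: set_val_inj|exact: lift_inj].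
move=> j /=; apply: set_val_onto; rewrite !inE set_valP andbT.
by rewrite (inj_eq (@set_val_inj _ _ _ cK)) eq_sym neq_lift.
Qed.

End Cell.

Section AdjacentSimplices.
Context {R : realType}.
Variable n : nat.
Local Notation E := 'rV[R]_n.+1.
Local Notation i1 := (lift ord0 ord0 : 'I_n.+2).
Variables y y' : 'I_n.+2 -> E.
Hypotheses (uy : edge_mx y \in unitmx) (uy' : edge_mx y' \in unitmx).
Hypothesis yy' : forall i, i != i1 -> y' i = y i.

(** The signed ratio of the heights of the two apexes over the common face, negative when they lie
    on opposite sides. *)
Let k := lam y i1 (y' i1).

(** Both affine functions vanish on the common face, so comparing them at the apex [y' i1]
    suffices. *)
Lemma lam_adjacent x : lam y i1 x = k * lam y' i1 x.
Proof.
rewrite -[in LHS](sum_lam_vtx uy' x) lam_comb ?sum_lam //.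
rewrite (bigD1 i1) //= big1 ?addr0; first by rewrite mulrC.
by move=> i ii; rewrite (yy' ii) lam_vtx // eq_sym (negbTE ii) mulr0.
Qed.

Lemma grad_lam_adjacent : grad_lam y i1 = k *: grad_lam y' i1.
Proof. by apply: grad_lam_ext => x; exact: lam_adjacent. Qed.

Lemma lam_adjacent_neq0 : k != 0.
Proof.
apply/eqP => k0; have := lam_adjacent (y i1).
by rewrite k0 mul0r lam_vtx // eqxx => /eqP; rewrite oner_eq0.
Qed.

Lemma det_edge_mx_adjacent : `|\det (edge_mx y')| = `|k| * `|\det (edge_mx y)|.
Proof.
(* The edges of [y'] in the basis of the edges of [y]: only the first one differs, so [B] is
   triangular with diagonal [k, 1, ..., 1]. *)
pose B : 'M[R]_n.+1 := \matrix_(i, j)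
  if i == ord0 then lam y (lift ord0 j) (y' i1) else (i == j)%:R.
have -> : edge_mx y' = B *m edge_mx y.
  apply/row_matrixP => i; rewrite row_mul rowK mulmx_sum_row.
  have y0 : y' ord0 = y ord0 by apply: yy'; exact: neq_lift.
  rewrite y0; have [->|i0] := eqVneq i ord0.
    rewrite -[in LHS](sum_lam_vtx uy (y' i1)).
    rewrite -[X in _ - X]scale1r -(sum_lam y (y' i1)) scaler_suml -sumrB.
    rewrite big_ord_recl subrr add0r; apply: eq_bigr => j _.
    by rewrite !mxE eqxx rowK scalerBr.
  rewrite (bigD1 i) //= big1 ?addr0.
    by rewrite !mxE (negbTE i0) eqxx scale1r rowK yy'.
  by move=> j ij; rewrite !mxE (negbTE i0) eq_sym (negbTE ij) scale0r.
rewrite det_mulmx normrM; congr (`|_| * _).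
rewrite -det_tr det_trig.
  rewrite big_ord_recl big1 => [|i _]; first by rewrite !mxE mulr1.
  by rewrite !mxE eqxx.
apply/is_trig_mxP => i j ij; rewrite !mxE.
have j0 : j != ord0 by apply: contraTneq ij => ->.
by rewrite (negbTE j0) gt_eqF.
Qed.

Lemma conormal_adjacent : k < 0 ->
  `|\det (edge_mx y')| *: grad_lam y' i1 = - (`|\det (edge_mx y)| *: grad_lam y i1).
Proof.
move=> k0; rewrite det_edge_mx_adjacent grad_lam_adjacent ltr0_norm //.
by rewrite mulrC -!scalerA -scalerN -scaleNr.
Qed.

End AdjacentSimplices.

(** * Conformity and the position of neighbouring cells *)

Section Conforming.
Context {R : realType} {n : nat} {V : finType}.
Local Notation E := 'rV[R]_n.+1.
Variables (M : mesh R n.+1 V) (Omega : set E).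
Hypothesis hM : simplicial_partition M Omega.
Implicit Types (K F S : {set V}) (a v : V) (x z : E).

Lemma card_cell K : K \in cells M -> #|K| = n.+2.
Proof. by case: hM => h _ _ /h[]. Qed.

Lemma free_cell K : K \in cells M -> row_free (edges M n.+1 K).
Proof. by case: hM => h _ _ /h[]. Qed.

Lemma conforming K K' : K \in cells M -> K' \in cells M ->
  hull M K `&` hull M K' = hull M (K :&: K').
Proof. by case: hM => _ h _; exact: h. Qed.

Lemma facetP F : reflect (#|F| = n.+1 /\ exists2 K, K \in cells M & F \subset K)
  (F \in facets M).
Proof.
rewrite /facets inE; apply: (iffP andP) => [[/eqP cF /set0Pn[K]]|[/eqP cF [K KM FK]]].
  by rewrite !inE => /andP[KM FK]; split=> //; exists K.
by split=> //; apply/set0Pn; exists K; rewrite !inE KM.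
Qed.

Lemma facet_cellP K F : K \in cells M -> #|F| = n.+1 -> F \subset K ->
  exists a, [/\ a \in K, a \notin F & F = K :\ a].
Proof.
move=> KM cF FK; have cKF : #|K :\: F| = 1%N.
  by rewrite cardsD (finset.setIidPr FK) (card_cell KM) cF subSnn.
have /cards1P[a aE] : #|K :\: F| == 1%N by rewrite cKF.
have : a \in K :\: F by rewrite aE set11.
rewrite inE => /andP[aF aK]; exists a; split=> //.
apply/setP => v; rewrite !inE; have := congr1 (fun A : {set V} => v \in A) aE.
rewrite !inE => <-; have := fintype.subsetP FK v.
by case: (v \in F); case: (v \in K) => //= h; have := h isT.
Qed.

Lemma card_cell_facet K a : K \in cells M -> a \in K -> #|K :\ a| = n.+1.
Proof.
by move=> KM aK; have := cardsD1 a K; rewrite aK (card_cell KM) add1n => -[].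
Qed.

Lemma cell_facet K a : K \in cells M -> a \in K -> K :\ a \in facets M.
Proof.
move=> KM aK; apply/facetP; split; first exact: card_cell_facet.
by exists K => //; exact: finset.subD1set.
Qed.

(** The sum has one term when [F] is a face of [K] and none otherwise; in this form no opposite
    vertex has to be chosen. *)
Definition facet_conormal K F : E := \sum_(a in K | K :\ a == F) conormal M K a.

Lemma facet_conormalE K a : a \in K -> facet_conormal K (K :\ a) = conormal M K a.
Proof.
move=> aK; rewrite /facet_conormal (bigD1 a) ?aK ?eqxx //= big1 ?addr0 //.
move=> v /andP[/andP[vK /eqP va] nva].
have := congr1 (fun A : {set V} => v \in A) va.
by rewrite !inE eqxx vK nva.
Qed.

Lemma sum_cell_facet (U : nmodType) (H : {set V} -> {set V} -> U) :
  \sum_(K in cells M) \sum_(a in K) H K (K :\ a) =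
  \sum_(F in facets M) \sum_(K in cells_at M F) H K F.
Proof.
rewrite (exchange_big_dep [in cells M]) /=; last first.
  by move=> F K _; rewrite inE => /andP[].
apply: eq_bigr => K KM.
rewrite -(big_imset (H K)) /=; last first.
  move=> a b aK bK ab; apply/eqP; have := congr1 (fun A : {set V} => a \in A) ab.
  by rewrite !inE eqxx aK /= andbT => /esym/negbFE.
apply: eq_bigl => F; apply/imsetP/andP => [[a aK ->]|[/facetP[cF _]]].
  split; first exact: cell_facet.
  by rewrite inE KM finset.subD1set.
by rewrite inE => /andP[_ FK]; have [a [aK _ ->]] := facet_cellP KM cF FK; exists a.
Qed.

(** If both apexes lay on the same side of the facet, a point of [K'] slightly above the facet would
    also belong to [K]. Conformity would then put it on the facet itself, where the coordinate of
    [a] vanishes. *)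
Lemma facet_opposite_neg K K' a a' : K \in cells M -> K' \in cells M ->
  a \in K -> a' \in K' -> K :\ a = K' :\ a' -> K != K' -> blam M K a (vtx M a') <= 0.
Proof.
move=> KM K'M aK a'K' KK' neq; rewrite leNgt; apply/negP => k0.
set F := K :\ a; have cF : #|F| = n.+1 by exact: card_cell_facet.
pose mu v := blam M K v (vtx M a'); pose B := \sum_(v in K) `|mu v|.
have B0 : 0 <= B by exact: sumr_ge0.
(* The point has weight [e] at [a'] and weight [e * (B + 1)] at every vertex of the facet, and these
   must add up to 1. As [B] bounds the coordinates of [a'] in [K], the facet weights outweigh any
   negative one. *)
pose e := (1 + n.+1%:R * (B + 1))^-1.
have D0 : 0 < 1 + n.+1%:R * (B + 1) :> R.
  by rewrite addr_gt0 // mulr_gt0 // ltr_wpDl.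
have e0 : 0 < e by rewrite invr_gt0.
have eD : e + e * (n.+1%:R * (B + 1)) = 1.
  by rewrite -{1}[e]mulr1 -mulrDr /e mulVf // gt_eqF.
have e1 : (1 - e) / n.+1%:R = e * (B + 1).
  have -> : 1 - e = e * (n.+1%:R * (B + 1)) by rewrite -[X in X - _]eD addrC addKr.
  by rewrite mulrCA mulrC mulKf.
pose c v := if v == a' then e else (1 - e) / n.+1%:R.
have sumK' (U : zmodType) (G : V -> U) : \sum_(v in K') G v = G a' + \sum_(v in F) G v.
  rewrite (bigD1 a') //=; congr (_ + _); apply: eq_bigl => v.
  by rewrite /F KK' !inE andbC.
have a'F : a' \notin F by rewrite /F KK' !inE eqxx.
have cE v : v \in F -> c v = e * (B + 1).
  by rewrite -e1 /c; case: eqP => // ->; rewrite (negbTE a'F).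
have c1 : \sum_(v in K') c v = 1.
  rewrite sumK' /c eqxx (eq_bigr (fun=> e * (B + 1))) => [|v vF]; last exact: cE.
  by rewrite sumr_const cF -[_ *+ _]mulr_natl mulrCA eD.
pose z := \sum_(v in K') c v *: vtx M v.
have zK' : hull M K' z.
  exists c; split=> // v; rewrite /c; case: ifP => _; first exact: ltW.
  by rewrite e1 mulr_ge0 ?(ltW e0) // addr_ge0.
have bz v : v \in K -> blam M K v z = e * mu v + \sum_(u in F) e * (B + 1) * (v == u)%:R.
  move=> vK; rewrite blam_comb // sumK' /c eqxx; congr (_ + _).
  apply: eq_bigr => u uF; rewrite -/(c u) cE // blam_vtx //.
  - exact: card_cell.
  - exact: free_cell.
  - by move: uF; rewrite inE => /andP[].
have za : blam M K a z = e * mu a.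
  rewrite bz // big1 ?addr0 // => u; rewrite !inE eq_sym => /andP[/negbTE -> _].
  by rewrite mulr0.
have zK : hull M K z.
  apply: (@blam_ge0_hull _ _ _ M K (card_cell KM) (free_cell KM)) => //.
    move=> v vK; have [->|va] := eqVneq v a; first by rewrite za mulr_ge0 // ltW.
    have vF : v \in F by rewrite !inE va.
    rewrite bz // (bigD1 v) //= eqxx mulr1 big1 ?addr0; last first.
      by move=> u /andP[_]; rewrite eq_sym => /negbTE ->; rewrite mulr0.
    rewrite -mulrDr mulr_ge0 ?(ltW e0) // addrA addr_ge0 // -lerBlDl sub0r.
    rewrite (le_trans (ler_norm _)) // normrN /B (bigD1 v) //= lerDl.
    exact: sumr_ge0.
  by move=> v vK /negP.
have : hull M (K :&: K') z by rewrite -conforming.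
(* The intersection cannot contain [a]: otherwise [a = a'] and the two cells would coincide. *)
have KK'F : K :&: K' \subset F.
  apply/fintype.subsetP => v; rewrite !inE => /andP[vK vK']; rewrite vK andbT.
  apply: contraNneq neq => va; subst v.
  have aa' : a = a'.
    apply/eqP; apply: contraT => naa'.
    have : a \in K' :\ a' by rewrite !inE naa'.
    by rewrite -KK' !inE eqxx.
  by rewrite -(finset.setD1K aK) KK' -aa' finset.setD1K.
move=> hz; have zF : hull M F z := hullS KK'F hz.
have := hull_sub_blam0 (card_cell KM) (free_cell KM) (finset.subD1set K a) zF aK.
rewrite za !inE eqxx => /(_ isT)/eqP; rewrite mulf_eq0 (gt_eqF e0) /=.
by rewrite (gt_eqF k0).
Qed.

End Conforming.

Section Facets.
Context {R : realType} {n : nat} {V : finType}.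
Local Notation E := 'rV[R]_n.+1.
Local Notation i1 := (lift ord0 ord0 : 'I_n.+2).
Variables (M : mesh R n.+1 V) (Omega : set E).
Hypothesis hM : simplicial_partition M Omega.
Implicit Types (K F S : {set V}) (a v : V) (x z : E).

(** Cells at [F] are numbered alike on [F], with the apex at index 1. Index 0 is left to a common
    vertex because [edge_mx] takes differences with it. *)
Definition apex_enum F (cF : #|F| = n.+1) a (i : 'I_n.+2) : V :=
  if unlift i1 i is Some j then set_val cF j else a.

Lemma apex_enum1 F (cF : #|F| = n.+1) a : apex_enum cF a i1 = a.
Proof. by rewrite /apex_enum unlift_none. Qed.

Lemma apex_enum_lift F (cF : #|F| = n.+1) a j : apex_enum cF a (lift i1 j) = set_val cF j.
Proof. by rewrite /apex_enum liftK. Qed.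

Lemma apex_enum_inj F (cF : #|F| = n.+1) a : a \notin F -> injective (apex_enum cF a).
Proof.
move=> aF i j; case: (unliftP i1 i) => [i' ->|->]; case: (unliftP i1 j) => [j' ->|->];
  rewrite ?apex_enum_lift ?apex_enum1 //.
- by move=> /set_val_inj ->.
- by move=> e; move: aF; rewrite -e set_valP.
- by move=> e; move: aF; rewrite e set_valP.
Qed.

Lemma cell_relabel K F (cF : #|F| = n.+1) a : K \in cells M -> a \in K -> F = K :\ a ->
  exists s : 'S_n.+2, vtx M \o apex_enum cF a = cell_pts M K \o s /\ s i1 = vidx K a.
Proof.
move=> KM aK FK; have cK := card_cell hM KM.
have aF : a \notin F by rewrite FK !inE eqxx.
have [|s gs] := @injective_same_range _ _ _ (set_val cK) (@apex_enum_inj F cF a aF).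
  move=> i; apply: set_val_onto; rewrite /apex_enum; case: unlift => [j|//].
  by have := set_valP cF j; rewrite {2}FK inE => /andP[].
exists s; split; first by apply/funext => i /=; rewrite gs cell_pts_set_val.
have e : set_val cK (s i1) = a by have := gs i1; rewrite apex_enum1 /= => <-.
by rewrite -[LHS](vidx_set_val cK) e.
Qed.

Lemma unit_apex K F (cF : #|F| = n.+1) a : K \in cells M -> a \in K -> F = K :\ a ->
  edge_mx (vtx M \o apex_enum cF a) \in unitmx.
Proof.
move=> KM aK FK; have [s [-> _]] := cell_relabel cF KM aK FK.
exact/unit_edge_mx_relabel/cell_unitmx/(free_cell hM).
Qed.

Lemma conormal_apex K F (cF : #|F| = n.+1) a : K \in cells M -> a \in K -> F = K :\ a ->
  conormal M K a = - `|\det (edge_mx (vtx M \o apex_enum cF a))| *: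
    grad_lam (vtx M \o apex_enum cF a) i1.
Proof.
move=> KM aK FK; have [s [-> sa]] := cell_relabel cF KM aK FK.
have uK := cell_unitmx (free_cell hM KM).
by rewrite det_edge_mx_relabel grad_lam_relabel // sa.
Qed.

Lemma blam_apex K F (cF : #|F| = n.+1) a x : K \in cells M -> a \in K -> F = K :\ a ->
  blam M K a x = lam (vtx M \o apex_enum cF a) i1 x.
Proof.
move=> KM aK FK; have [s [-> sa]] := cell_relabel cF KM aK FK.
by rewrite lam_relabel ?sa // cell_unitmx // (free_cell hM).
Qed.

(** [apex_enum] brings the two cells into the position of [conormal_adjacent], and
    [facet_opposite_neg] provides the sign of the height ratio. *)
Lemma conormal_opposite K K' a a' : K \in cells M -> K' \in cells M ->
  a \in K -> a' \in K' -> K :\ a = K' :\ a' -> K != K' ->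
  conormal M K' a' = - conormal M K a.
Proof.
move=> KM K'M aK a'K' KK' neq.
have cF : #|K :\ a| = n.+1 by exact: (card_cell_facet hM).
rewrite (conormal_apex cF K'M a'K' KK') (conormal_apex cF KM aK erefl).
set y := vtx M \o apex_enum cF a; set y' := vtx M \o apex_enum cF a'.
have uy : edge_mx y \in unitmx by exact: (unit_apex cF KM aK).
have uy' : edge_mx y' \in unitmx by exact: (unit_apex cF K'M a'K').
have yy' i : i != i1 -> y' i = y i.
  by rewrite /y /y' /= /apex_enum; case: unliftP => [//|->]; rewrite eqxx.
have k0 : lam y i1 (y' i1) < 0.
  rewrite lt_neqAle (lam_adjacent_neq0 uy uy' yy') /=.
  have := facet_opposite_neg hM KM K'M aK a'K' KK' neq.
  by rewrite (blam_apex cF _ KM aK erefl) /y' /= apex_enum1.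
by rewrite !scaleNr (conormal_adjacent uy uy' yy' k0).
Qed.

Lemma facet_conormal_opposite F K K' : F \in facets M -> K \in cells_at M F ->
  K' \in cells_at M F -> K != K' -> facet_conormal M K' F = - facet_conormal M K F.
Proof.
move=> /facetP[cF _]; rewrite !inE => /andP[KM FK] /andP[K'M FK'] neq.
have [a [aK _ Fa]] := facet_cellP hM KM cF FK.
have [a' [aK' _ Fa']] := facet_cellP hM K'M cF FK'.
rewrite {1}Fa' {1}Fa !facet_conormalE //; apply: conormal_opposite => //.
by rewrite -Fa.
Qed.

(** Otherwise the coordinate of [a] would be constant, but it is 1 at [a] and 0 at the other
    vertices. *)
Lemma conormal_neq0 K a : K \in cells M -> a \in K -> conormal M K a != 0.
Proof.
move=> KM aK; have uK := free_cell hM KM; have cK := card_cell hM KM.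
have uy := cell_unitmx uK.
rewrite /conormal scaler_eq0 oppr_eq0 normr_eq0 negb_or -unitfE -unitmxE uy /=.
apply/eqP => g0.
have [v vK va] : exists2 v, v \in K & v != a.
  have /set0Pn[v] : K :\ a != finset.set0.
    by rewrite -card_gt0 (card_cell_facet hM KM aK).
  by rewrite !inE => /andP[va vK]; exists v.
have := lam_sub (cell_pts M K) (vidx K a) (vtx M a) (vtx M v).
rewrite g0 mxdot0r -/(blam M K a _) -/(blam M K a _) !blam_vtx // eqxx eq_sym (negbTE va).
by rewrite subr0 => /eqP; rewrite oner_eq0.
Qed.

(** Three cells at [F] would have pairwise opposite conormals; going once around, a conormal would
    equal its own negative. *)
Lemma card_cells_at F : F \in facets M -> (#|cells_at M F| <= 2)%N.
Proof.
move=> FM; rewrite leqNgt; apply/negP => h.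
have /card_gt2P : (2 < #|cells_at M F|)%N by [].
move=> [K1 [K2 [K3 [[k1 k2 k3] [n12 n23 n31]]]]].
have c12 := facet_conormal_opposite FM k1 k2 n12.
have c23 := facet_conormal_opposite FM k2 k3 n23.
have c31 := facet_conormal_opposite FM k3 k1 n31.
have : facet_conormal M K1 F = 0.
  have e : facet_conormal M K1 F = - facet_conormal M K1 F.
    by rewrite {1}c31 c23 c12 !opprK.
  have : facet_conormal M K1 F *+ 2 = 0 by rewrite mulr2n {1}e addNr.
  by rewrite -scaler_nat => /eqP; rewrite scaler_eq0 pnatr_eq0 => /eqP.
move: FM k1 => /facetP[cF _]; rewrite inE => /andP[KM FK].
have [a [aK _ ->]] := facet_cellP hM KM cF FK.
by rewrite facet_conormalE // => /eqP; rewrite (negbTE (conormal_neq0 KM aK)).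
Qed.

Definition face_pt F (t : 'rV[R]_n) : E :=
  simplex_pt (fun i : 'I_n.+1 => (vertices M F)`_i) t.

Lemma blam_face_pt K F (cF : #|F| = n.+1) t i : K \in cells M -> F \subset K ->
  blam M K (set_val cF i) (face_pt F t) = bary t i.
Proof.
move=> KM FK; have uK := free_cell hM KM; have cK := card_cell hM KM.
rewrite /face_pt /simplex_pt blam_comb ?sum_bary // (bigD1 i) //= big1 ?addr0.
  rewrite (vertices_nth M cF) blam_vtx ?eqxx ?mulr1 //;
    exact: (fintype.subsetP FK) (set_valP cF i).
move=> j ji; rewrite (vertices_nth M cF) blam_vtx //.
- by rewrite (inj_eq (@set_val_inj _ _ _ cF)) eq_sym (negbTE ji) mulr0.
- exact: (fintype.subsetP FK) (set_valP cF i).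
- exact: (fintype.subsetP FK) (set_valP cF j).
Qed.

Lemma hull_face_pt F t : #|F| = n.+1 -> ref_simplex t -> hull M F (face_pt F t).
Proof. by move=> cF St; rewrite (hull_image M cF); exists t. Qed.

(** At such a point all coordinates attached to [F] are positive. Lying in the common face of the
    two cells forces [F] into [K'], and lying in [F'] forces [F] into [F']; equal cardinalities
    conclude. *)
Lemma facet_interior_disjoint F F' t : F \in facets M -> F' \in facets M ->
  F != F' -> open_simplex t -> ~ hull M F' (face_pt F t).
Proof.
move=> /facetP[cF [K KM FK]] /facetP[cF' [K' K'M FK']] neq t0 xF'.
have cK := card_cell hM KM; have uK := free_cell hM KM.
have cK' := card_cell hM K'M; have uK' := free_cell hM K'M.
set x := face_pt F t in xF'.
have xK : hull M K x.
  by apply: (hullS FK); apply: hull_face_pt => //; exact: sub_open_simplex.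
have : hull M (K :&: K') x.
  by rewrite -(conforming hM) //; split=> //; exact: hullS xF'.
move=> xKK'.
have FsubK' : F \subset K'.
  apply/fintype.subsetP => v vF; apply/negPn/negP => vK'.
  have [i vi] := set_val_onto cF vF.
  have vK : v \in K by exact: (fintype.subsetP FK).
  have := hull_sub_blam0 cK uK (finset.subsetIl K K') xKK' vK.
  rewrite inE (negbTE vK') andbF vi blam_face_pt // => /(_ isT) => e.
  by have := t0 i; rewrite e ltxx.
have FF' : F \subset F'.
  apply/fintype.subsetP => v vF; apply/negPn/negP => vF'.
  have [i vi] := set_val_onto cF vF.
  have vK' : v \in K' by exact: (fintype.subsetP FsubK').
  have := hull_sub_blam0 cK' uK' FK' xF' vK' vF'.
  by rewrite vi blam_face_pt // => e; have := t0 i; rewrite e ltxx.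
by move: neq; rewrite eqEcard FF' cF cF' leqnn.
Qed.

End Facets.

(** * Normals, areas and Green's formula on the mesh *)

Section FacetData.
Context {R : realType} {n : nat} {V : finType}.
Local Notation E := 'rV[R]_n.+1.
Local Notation i1 := (lift ord0 ord0 : 'I_n.+2).
Variables (M : mesh R n.+1 V) (Omega : set E).
Hypotheses (hM : simplicial_partition M Omega) (hFD : facet_data M).
Implicit Types (K F S : {set V}) (a v : V) (x z : E).

Lemma plus_cells_at F : F \in facets M -> plus M F \in cells_at M F.
Proof. by move=> /hFD[]. Qed.

Lemma minus_cells_at F : F \in facets M -> interior_facet M F ->
  minus M F \in cells_at M F.
Proof. by move=> FM iF; have [_ /(_ iF)[]] := hFD FM. Qed.

Lemma plus_cell F : F \in facets M -> plus M F \in cells M.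
Proof. by move=> /plus_cells_at; rewrite inE => /andP[]. Qed.

Lemma minus_cell F : F \in facets M -> interior_facet M F -> minus M F \in cells M.
Proof. by move=> FM /(minus_cells_at FM); rewrite inE => /andP[]. Qed.

Lemma sum_cells_at (U : nmodType) F (G : {set V} -> U) : F \in facets M ->
  \sum_(K in cells_at M F) G K =
  if interior_facet M F then G (plus M F) + G (minus M F) else G (plus M F).
Proof.
move=> FM; have pF := plus_cells_at FM.
rewrite (bigD1 (plus M F)) //=; case: ifPn => iF.
  congr (_ + _); have [_ /(_ iF)[mF mp] _ _ _] := hFD FM.
  rewrite (bigD1 (minus M F)) ?mF //= big1 ?addr0 // => K /andP[/andP[KF Kp] Km].
  have := card_cells_at hM FM.
  rewrite (cardsD1 (plus M F)) pF (cardsD1 (minus M F)) !inE mp.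
  move: (mF); rewrite inE => -> /=; rewrite (cardsD1 K) !inE Kp Km.
  by move: (KF); rewrite inE => ->.
rewrite big1 ?addr0 // => K /andP[KF Kp]; move: iF; rewrite /interior_facet.
rewrite (cardsD1 (plus M F)) pF (cardsD1 K) !inE Kp.
by move: (KF); rewrite inE => ->.
Qed.

(** Both vectors are orthogonal to the facet and nonzero. The sign of [c] reflects the orientation
    of [normal], which is free on interior facets. *)
Lemma facet_conormal_normal F : F \in facets M ->
  exists2 c : R, c != 0 & facet_conormal M (plus M F) F = c *: Defs.normal M F.
Proof.
move=> FM; have pM := plus_cell FM; have [cF _] := facetP _ _ FM.
have FK : F \subset plus M F by have := plus_cells_at FM; rewrite inE => /andP[].
have [a [aK _ Fa]] := facet_cellP hM pM cF FK.
have [_ _ nu1 nuF _] := hFD FM.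
set nu := Defs.normal M F in nu1 nuF *; set K := plus M F in pM FK aK Fa *.
have -> : facet_conormal M K F = conormal M K a by rewrite {1}Fa facet_conormalE.
rewrite (conormal_apex hM cF pM aK Fa).
set y := vtx M \o apex_enum cF a; have uy : edge_mx y \in unitmx.
  exact: (unit_apex hM cF pM aK Fa).
have y1 : y i1 = vtx M a by rewrite /y /= apex_enum1.
have yF i : i != i1 -> exists2 v, v \in F & y i = vtx M v.
  rewrite /y /= /apex_enum; case: (unliftP i1 i) => [j ->|->]; last by rewrite eqxx.
  by exists (set_val cF j) => //; exact: set_valP.
have y0 : exists2 v, v \in F & y ord0 = vtx M v by apply: yF; exact: neq_lift.
(* Since [grad_lam y i1] is 1 on the edge towards the apex and 0 on the edges inside the facet, [k]
   is the only possible factor. *)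
pose k := mxdot nu (y i1 - y ord0).
have nuE : nu = k *: grad_lam y i1.
  apply/eqP; rewrite -subr_eq0; apply/eqP; set d := nu - _.
  have : d *m (edge_mx y)^T = 0.
    apply/rowP => j; rewrite !mxE.
    transitivity (mxdot d (y (lift ord0 j) - y ord0)).
      by rewrite mxdot_rV; apply: eq_bigr => i _; rewrite !mxE.
    rewrite /d mxdotBl mxdotZl [X in _ - k * X]mxdotC -lam_sub !lam_vtx //.
    rewrite [i1 == ord0]eq_sym (negbTE (neq_lift _ _)) subr0.
    have [ji|ji] := eqVneq i1 (lift ord0 j); first by rewrite -ji mulr1 subrr.
    have [v0 v0F ->] := y0; have [v vF ->] : exists2 v, v \in F & y (lift ord0 j) = vtx M v.
      by apply: yF; rewrite eq_sym.
    by rewrite mulr0 subr0; apply: nuF; exact: hull_vtx.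
  move=> /(congr1 (mulmx^~ (invmx (edge_mx y)^T))).
  by rewrite mulmxK ?unitmx_tr // mul0mx.
have k0 : k != 0.
  apply/eqP => k0; move: nu1; rewrite nuE k0 scale0r /enorm mxdot0l sqrtr0.
  by move/eqP; rewrite eq_sym oner_eq0.
exists (- `|\det (edge_mx y)| / k).
  by rewrite mulf_neq0 ?invr_neq0 // oppr_eq0 normr_eq0 -unitfE -unitmxE.
by rewrite nuE scalerA divfK.
Qed.

(** A row vector killed by the edges has the same image point as 0, and barycentric coordinates are
    read off from that point by [blam]. *)
Lemma facet_edges_free F : F \in facets M -> row_free (edges M n F).
Proof.
move=> FM; have pM := plus_cell FM; have [cF _] := facetP _ _ FM.
have FK : F \subset plus M F by have := plus_cells_at FM; rewrite inE => /andP[].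
rewrite edges_edge_mx -kermx_eq0; apply/eqP/row_matrixP => i; rewrite row0.
set e := edge_mx _; set t := row i (kermx e).
have te : t *m e = 0 by apply/sub_kermxP; exact: row_sub.
have pt0 : face_pt M F t = face_pt M F 0.
  by rewrite /face_pt !simplex_ptE te mul0mx.
apply: bary_inj => j.
by rewrite -!(blam_face_pt hM cF _ _ pM FK) pt0.
Qed.

Lemma det_gram_gt0 m k (A : 'M[R]_(m, k)) : row_free A ->
  0 <= \det (A *m A^T) -> 0 < \det (A *m A^T).
Proof.
move=> fA dE; rewrite lt_neqAle dE andbT eq_sym; apply/det0P => -[u u0 uA].
have : mxdot (u *m A) (u *m A) = 0.
  by rewrite /mxdot trmx_mul mulmxA -[u *m A *m A^T]mulmxA uA mul0mx mxtrace0.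
move=> /mxdot_eq0 uA0; move: u0; rewrite -(mulmx_free_eq0 u fA) uA0 eqxx //.
Qed.

Definition facet_area F : R :=
  let e := edges M n F in Num.sqrt (\det (e *m e^T)).

(** Bordering the edges by the unit normal gives a square matrix [B] with [B *m B^T] block diagonal;
    hence the Gram determinant is the square of [\det B] and nonnegative. *)
Lemma facet_area_gt0 F : F \in facets M -> 0 < facet_area F.
Proof.
move=> FM; rewrite sqrtr_gt0; set e := edges M n F.
have fe : row_free e := facet_edges_free FM.
have [_ _ nu1 nuF _] := hFD FM; set nu := Defs.normal M F in nu1 nuF.
have [cF _] := facetP _ _ FM.
have nun : nu *m nu^T = 1%:M.
  rewrite [LHS]mx11_scalar; congr (_%:M); move: nu1; rewrite /enorm /mxdot /mxtrace.
  rewrite big_ord1 => h; rewrite -[LHS]sqr_sqrtr ?h ?expr1n //.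
  by have := mxdot_ge0 nu; rewrite /mxdot /mxtrace big_ord1.
have nue : nu *m e^T = 0.
  apply/rowP => j; rewrite !mxE.
  transitivity (mxdot nu (vtx M (set_val cF (lift ord0 j)) - vtx M (set_val cF ord0))).
    rewrite mxdot_rV; apply: eq_bigr => i _; congr (_ * _).
    rewrite /e edges_edge_mx !mxE -(vertices_nth M cF (lift ord0 j)).
    by rewrite -(vertices_nth M cF ord0).
  by apply: nuF; apply: hull_vtx; exact: set_valP.
pose B : 'M[R]_(1 + n, n.+1) := col_mx nu e.
apply: det_gram_gt0 => //.
have BB : B *m B^T = block_mx 1%:M 0 0 (e *m e^T).
  by rewrite /B tr_col_mx mul_col_row nun nue -[e *m nu^T]trmxK trmx_mul trmxK nue trmx0.
have := congr1 determinant BB.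
rewrite det_ublock det1 mul1r => <-.
by rewrite (@det_mulmx _ (1 + n)) det_tr -expr2 sqr_ge0.
Qed.

Lemma enorm_sub_le (b : R) x z : cube 0 b x -> cube 0 b z ->
  enorm (x - z) <= Num.sqrt (\sum_(i < n.+1) (b + b) ^+ 2).
Proof.
move=> xb zb; apply: ler_wsqrtr; rewrite mxdot_rV; apply: ler_sum => i _.
have h : `|(x - z) ord0 i| <= b + b.
  rewrite !mxE (le_trans (ler_normB _ _)) // lerD //.
    by have := xb i; rewrite mxE sub0r normrN.
  by have := zb i; rewrite mxE sub0r normrN.
by rewrite -expr2 -real_normK ?num_real // ler_sqr ?nnegrE // (le_trans _ h).
Qed.

(** For [n = 0] a facet is a point of diameter 0. Otherwise two distinct vertices bound the diameter
    from below, once the facet is known to be bounded so that the supremum is a true one. *)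
Lemma hF_gt0 F : (0 < n)%N -> F \in facets M -> 0 < hF M F.
Proof.
move=> n0 FM; have [cF [K KM FK]] := facetP _ _ FM.
have bF : bounded_set (hull M F).
  have bK := bounded_hull_cell (card_cell hM KM) (free_cell hM KM).
  have [r Kr] := (bounded_set_cube _).1 bK.
  by apply/bounded_set_cube; exists r; apply: subset_trans Kr; exact: hullS.
have [b Fb] := (bounded_set_cube _).1 bF.
pose j : 'I_n.+1 := ord_max.
pose p := vtx M (set_val cF ord0); pose q := vtx M (set_val cF j).
have pF : hull M F p by apply: hull_vtx; exact: set_valP.
have qF : hull M F q by apply: hull_vtx; exact: set_valP.
have pq : p - q != 0.
  rewrite subr_eq0; apply/eqP => e.
  have uK := free_cell hM KM; have cK := card_cell hM KM.
  have inK i : set_val cF i \in K by exact: (fintype.subsetP FK) (set_valP cF i).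
  have := congr1 (blam M K (set_val cF ord0)) e.
  rewrite /p /q !blam_vtx // eqxx (inj_eq (@set_val_inj _ _ _ cF)).
  rewrite (_ : (ord0 == j) = false); last first.
    by apply/eqP => /(congr1 val)/= e0; move: n0; rewrite -e0.
  by move/eqP; rewrite oner_eq0.
apply: (@lt_le_trans _ _ (enorm (p - q))).
  rewrite sqrtr_gt0 lt_neqAle mxdot_ge0 andbT eq_sym.
  by apply: contraNneq pq => /mxdot_eq0 ->.
apply: sup_upper_bound; last by exists (p, q).
split; first by exists (enorm (p - q)), (p, q).
exists (Num.sqrt (\sum_(i < n.+1) (b + b) ^+ 2)) => _ [[x z] [/= xF zF] <-].
by apply: enorm_sub_le; exact: Fb.
Qed.

Lemma facet_intE F (g : E -> R) : facet_int M F g =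
  facet_area F * \int[lebesgue_rV R n]_(t in @ref_simplex R n) g (face_pt M F t).
Proof.
rewrite /facet_int /facet_area /=; congr (_ * _); apply: eq_Rintegral => t _.
by rewrite /face_pt simplex_ptE edges_edge_mx addrC.
Qed.

Lemma green_mesh (w : {set V} -> E -> E) (phi : E -> R) :
  (forall K, K \in cells M -> C1v (w K)) -> C1 phi ->
  \sum_(K in cells M) \int[lebesgue_rV R n.+1]_(x in (hull M K)°)
     (mxdot (w K x) (gradient phi x) + div (w K) x * phi x) =
  \sum_(F in facets M) \sum_(K in cells_at M F)
     face_int M F (fun x => phi x * mxdot (w K x) (facet_conormal M K F)).
Proof.
move=> w1 p1; pose H K F : R := face_int M F
  (fun x => phi x * mxdot (w K x) (facet_conormal M K F)).
rewrite -(sum_cell_facet hM H); apply: eq_bigr => K KM.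
have wp1 : C1v (fun x => phi x *: w K x) by apply: C1v_scale => //; exact: w1.
have := green_cell (card_cell hM KM) (free_cell hM KM) wp1.
under eq_Rintegral => x _ do rewrite (div_scale x p1 (w1 K KM)).
under [in RHS]eq_bigr => a aK do rewrite -(facet_conormalE M aK).
move=> e; transitivity (\sum_(a in K) face_int M (K :\ a)
    (fun x => mxdot (phi x *: w K x) (facet_conormal M K (K :\ a)))).
  rewrite -e; apply: eq_Rintegral => x _.
  by rewrite addrC mulrC.
apply: eq_bigr => a aK; rewrite /H /face_int /int_simplex.
by apply: eq_Rintegral => t _; rewrite mxdotZl.
Qed.

(** The jump of a family of globally defined fields, one for each cell: it is free of the limits in
    [jump]. *)
Definition jump_of F (w : {set V} -> E -> E) (x : E) : E :=
  if interior_facet M F then w (plus M F) x - w (minus M F) x else w (plus M F) x.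

(** Opposite conormals merge the two sides of an interior facet into one jump. The factors [c] come
    from [facet_conormal_normal] and depend on the mesh only. *)
Lemma green_jump : exists2 c : {set V} -> R, (forall F, F \in facets M -> c F != 0) &
  forall (w : {set V} -> E -> E) (phi : E -> R),
  (forall K, K \in cells M -> C1v (w K)) -> C1 phi ->
  \sum_(K in cells M) \int[lebesgue_rV R n.+1]_(x in (hull M K)°)
     (mxdot (w K x) (gradient phi x) + div (w K) x * phi x) =
  \sum_(F in facets M) c F *
     face_int M F (fun x => phi x * mxdot (jump_of F w x) (Defs.normal M F)).
Proof.
have /choice[c cP] F : exists c : R, F \in facets M ->
    c != 0 /\ facet_conormal M (plus M F) F = c *: Defs.normal M F.
  case: (boolP (F \in facets M)) => [/facet_conormal_normal[c c0 cE]|]; last by exists 0.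
  by exists c.
exists c => [F /cP[]//|w phi w1 p1]; rewrite green_mesh //.
apply: eq_bigr => F FM; have [c0 cE] := cP F FM.
rewrite sum_cells_at //.
have cw K : K \in cells M -> continuous (fun x => phi x * mxdot (w K x) (Defs.normal M F)).
  move=> KM; apply: cont_mul; first exact: C1_continuous.
  by apply: C1_continuous; apply: C1_mxdot_cst; exact: w1.
have pM := plus_cell FM.
rewrite /face_int /jump_of; case: ifPn => iF; last first.
  rewrite -int_simplexZ; last exact: cw.
  by apply: eq_Rintegral => t _; rewrite cE mxdotZr mulrCA.
have mM := minus_cell FM iF.
have mE : facet_conormal M (minus M F) F = (- c F) *: Defs.normal M F.
  rewrite scaleNr -cE; apply: (facet_conormal_opposite hM FM).
  - exact: plus_cells_at.
  - exact: minus_cells_at.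
  - by have [_ /(_ iF)[_]] := hFD FM; rewrite eq_sym.
rewrite -int_simplexZ; last first.
  under eq_fun do rewrite mxdotBl mulrBr.
  by apply: cont_sub; exact: cw.
transitivity (int_simplex (fun i : 'I_n.+1 => (vertices M F)`_i)
   (fun x => c F * (phi x * mxdot (w (plus M F) x) (Defs.normal M F))) +
  int_simplex (fun i : 'I_n.+1 => (vertices M F)`_i)
   (fun x => - c F * (phi x * mxdot (w (minus M F) x) (Defs.normal M F)))).
  congr (_ + _); apply: eq_Rintegral => t _; rewrite ?cE ?mE mxdotZr; ring.
rewrite /int_simplex -RintegralD.
- by apply: eq_Rintegral => t _; rewrite mxdotBl; ring.
- exact: measurable_ref_simplex.
- apply: (@integrable_simplex _ _ _ _
    (fun x => c F * (phi x * mxdot (w (plus M F) x) (Defs.normal M F)))).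
  by apply: cont_mul; [exact: cont_cst|exact: cw].
- apply: (@integrable_simplex _ _ _ _
    (fun x => - c F * (phi x * mxdot (w (minus M F) x) (Defs.normal M F)))).
  by apply: cont_mul; [exact: cont_cst|exact: cw].
Qed.

End FacetData.

Lemma conv_hull_compact {R : realType} {m k : nat} (p : 'I_k -> 'rV[R]_m) :
  compact (conv_hull p [set: 'I_k]).
Proof.
(* A mesh without cells, introduced only to reuse the lemmas on [hull]. *)
pose M : mesh R m 'I_k := @Mesh R m _ p finset.set0 id id (fun=> 0).
have -> : conv_hull p [set: 'I_k] = hull M [set: 'I_k] by [].
case: k p M => [|k] p M.
  rewrite (_ : hull M _ = set0); first exact: compact0.
  rewrite predeqE => x; split=> // -[c [_ + _]].
  by rewrite big1 => [/eqP|[]//]; rewrite eq_sym oner_eq0.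
by apply: (@compact_hull _ _ _ M _ k); rewrite cardsT card_ord.
Qed.

(** At a boundary point interior to the closure, the local defining function would vanish and be
    nonpositive all around, which its nonzero gradient excludes. *)
Lemma smooth_boundary_interior {R : realType} {d : nat} (Omega : set 'rV[R]_d) :
  smooth_boundary Omega -> (closure Omega)° `<=` Omega.
Proof.
move=> smo x xc; have [//|xO] := pselect (Omega x); exfalso.
have cx : closure Omega x by exact: interior_subset.
have [|U [phi [oU Ux sphi gphi UO]]] := smo x; first by [].
have Ux_nbhs : nbhs x U by move: oU; rewrite openE; exact.
have cphi z : U z -> {for z, continuous phi}.
  by move=> Uz; have [] := sphi [::] z Uz.
have phi_le0 z : U z -> closure Omega z -> phi z <= 0.
  move=> Uz cz; rewrite leNgt; apply/negP => pz.
  have [] : Omega `&` (U `&` [set y | 0 < phi y]) !=set0.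
    apply: cz; apply: filterI; first by move: oU; rewrite openE; exact.
    have /open_nbhs_nbhs : open_nbhs (phi z) [set r : R | 0 < r].
      by split; [exact: open_gt|].
    exact: cphi.
  move=> y [Oy [Uy py]].
  have : (U `&` Omega) y by [].
  by rewrite UO => -[_] /=; rewrite ltNge (ltW py).
have phix : phi x = 0.
  apply/eqP; rewrite eq_le phi_le0 //= leNgt; apply/negP => px.
  have : (U `&` [set y | phi y < 0]) x by [].
  by rewrite -UO => -[].
have /eqP/rowP/existsNP[i gi] := gphi x Ux.
have di : derivable phi x (delta_mx 0 i).
  by have [_] := sphi [::] x Ux; exact.
move: gi; rewrite !mxE => /eqP; rewrite /partial => D0.
set D := 'D_(delta_mx 0 i) phi x in D0.
have near0 (P : set 'rV[R]_d) : nbhs x P ->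
    \forall h \near (0 : R), P (h *: delta_mx 0 i + x).
  move=> nP; have cl : {for (0 : R), continuous (fun h : R => h *: delta_mx 0 i + x)}.
    apply: cont_mx => a b; under eq_fun do rewrite !mxE.
    apply: cont_add; last exact: cont_cst.
    by apply: cont_mul; [move=> z|exact: cont_cst].
  by apply: cl; rewrite scale0r add0r.
have quot : h^-1 * phi (h *: delta_mx 0 i + x) @[h --> 0^'] --> D.
  have := di; rewrite /derivable.
  have qE : (fun h : R => h^-1 *: ((phi \o shift x) (h *: delta_mx 0 i) - phi x)) =
      fun h => h^-1 * phi (h *: delta_mx 0 i + x).
    by apply/funext => h /=; rewrite phix subr0.
  by rewrite /D /derive qE; exact.
have [e e0 he] : exists2 e : R, 0 < e & forall h, `|h| < e -> h != 0 ->
    [/\ U (h *: delta_mx 0 i + x), closure Omega (h *: delta_mx 0 i + x) &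
        0 < D * (h^-1 * phi (h *: delta_mx 0 i + x))].
  have : \forall h \near 0^', 0 < D * (h^-1 * phi (h *: delta_mx 0 i + x)).
    have : D * (h^-1 * phi (h *: delta_mx 0 i + x)) @[h --> 0^'] --> D * D.
      exact: (cvgM (cvg_cst D) quot).
    move=> /(_ [set r | 0 < r]); apply; apply: open_nbhs_nbhs.
    split; first exact: open_gt.
    by rewrite /= -expr2 exprn_even_gt0.
  have /near0 n1 : nbhs x U by [].
  have /near0 n2 : nbhs x (closure Omega) by exact: xc.
  rewrite /dnbhs near_withinE => n3.
  have : \forall h \near (0 : R), h != 0 ->
    [/\ U (h *: delta_mx 0 i + x), closure Omega (h *: delta_mx 0 i + x) &
        0 < D * (h^-1 * phi (h *: delta_mx 0 i + x))].
    near=> h => h0; split; [near: h; exact: n1|near: h; exact: n2|].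
    by move: h0; near: h; exact: n3.
  move=> /nbhs_ballP[e /= e0 he]; exists e => // h he' h0; apply: he => //.
  by rewrite -ball_normE /= sub0r normrN.
(* The sign of [h] is that of the partial derivative [D], so that [phi] becomes positive after the
   step. *)
pose h := if 0 < D then e / 2 else - (e / 2).
have e2 : 0 < e / 2 by rewrite divr_gt0.
have hn : `|h| < e.
  rewrite /h; case: ifP => _; rewrite ?normrN gtr0_norm // ltr_pdivrMr //;
  by rewrite ltr_pMr // ltr1n.
have h0 : h != 0.
  by rewrite /h; case: ifP => _; rewrite ?oppr_eq0 gt_eqF.
have Dh : 0 < D * h^-1.
  rewrite /h; have [D1|D1] := ltP 0 D; first by rewrite mulr_gt0 // invr_gt0.
  by rewrite invrN mulrN -mulNr mulr_gt0 ?oppr_gt0 ?invr_gt0 // lt_neqAle D0.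
have [Uh ch] := he h hn h0.
rewrite mulrA pmulr_rgt0 // => /(lt_le_trans)/(_ (phi_le0 _ Uh ch)).
by rewrite ltxx.
Unshelve. all: by end_near. Qed.

(** * The cells as a tiling of the domain *)

Section CellsOfDomain.
Context {R : realType} {n : nat} {V : finType}.
Local Notation E := 'rV[R]_n.+1.
Local Notation mu := (lebesgue_rV R n.+1).
Variables (M : mesh R n.+1 V) (Omega : set E).
Hypothesis hOmega : admissible_domain Omega.
Hypothesis hM : simplicial_partition M Omega.
Implicit Types (K : {set V}) (f : E -> R).

Lemma admissible_open : open Omega.
Proof.
case: hOmega => [[]//|[_ [m [p ->]]]]; exact: open_interior.
Qed.

Lemma admissible_measurable : measurable Omega.
Proof. by apply: open_measurable_rV; exact: admissible_open. Qed.

(** The mesh only describes [closure Omega], in which a slit or a puncture would be lost; the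
    admissible domains have none. *)
Lemma interior_closure_admissible : (closure Omega)° `<=` Omega.
Proof.
case: hOmega => [[_ _ _ _]|[_ [m [p ->]]]]; first exact: smooth_boundary_interior.
set C := conv_hull p _; have cC : closed C.
  by apply: compact_closed; [exact: norm_hausdorff|exact: conv_hull_compact].
apply: interiorS; rewrite [X in _ `<=` X](closure_id C).1 //.
by apply: closureS; exact: interior_subset.
Qed.

Lemma closure_cells : closure Omega = \bigcup_(K in [set` cells M]) hull M K.
Proof. by case: hM. Qed.

Lemma interior_cell_sub K : K \in cells M -> (hull M K)° `<=` Omega.
Proof.
move=> KM; apply: subset_trans interior_closure_admissible; apply: interiorS.
by rewrite closure_cells => x Kx; exists K.
Qed.

Lemma interior_cell_disjoint K K' : K \in cells M -> K' \in cells M -> K != K' ->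
  (hull M K)° `&` (hull M K')° = set0.
Proof.
move=> KM K'M neq; rewrite predeqE => x; split=> // -[xK xK'].
have cK := card_cell hM KM; have uK := free_cell hM KM.
have : hull M (K :&: K') x by rewrite -(conforming hM) //; split; exact: interior_subset.
move=> xKK'.
have [v vK vK'] : exists2 v, v \in K & v \notin K'.
  apply/subsetPn; apply: contra neq => KK'.
  by rewrite eqEcard KK' cK (card_cell hM K'M) leqnn.
have := hull_sub_blam0 cK uK (finset.subsetIl K K') xKK' vK.
rewrite inE (negbTE vK') andbF => /(_ isT) e.
by have := interior_hull_blam_gt0 cK uK v xK; rewrite e ltxx.
Qed.

End CellsOfDomain.

(** * Square-integrable functions on the domain *)

(** No sign is assumed for [c]: the values at suitable [t] exclude a negative one. *)
Lemma discriminant_le {R : realFieldType} (a b c : R) :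
  (forall t, 0 <= a + 2 * b * t + c * t ^+ 2) -> b ^+ 2 <= a * c.
Proof.
move=> h; have a0 : 0 <= a by have := h 0; rewrite expr2 !mulr0 !addr0.
have [c0|c0] := leP c 0.
  have [b0|b0] := eqVneq b 0.
    rewrite b0 in h *; have [->|cn0] := eqVneq c 0; first by rewrite mulr0 expr2 mulr0.
    have cl : c < 0 by rewrite lt_neqAle cn0.
    (* This [t] is at least 1, so [c * t ^+ 2 <= c * t = - (a + 1 - c) < - a]. *)
    have := h ((a + 1 - c) / - c); rewrite mulr0 mul0r addr0 => h1.
    exfalso; move: h1; rewrite leNgt => /negP; apply.
    have nc : 0 < - c by lra.
    set s := (a + 1 - c) / - c.
    have s1 : 1 <= s by rewrite ler_pdivlMr //; lra.
    have : a < - c * s by rewrite mulrC divfK ?gt_eqF //; lra.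
    nra.
  (* The linear term becomes [- (a + 1)] and the quadratic one is nonpositive. *)
  exfalso; have := h (- (a + 1) / (2 * b)).
  have -> : 2 * b * (- (a + 1) / (2 * b)) = - (a + 1) by field.
  by have := sqr_ge0 (- (a + 1) / (2 * b)); nra.
(* The minimizer of the quadratic polynomial. *)
have := h (- b / c); have -> : 2 * b * (- b / c) = - (2 * (b ^+ 2 / c)) by ring.
have -> : c * (- b / c) ^+ 2 = b ^+ 2 / c by field; exact: lt0r_neq0.
by move=> h1; rewrite -ler_pdivrMr //; lra.
Qed.

Section L2Functions.
Context {R : realType} {n : nat}.
Local Notation E := 'rV[R]_n.
Local Notation mu := (lebesgue_rV R n).
Variable Omega : set E.
Hypothesis mO : measurable Omega.
Implicit Types f g : E -> R.

Lemma L2_sqr_integrable f : L2 Omega f -> mu.-integrable Omega (fun x => ((f x) ^+ 2)%:E).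
Proof.
move=> [mf fi]; apply/integrableP; split.
  by apply/measurable_EFinP; exact: measurable_funX.
by under eq_integral => x _ do rewrite gee0_abs ?lee_fin ?sqr_ge0 //.
Qed.

Lemma L2_mul_integrable f g : L2 Omega f -> L2 Omega g ->
  mu.-integrable Omega (EFin \o (fun x => f x * g x)).
Proof.
move=> f2 g2; have := integrableD mO (L2_sqr_integrable f2) (L2_sqr_integrable g2).
apply: le_integrable => //.
  by apply/measurable_EFinP; apply: measurable_funM; [case: f2|case: g2].
move=> x _ /=; rewrite lee_fin normrM.
rewrite (ger0_norm (addr_ge0 (sqr_ge0 (f x)) (sqr_ge0 (g x)))).
rewrite -(real_normK (num_real (f x))) -(real_normK (num_real (g x))).
have := sqr_ge0 (`|f x| - `|g x|).
by have := mulr_ge0 (normr_ge0 (f x)) (normr_ge0 (g x)); nra.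
Qed.

Lemma L2_lin (a : R) f g : L2 Omega f -> L2 Omega g -> L2 Omega (fun x => a * f x + g x).
Proof.
move=> f2 g2; have m1 : measurable_fun Omega (fun x => a * f x + g x).
  apply: measurable_funD; last by case: g2.
  by apply: measurable_funM => //; case: f2.
split=> //.
have /integrableP[_ i1] := integrableD mO
  (integrableZl mO (2 * a ^+ 2) (L2_sqr_integrable f2))
  (integrableZl mO 2 (L2_sqr_integrable g2)).
apply: le_lt_trans i1; apply: ge0_le_integral => //.
- by move=> x _; rewrite lee_fin sqr_ge0.
- by apply/measurable_EFinP; exact: measurable_funX.
- apply: measurableT_comp => //; apply: emeasurable_funD;
  apply: measurable_funeM; apply/measurable_EFinP; apply: measurable_funX;
  by [case: f2|case: g2].
move=> x _ /=; rewrite lee_fin; apply: le_trans (ler_norm _).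
by have := sqr_ge0 (a * f x - g x); nra.
Qed.

Lemma L2_scale (a : R) f : L2 Omega f -> L2 Omega (fun x => a * f x).
Proof.
move=> f2; have := L2_lin (a - 1) f2 f2.
by rewrite (_ : (fun x => (a - 1) * f x + f x) = fun x => a * f x) //; apply/funext => x; ring.
Qed.

Lemma L2_cst0 : L2 Omega (fun=> 0).
Proof.
split; first exact: measurable_cst.
by rewrite (eq_integral (cst 0%E)) ?integral0 // => x _; rewrite expr2 mulr0.
Qed.

Lemma L2_sum (I : Type) (r : seq I) (P : pred I) (f : I -> E -> R) :
  (forall i, P i -> L2 Omega (f i)) -> L2 Omega (fun x => \sum_(i <- r | P i) f i x).
Proof.
move=> h; elim: r => [|i r IH].
  by rewrite (_ : (fun _ => _) = fun=> 0); [exact: L2_cst0|apply/funext => x; rewrite big_nil].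
case: (boolP (P i)) => Pi; last first.
  rewrite (_ : (fun _ => _) = fun x => \sum_(j <- r | P j) f j x) //.
  by apply/funext => x; rewrite big_cons (negbTE Pi).
rewrite (_ : (fun _ => _) = fun x => f i x + \sum_(j <- r | P j) f j x); last first.
  by apply/funext => x; rewrite big_cons Pi.
have := L2_lin 1 (h i Pi) IH.
by rewrite (_ : (fun x => 1 * f i x + _) = fun x => f i x + \sum_(j <- r | P j) f j x) //;
  apply/funext => x; rewrite mul1r.
Qed.

Lemma L2v_lin (a : R) (v w : E -> E) : L2v Omega v -> L2v Omega w ->
  L2v Omega (fun x => a *: v x + w x).
Proof.
by move=> hv hw i; under eq_fun do rewrite !mxE; exact: L2_lin.
Qed.

Lemma integrable_mxdot (v w : E -> E) : L2v Omega v -> L2v Omega w ->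
  mu.-integrable Omega (EFin \o (fun x => mxdot (v x) (w x))).
Proof.
move=> hv hw.
rewrite (_ : EFin \o _ = fun x => (\sum_i (v x ord0 i * w x ord0 i)%:E)%E).
  by apply: integrable_sum => // i _; exact: L2_mul_integrable.
by apply/funext => x /=; rewrite mxdot_rV sumEFin.
Qed.

Lemma ipL2_linr (f v w : E -> E) (a : R) : L2v Omega f -> L2v Omega v -> L2v Omega w ->
  ipL2 Omega f (fun x => a *: v x + w x) = a * ipL2 Omega f v + ipL2 Omega f w.
Proof.
move=> hf hv hw; rewrite /ipL2 -RintegralZl //; last exact: integrable_mxdot.
rewrite -RintegralD //.
- by apply: eq_Rintegral => x _; rewrite mxdotDr mxdotZr.
- rewrite (_ : EFin \o _ = fun x => (a%:E * (EFin \o (fun x => mxdot (f x) (v x))) x)%E) //.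
  by apply: integrableZl => //; exact: integrable_mxdot.
- exact: integrable_mxdot.
Qed.

Lemma ipL2C (v w : E -> E) : ipL2 Omega v w = ipL2 Omega w v.
Proof. by apply: eq_Rintegral => x _; rewrite mxdotC. Qed.

Lemma ipL2_ge0 (v : E -> E) : 0 <= ipL2 Omega v v.
Proof. by apply: Rintegral_ge0 => x _; exact: mxdot_ge0. Qed.

Lemma ipL2_cauchy_schwarz (f v : E -> E) : L2v Omega f -> L2v Omega v ->
  `|ipL2 Omega f v| <= normL2v Omega f * normL2v Omega v.
Proof.
move=> hf hv; rewrite /normL2v -sqrtrM ?ipL2_ge0 // -sqrtr_sqr ler_wsqrtr //.
apply: discriminant_le => t; have hw := L2v_lin t hv hf.
suff <- : ipL2 Omega (fun x => t *: v x + f x) (fun x => t *: v x + f x) =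
  ipL2 Omega f f + 2 * ipL2 Omega f v * t + ipL2 Omega v v * t ^+ 2 by exact: ipL2_ge0.
rewrite ipL2_linr // (ipL2C _ v) (ipL2C _ f) !ipL2_linr // (ipL2C v f).
ring.
Qed.

End L2Functions.

Section CellIntegrals.
Context {R : realType} {n : nat} {V : finType}.
Local Notation E := 'rV[R]_n.+1.
Local Notation mu := (lebesgue_rV R n.+1).
Variables (M : mesh R n.+1 V) (Omega : set E).
Hypothesis hOmega : admissible_domain Omega.
Hypothesis hM : simplicial_partition M Omega.
Implicit Types (K : {set V}) (f : E -> R).

Let mO := admissible_measurable hOmega.

Lemma bounded_cell K : K \in cells M -> bounded_set (hull M K)°.
Proof. by move=> KM; apply: bounded_interior_cell; [exact: (card_cell hM)|exact: (free_cell hM)]. Qed.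

(** The finitely many cells cover the domain, which treats smooth domains and polytopes alike. *)
Lemma bounded_admissible : bounded_set Omega.
Proof.
have /choice[r rP] K : exists r : R, K \in cells M -> hull M K `<=` cube 0 r.
  case: (boolP (K \in cells M)) => [KM|]; last by exists 0.
  have /bounded_set_cube[r h] := bounded_hull_cell (card_cell hM KM) (free_cell hM KM).
  by exists r.
apply/bounded_set_cube; exists (\sum_(K in cells M) `|r K|) => x xO i.
have : closure Omega x by exact: subset_closure.
rewrite (closure_cells hM) => -[K /= KM xK].
rewrite (le_trans (rP K KM x xK i)) // (le_trans (ler_norm _)) //.
by rewrite (bigD1 K) //= lerDl sumr_ge0.
Qed.

Lemma admissible_lty : (mu Omega < +oo)%E.
Proof. by apply: lebesgue_rV_bounded_lty => //; exact: bounded_admissible. Qed.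

Lemma negligible_skeleton :
  mu.-negligible (Omega `\` \bigcup_(K in [set` cells M]) (hull M K)°).
Proof.
have [F [FE Fn]] : exists F : set E,
    \bigcup_(K in [set` cells M]) (hull M K `\` (hull M K)°) = F /\ mu.-negligible F.
  eexists; split; first exact: (bigcup_pred (mem (cells M))).
  elim/big_ind : _ => [|A B|K KM]; first exact: negligible_set0.
    exact: negligibleU.
  have cK := card_cell hM KM; have uK := free_cell hM KM.
  exists (hull M K `\` (hull M K)°); split=> //; last exact: hull_boundary0.
  apply: measurableD; last exact: measurable_interior_cell.
  by apply: closed_measurable_rV; exact: closed_hull cK.
apply: negligibleS Fn; rewrite -FE => x [xO xK].
have : closure Omega x by exact: subset_closure.
rewrite (closure_cells hM) => -[K KM xhK]; exists K => //; split=> // xi.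
by apply: xK; exists K.
Qed.

Lemma Rintegral_cells f : mu.-integrable Omega (EFin \o f) ->
  \int[mu]_(x in Omega) f x = broken_int M f.
Proof.
move=> fi; rewrite /broken_int.
set U := \bigcup_(K in [set` cells M]) (hull M K)°.
pose G K := if K \in cells M then (hull M K)° else set0.
have mG K : measurable (G K).
  by rewrite /G; case: ifPn => // KM; exact: measurable_interior_cell.
have UE : U = \big[setU/set0]_(K <- enum (cells M)) G K.
  rewrite /U (bigcup_pred (mem (cells M))) [RHS]big_enum /=.
  by apply: eq_bigr => K KM; rewrite /G KM.
have UO : U `<=` Omega.
  by move=> x [K KM]; exact: (interior_cell_sub hOmega hM).
have mU : measurable U by rewrite UE; exact: bigsetU_measurable.
have N0 : mu (Omega `\` U) = 0%E.
  by apply: measure_negligible; [exact: measurableD|exact: negligible_skeleton].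
rewrite /Rintegral (@negligible_integral _ _ _ _ _ (Omega `\` U)) //; last exact: measurableD.
have -> : Omega `\` (Omega `\` U) = U.
  by rewrite setDD; apply/setIidPr.
have Ui : mu.-integrable U (EFin \o f) by exact: integrableS fi.
have GU K : G K `<=` U.
  by rewrite /G; case: ifPn => // KM x xK; exists K.
rewrite UE integral_bigsetU_EFin ?enum_uniq //.
- rewrite -sum_fine; last first.
    move=> K _; apply: integrable_fin_num => //; exact: integrableS Ui.
  by rewrite big_enum; apply: eq_bigr => K KM; rewrite /G KM.
- move=> K K' /=; rewrite !mem_enum => KM K'M [x [xK xK']].
  apply/eqP/negPn/negP => neq.
  have : ((hull M K)° `&` (hull M K')°) x by move: xK xK'; rewrite /G KM K'M.
  by rewrite (interior_cell_disjoint hM).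
- by rewrite -UE; case/integrableP: Ui.
Qed.

Definition piecewise (g : {set V} -> E -> R) (x : E) : R :=
  \sum_(K in cells M) \1_((hull M K)°) x * g K x.

Lemma piecewiseE g K x : K \in cells M -> (hull M K)° x -> piecewise g x = g K x.
Proof.
move=> KM xK; rewrite /piecewise (bigD1 K) //= big1 ?addr0.
  by rewrite indicE mem_set // mul1r.
move=> K' /andP[K'M neq]; rewrite indicE memNset ?mul0r // => xK'.
have : ((hull M K')° `&` (hull M K)°) x by [].
by rewrite (interior_cell_disjoint hM).
Qed.

Lemma L2_bounded_measurable f (b : R) : measurable_fun Omega f ->
  (forall x, Omega x -> `|f x| <= b) -> L2 Omega f.
Proof.
move=> mf fb; split=> //.
have : mu.-integrable Omega (EFin \o (fun x => f x ^+ 2)).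
  apply: measurable_bounded_integrable => //; first exact: admissible_lty.
    exact: measurable_funX.
  exists (b ^+ 2); split; first exact: num_real.
  move=> N bN x xO; rewrite /= normrX (le_trans _ (ltW bN)) //.
  by rewrite lerXn2r ?nnegrE // ?(le_trans _ (fb x xO)) //; exact: fb.
case/integrableP => _; apply: le_lt_trans; apply: ge0_le_integral => //.
- by move=> x _; rewrite lee_fin sqr_ge0.
- by apply/measurable_EFinP; exact: measurable_funX.
- by apply: measurableT_comp => //; apply/measurable_EFinP; exact: measurable_funX.
- by move=> x _; rewrite /= lee_fin ler_norm.
Qed.

Lemma L2_continuous f : continuous f -> L2 Omega f.
Proof.
move=> cf; have [r Or] := (bounded_set_cube _).1 bounded_admissible.
have [b fb] := bounded_continuous_cube r cf.
apply: (@L2_bounded_measurable _ b).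
  by apply: measurable_funTS; exact: continuous_measurable_rV.
by move=> x /Or; exact: fb.
Qed.

Lemma L2_piecewise g : (forall K, K \in cells M -> continuous (g K)) ->
  L2 Omega (piecewise g).
Proof.
move=> cg; apply: L2_sum => // K KM; have [mf [r Or]] : measurable_fun Omega (g K) /\
    exists r, Omega `<=` cube 0 r.
  split; last exact/bounded_set_cube/bounded_admissible.
  by apply: measurable_funTS; apply: continuous_measurable_rV; exact: cg.
have [b fb] := bounded_continuous_cube r (cg K KM).
apply: (@L2_bounded_measurable _ b).
  apply: measurable_funM => //; apply: measurable_indic; exact: measurable_interior_cell.
move=> x /Or/fb gb; rewrite normrM (le_trans _ gb) // ler_piMl //.
by rewrite indicE; case: (_ \in _); rewrite ?normr1 ?normr0.
Qed.

Lemma L2_integrable f : L2 Omega f -> mu.-integrable Omega (EFin \o f).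
Proof.
move=> f2; have c1 : L2 Omega (fun=> 1).
  by apply: L2_continuous; exact: cont_cst.
have := L2_mul_integrable mO f2 c1.
by rewrite (_ : (fun x => f x * 1) = f) //; apply/funext => x; rewrite mulr1.
Qed.

End CellIntegrals.

(** * Bilinear forms of the method *)

Section PositiveFunctionals.
Context {R : realType} {T : topologicalType}.

(** The extension is continuous on the whole space: it bounds [g] on an open cell and provides its
    traces. *)
Definition cont_on {W : topologicalType} (D : set T) (g : T -> W) :=
  exists2 h : T -> W, continuous h & forall x, D x -> g x = h x.

(** Integration over an open cell and over a facet share these properties; linearity, positivity and
    the Cauchy-Schwarz inequality are proved once for both. *)
Definition pos_functional (D : set T) (I : (T -> R) -> R) :=
  [/\ forall f g : T -> R, (forall x, D x -> f x = g x) -> I f = I g,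
      forall (a : R) (f g : T -> R), continuous f -> continuous g ->
        I (fun x => a * f x + g x) = a * I f + I g
    & forall f : T -> R, continuous f -> (forall x, D x -> 0 <= f x) -> 0 <= I f].

Definition inner_product {W : normedModType R} (dot : W -> W -> R) :=
  [/\ forall a u v w, dot (a *: u + v) w = a * dot u w + dot v w,
      forall u v, dot u v = dot v u,
      forall u, 0 <= dot u u
    & forall f g : T -> W, continuous f -> continuous g ->
        continuous (fun x => dot (f x) (g x))].

Lemma inner_mul : @inner_product R^o (fun x y => x * y).
Proof.
split=> [a u v w|u v|u|f g cf cg]; first by rewrite mulrDl -mulrA.
- exact: mulrC.
- by rewrite -expr2 sqr_ge0.
- exact: cont_mul.
Qed.

Lemma continuous_lin {W : normedModType R} (a : R) (f g : T -> W) :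
  continuous f -> continuous g -> continuous (fun x => a *: f x + g x).
Proof.
by move=> cf cg x; apply: cvgD; [apply: cvgZ; [exact: cvg_cst|exact: cf]|exact: cg].
Qed.

Section Functional.
Variables (D : set T) (I : (T -> R) -> R).
Hypothesis hI : pos_functional D I.
Context {W : normedModType R}.
Variable dot : W -> W -> R.
Hypothesis hdot : inner_product dot.
Implicit Types f g h : T -> W.

Let eqI f g : (forall x, D x -> f x = g x) ->
  forall k, I (fun x => dot (f x) (k x)) = I (fun x => dot (g x) (k x)).
Proof. by case: hI => [cI _ _] fg k; apply: cI => x Dx; rewrite fg. Qed.

Lemma functionalC f g : I (fun x => dot (f x) (g x)) = I (fun x => dot (g x) (f x)).
Proof. by case: hI => [cI _ _]; apply: cI => x _; case: hdot => _ dC _ _; exact: dC. Qed.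

Lemma functional_linl a f f1 f2 g : (forall x, D x -> f x = a *: f1 x + f2 x) ->
  cont_on D f1 -> cont_on D f2 -> cont_on D g ->
  I (fun x => dot (f x) (g x)) =
  a * I (fun x => dot (f1 x) (g x)) + I (fun x => dot (f2 x) (g x)).
Proof.
move=> fE [h1 c1 e1] [h2 c2 e2] [h ch e].
have [cI lI _] := hI; have [dl dC _ dc] := hdot.
rewrite (eqI e1) (eqI e2) (eqI fE) !(functionalC _ g) !(eqI e).
rewrite -lI; [|exact: dc..]; apply: cI => x Dx.
by rewrite e1 // e2 // dC dl !(dC (h x)).
Qed.

Lemma functional_linr a f f1 f2 g : (forall x, D x -> f x = a *: f1 x + f2 x) ->
  cont_on D f1 -> cont_on D f2 -> cont_on D g ->
  I (fun x => dot (g x) (f x)) =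
  a * I (fun x => dot (g x) (f1 x)) + I (fun x => dot (g x) (f2 x)).
Proof. by move=> fE c1 c2 cg; rewrite !(functionalC g); exact: functional_linl. Qed.

Lemma functional_ge0 f : cont_on D f -> 0 <= I (fun x => dot (f x) (f x)).
Proof.
move=> [h ch e]; have [cI lI pI] := hI; have [dl dC dp dc] := hdot.
by rewrite (eqI e) functionalC (eqI e); apply: pI => //; exact: dc.
Qed.

Lemma cont_on_lin a f g : cont_on D f -> cont_on D g ->
  cont_on D (fun x => a *: f x + g x).
Proof.
move=> [h1 c1 e1] [h2 c2 e2]; exists (fun x => a *: h1 x + h2 x).
  exact: continuous_lin.
by move=> x Dx; rewrite e1 // e2.
Qed.

Lemma functional_cauchy_schwarz f g : cont_on D f -> cont_on D g ->
  I (fun x => dot (f x) (g x)) ^+ 2 <=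
  I (fun x => dot (f x) (f x)) * I (fun x => dot (g x) (g x)).
Proof.
move=> cf cg; apply: discriminant_le => t.
have ch := cont_on_lin t cg cf.
suff <- : I (fun x => dot (t *: g x + f x) (t *: g x + f x)) =
  I (fun x => dot (f x) (f x)) + 2 * I (fun x => dot (f x) (g x)) * t +
  I (fun x => dot (g x) (g x)) * t ^+ 2.
  exact: (functional_ge0 ch).
rewrite (@functional_linl t _ g f) //.
rewrite (functionalC g) (functionalC f (fun x => t *: g x + f x)).
rewrite !(@functional_linl t (fun x => t *: g x + f x) g f) // (functionalC g f).
ring.
Qed.

Lemma functional_eq0 f g : cont_on D f -> cont_on D g ->
  I (fun x => dot (f x) (f x)) = 0 -> I (fun x => dot (f x) (g x)) = 0.
Proof.
move=> cf cg f0; have := functional_cauchy_schwarz cf cg.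
by rewrite f0 mul0r => h; apply/eqP; rewrite -sqrf_eq0 eq_le h sqr_ge0.
Qed.

End Functional.
End PositiveFunctionals.

Lemma inner_mxdot {R : realType} {T : topologicalType} m n :
  @inner_product R T 'M[R]_(m, n) (@mxdot R m n).
Proof.
split=> [a u v w|u v|u|f g].
- by rewrite mxdotDl mxdotZl.
- exact: mxdotC.
- exact: mxdot_ge0.
- exact: cont_mxdot.
Qed.

Section DiscreteFields.
Context {R : realType} {n : nat} {V : finType}.
Local Notation E := 'rV[R]_n.+1.
Local Notation mu := (lebesgue_rV R n.+1).
Variables (M : mesh R n.+1 V) (Omega : set E).
Hypotheses (hM : simplicial_partition M Omega) (hFD : facet_data M).
Implicit Types (K F : {set V}).

Lemma cell_functional K : K \in cells M ->
  pos_functional (hull M K)° (fun g => \int[mu]_(x in (hull M K)°) g x).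
Proof.
move=> KM; have mK := measurable_interior_cell M K.
have bK : bounded_set (hull M K)° by exact: (bounded_cell hM KM).
split.
- by move=> f g fg; apply: eq_Rintegral => x /set_mem /fg.
- move=> a f g cf cg; rewrite -RintegralZl //; last exact: integrable_continuous_bounded.
  rewrite -RintegralD //; last exact: integrable_continuous_bounded.
  apply: (@integrable_continuous_bounded _ _ _ (fun x => a * f x)) => //.
  by apply: cont_mul => //; exact: cont_cst.
- by move=> f _ f0; exact: Rintegral_ge0.
Qed.

Lemma facet_functional F : F \in facets M -> pos_functional (hull M F) (facet_int M F).
Proof.
move=> FM; have /facetP[cF _] := FM; split.
- move=> f g fg; rewrite !facet_intE; congr (_ * _); apply: eq_Rintegral => t /set_mem St.
  by apply: fg; exact: hull_face_pt.
- move=> a f g cf cg; rewrite !facet_intE mulrCA -mulrDr; congr (_ * _).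
  have mS := @measurable_ref_simplex R n.
  rewrite -RintegralZl //; last exact: integrable_simplex.
  rewrite -RintegralD //; last exact: integrable_simplex.
  apply: (@integrable_simplex _ _ _ _ (fun x => a * f x)).
  by apply: cont_mul => //; exact: cont_cst.
- move=> f _ f0; rewrite facet_intE mulr_ge0 ?sqrtr_ge0 //.
  by apply: Rintegral_ge0 => t St; apply: f0; exact: hull_face_pt.
Qed.

Section Traces.
Context {W : normedModType R}.
Implicit Types g h : E -> W.

Definition pw_cont g := forall K, K \in cells M -> cont_on (hull M K)° g.

Definition pw_lin g (a : R) (g1 g2 : E -> W) := forall K x, K \in cells M ->
  (hull M K)° x -> g x = a *: g1 x + g2 x.

(** Points of the closed cell are limits of interior points, so the filter is proper and the limit
    unique. *)
Lemma trace_eq K g h x : K \in cells M -> continuous h ->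
  (forall y, (hull M K)° y -> g y = h y) -> hull M K x -> trace M K g x = h x.
Proof.
move=> KM ch gh xK.
have cl := hull_sub_closure_interior (card_cell hM KM) (free_cell hM KM) xK.
have pF : ProperFilter (within (hull M K)° (nbhs x)).
  apply: Build_ProperFilter_ex => P /= nP.
  by have [y [yK Py]] := cl _ nP; exists y; exact: Py.
apply: cvg_lim; first exact: norm_hausdorff.
have cw : h y @[y --> within (hull M K)° (nbhs x)] --> h x.
  by apply: cvg_within_filter; exact: ch.
apply: cvg_trans cw; apply: near_eq_cvg; rewrite near_withinE; near=> y => yK; exact/esym/gh.
Unshelve. all: by end_near. Qed.

Lemma cont_on_trace K F g : K \in cells M -> F \subset K -> pw_cont g ->
  cont_on (hull M F) (trace M K g).
Proof.
move=> KM FK /(_ K KM)[h ch gh]; exists h => // x xF.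
by apply: trace_eq => //; exact: hullS xF.
Qed.

Lemma trace_lin K g a g1 g2 x : K \in cells M -> hull M K x -> pw_lin g a g1 g2 ->
  pw_cont g1 -> pw_cont g2 -> trace M K g x = a *: trace M K g1 x + trace M K g2 x.
Proof.
move=> KM xK gE /(_ K KM)[h1 c1 e1] /(_ K KM)[h2 c2 e2].
rewrite (trace_eq KM c1 e1 xK) (trace_eq KM c2 e2 xK).
apply: (trace_eq KM (h := fun x => a *: h1 x + h2 x)) => //.
  exact: continuous_lin.
by move=> y yK; rewrite (gE K) // e1 // e2.
Qed.

Lemma facet_sub_plus F : F \in facets M -> F \subset plus M F.
Proof. by move=> /(plus_cells_at hFD); rewrite inE => /andP[]. Qed.

Lemma facet_sub_minus F : F \in facets M -> interior_facet M F -> F \subset minus M F.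
Proof. by move=> FM /(minus_cells_at hFD FM); rewrite inE => /andP[]. Qed.

Let pM := plus_cell hFD.
Let mM := minus_cell hFD.

Lemma cont_on_jump F g : F \in facets M -> pw_cont g -> cont_on (hull M F) (jump M F g).
Proof.
move=> FM cg; have [h ch e] := cont_on_trace (pM FM) (facet_sub_plus FM) cg.
case: (boolP (interior_facet M F)) => iF; last first.
  by exists h => // x xF; rewrite /jump (negbTE iF) e.
have [h' ch' e'] := cont_on_trace (mM FM iF) (facet_sub_minus FM iF) cg.
exists (fun x => -1 *: h' x + h x); first exact: continuous_lin.
by move=> x xF; rewrite /jump iF e // e' // scaleN1r addrC.
Qed.

Lemma cont_on_avg F g : F \in facets M -> pw_cont g -> cont_on (hull M F) (avg M F g).
Proof.
move=> FM cg; have [h ch e] := cont_on_trace (pM FM) (facet_sub_plus FM) cg.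
case: (boolP (interior_facet M F)) => iF; last first.
  by exists h => // x xF; rewrite /avg (negbTE iF) e.
have [h' ch' e'] := cont_on_trace (mM FM iF) (facet_sub_minus FM iF) cg.
exists (fun x => 2^-1 *: h x + (2^-1 *: h' x + 0)).
  by apply: continuous_lin => //; apply: continuous_lin => //; exact: cst_continuous.
by move=> x xF; rewrite /avg iF e // e' // addr0 scalerDr.
Qed.

Lemma jump_lin F g a g1 g2 x : F \in facets M -> hull M F x -> pw_lin g a g1 g2 ->
  pw_cont g1 -> pw_cont g2 -> jump M F g x = a *: jump M F g1 x + jump M F g2 x.
Proof.
move=> FM xF gE c1 c2; have xp := hullS (facet_sub_plus FM) xF.
have tp := trace_lin (pM FM) xp gE c1 c2.
rewrite /jump; case: ifPn => // iF; have xm := hullS (facet_sub_minus FM iF) xF.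
by rewrite tp (trace_lin (mM FM iF) xm gE c1 c2) scalerBr opprD addrACA.
Qed.

Lemma avg_lin F g a g1 g2 x : F \in facets M -> hull M F x -> pw_lin g a g1 g2 ->
  pw_cont g1 -> pw_cont g2 -> avg M F g x = a *: avg M F g1 x + avg M F g2 x.
Proof.
move=> FM xF gE c1 c2; have xp := hullS (facet_sub_plus FM) xF.
have tp := trace_lin (pM FM) xp gE c1 c2.
rewrite /avg; case: ifPn => // iF; have xm := hullS (facet_sub_minus FM iF) xF.
rewrite tp (trace_lin (mM FM iF) xm gE c1 c2) scalerA [a * _]mulrC -scalerA -scalerDr.
by congr (_ *: _); rewrite scalerDr addrACA.
Qed.

End Traces.
End DiscreteFields.

Section LinearCombinations.
Context {R : comPzRingType}.
Implicit Types a c x y z : R.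

(** This and the next lemmas carry a relation [x = a * y + z] through the operations that build the
    forms, so that linearity is proved term by term. *)
Lemma mul_lin c a x y z : x = a * y + z -> c * x = a * (c * y) + c * z.
Proof. by move=> ->; rewrite mulrDr mulrCA. Qed.

Lemma opp_lin a x y z : x = a * y + z -> - x = a * - y + - z.
Proof. by move=> ->; rewrite opprD mulrN. Qed.

Lemma add_lin a x y z x' y' z' : x = a * y + z -> x' = a * y' + z' ->
  x + x' = a * (y + y') + (z + z').
Proof. by move=> -> ->; rewrite mulrDr addrACA. Qed.

Lemma sub_lin a x y z x' y' z' : x = a * y + z -> x' = a * y' + z' ->
  x - x' = a * (y - y') + (z - z').
Proof. by move=> xE /opp_lin; exact: add_lin. Qed.

Lemma sum_lin (I : finType) (P : pred I) a (f f1 f2 : I -> R) :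
  (forall i, P i -> f i = a * f1 i + f2 i) ->
  \sum_(i | P i) f i = a * \sum_(i | P i) f1 i + \sum_(i | P i) f2 i.
Proof. by move=> h; rewrite mulr_sumr -big_split; exact: eq_bigr. Qed.

End LinearCombinations.

Section Forms.
Context {R : realType} {n : nat} {V : finType}.
Local Notation E := 'rV[R]_n.+1.
Variables (M : mesh R n.+1 V) (Omega : set E).
Hypotheses (hM : simplicial_partition M Omega) (hFD : facet_data M).
Implicit Types (K F : {set V}) (v w : E -> E) (q : E -> R).

Definition pw_C1 v := forall K, K \in cells M ->
  exists2 w, C1v w & forall x, (hull M K)° x -> v x = w x.

Lemma pw_C1_cont v : pw_C1 v -> pw_cont M v.
Proof. by move=> pv K /pv[w w1 vw]; exists w => //; exact: C1v_continuous. Qed.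

Lemma cell_near K v w x : (forall y, (hull M K)° y -> v y = w y) ->
  (hull M K)° x -> \near x, v x = w x.
Proof.
move=> vw xK; have : nbhs x (hull M K)°.
  by have := open_interior (hull M K); rewrite openE; exact.
by apply: filterS => y /vw.
Qed.

Lemma cell_jacobian K v w x : C1v w -> (forall y, (hull M K)° y -> v y = w y) ->
  (hull M K)° x -> 'J v x = 'J w x.
Proof.
move=> cw vw xK; have := jacobian_near (cell_near vw xK) (C1v_differentiable x cw).
by case.
Qed.

Lemma pw_cont_jacobian v : pw_C1 v -> pw_cont M (fun x => 'J v x).
Proof.
move=> pv K /pv[w w1 vw]; exists (fun x => 'J w x); first exact: C1v_continuous_jacobian.
by move=> x; exact: cell_jacobian.
Qed.

Lemma pw_lin_jacobian v a v1 v2 : pw_lin M v a v1 v2 -> pw_C1 v1 -> pw_C1 v2 ->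
  pw_lin M (fun x => 'J v x) a (fun x => 'J v1 x) (fun x => 'J v2 x).
Proof.
move=> vE p1 p2 K x KM xK; have [w1 c1 e1] := p1 K KM; have [w2 c2 e2] := p2 K KM.
have c3 : C1v (fun x => a *: w1 x + w2 x) by apply: C1vD => //; exact: C1vZ.
rewrite (cell_jacobian c3 _ xK); last by move=> y yK; rewrite (vE K) // e1 // e2.
rewrite (cell_jacobian c1 e1 xK) (cell_jacobian c2 e2 xK).
have j3 i j := C1v_jacobian x i j c3; have j1 i j := C1v_jacobian x i j c1.
have j2 i j := C1v_jacobian x i j c2; move: j1 j2 j3.
move: ('J w1 x) ('J w2 x) ('J (fun z => a *: w1 z + w2 z) x) => A B C eA eB eC.
apply/matrixP => i j; rewrite !mxE eA eB eC.
rewrite (_ : (fun y => _) = fun y => cst a y * w1 y ord0 j + w2 y ord0 j); last first.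
  by apply/funext => y; rewrite !mxE.
have d1 y : differentiable (fun y => w1 y ord0 j) y by case: (c1 j).
have da y : differentiable (cst a : E -> R) y by case: (@C1_cst R n.+1 a).
rewrite partialD; last 2 first.
- by apply: C1_differentiable; apply: C1M; [exact: C1_cst|exact: c1].
- by case: (c2 j).
by rewrite partialM // partial_cst mulr0 addr0.
Qed.

Lemma pw_cont_div v : pw_C1 v -> pw_cont M (div v : E -> R^o).
Proof.
move=> pv K /pv[w w1 vw]; exists (div w); first exact: C1v_continuous_div.
by move=> x xK; rewrite /div (cell_jacobian w1 vw xK).
Qed.

Lemma pw_lin_div v a v1 v2 : pw_lin M v a v1 v2 -> pw_C1 v1 -> pw_C1 v2 ->
  pw_lin M (div v : E -> R^o) a (div v1) (div v2).
Proof.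
move=> vE p1 p2 K x KM xK; rewrite /div (pw_lin_jacobian vE p1 p2 KM xK).
by rewrite mxtraceD mxtraceZ.
Qed.

Lemma cont_on_map {W U : normedModType R} (D : set E) (f : W -> U) (g : E -> W) :
  continuous f -> cont_on D g -> cont_on D (f \o g).
Proof.
move=> cf [h ch e]; exists (f \o h); last by move=> x xD /=; rewrite e.
by move=> x; apply: continuous_comp; [exact: ch|exact: cf].
Qed.

Lemma cont_mulmxl m1 m2 m3 (A : 'M[R]_(m1, m2)) : continuous (@mulmx R m1 m2 m3 A).
Proof.
apply: cont_mx => i j; rewrite (_ : (fun _ => _) = fun B : 'M[R]_(m2, m3) => \sum_k A i k * B k j); last first.
  by apply/funext => B; rewrite mxE.
apply: cont_sum => k _; apply: cont_mul; first exact: cont_cst.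
by apply: cont_mx_coord => x.
Qed.

Lemma cont_on_flux F v : F \in facets M -> pw_C1 v -> cont_on (hull M F) (avg_flux M F v).
Proof.
move=> FM pv; apply: (@cont_on_map _ _ _ (mulmx (Defs.normal M F))).
  exact: cont_mulmxl.
by apply: (cont_on_avg hM hFD) => //; exact: pw_cont_jacobian.
Qed.

Lemma flux_lin F v a v1 v2 x : F \in facets M -> hull M F x -> pw_lin M v a v1 v2 ->
  pw_C1 v1 -> pw_C1 v2 ->
  avg_flux M F v x = a *: avg_flux M F v1 x + avg_flux M F v2 x.
Proof.
move=> FM xF vE p1 p2; have jE := pw_lin_jacobian vE p1 p2.
have e := avg_lin hM hFD FM xF jE (pw_cont_jacobian p1) (pw_cont_jacobian p2).
apply: (etrans (congr1 (mulmx (Defs.normal M F)) e)).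
by apply: (etrans (mulmxDr _ _ _)); congr (_ + _); exact: (esym (scalemxAr _ _ _)).
Qed.

Lemma cont_on_normal_jump F v : F \in facets M -> pw_C1 v ->
  cont_on (hull M F) (normal_jump M F v : E -> R^o).
Proof.
move=> FM pv; apply: (@cont_on_map _ _ _ (fun u => mxdot u (Defs.normal M F) : R^o)).
  by apply: cont_mxdot => [x|]; [|exact: cst_continuous].
by apply: (cont_on_jump hM hFD) => //; exact: pw_C1_cont.
Qed.

Lemma normal_jump_lin F v a v1 v2 x : F \in facets M -> hull M F x ->
  pw_lin M v a v1 v2 -> pw_C1 v1 -> pw_C1 v2 ->
  normal_jump M F v x = a * normal_jump M F v1 x + normal_jump M F v2 x.
Proof.
move=> FM xF vE p1 p2; rewrite /normal_jump (jump_lin hM hFD FM xF vE); [|exact: pw_C1_cont..].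
by rewrite mxdotDl mxdotZl.
Qed.

Let cdot m k := @inner_mxdot R E m k.

Definition cell_form v w : R := broken_int M (fun x => mxdot ('J v x) ('J w x)).

Definition jump_form (sigma : R) v w : R := \sum_(F in facets M)
  sigma / hF M F * facet_int M F (fun x => mxdot (jump M F v x) (jump M F w x)).

(** The consistency term of [a_h]; by [a_hE] the symmetrizing term is its transpose. *)
Definition flux_form v w : R :=
  \sum_(F in facets M) facet_int M F (fun x => mxdot (avg_flux M F v x) (jump M F w x)).

Definition energy_form sigma v w : R := cell_form v w + jump_form sigma v w.

Lemma energy_normE sigma v : energy_norm M sigma v = Num.sqrt (energy_form sigma v v).
Proof. by []. Qed.

Lemma cell_formC v w : cell_form v w = cell_form w v.
Proof.
by apply: (congr1 (broken_int M)); apply/funext => x; exact: mxdotC.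
Qed.

Lemma jump_formC sigma v w : jump_form sigma v w = jump_form sigma w v.
Proof.
apply: eq_bigr => F _; apply: (congr1 (fun g => sigma / hF M F * facet_int M F g)).
by apply/funext => x; exact: mxdotC.
Qed.

Lemma energy_formC sigma v w : energy_form sigma v w = energy_form sigma w v.
Proof. by rewrite /energy_form cell_formC jump_formC. Qed.

Lemma a_hE sigma v w :
  a_h M sigma v w = energy_form sigma v w - flux_form v w - flux_form w v.
Proof.
suff -> : flux_form w v =
    \sum_(F in facets M) facet_int M F (fun x => mxdot (jump M F v x) (avg_flux M F w x)).
  by [].
apply: eq_bigr => F _; apply: (congr1 (facet_int M F)).
by apply/funext => x; exact: mxdotC.
Qed.

Lemma a_hC sigma v w : a_h M sigma v w = a_h M sigma w v.
Proof. by rewrite (a_hE sigma v w) (a_hE sigma w v) (energy_formC sigma v w); exact: addrAC. Qed.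

Section Linearity.
Variables (v v1 v2 : E -> E) (a : R).
Hypotheses (vE : pw_lin M v a v1 v2) (p1 : pw_C1 v1) (p2 : pw_C1 v2).

Lemma cell_form_linl w : pw_C1 w ->
  cell_form v w = a * cell_form v1 w + cell_form v2 w.
Proof.
move=> pw; apply: sum_lin => K KM.
apply: (functional_linl (cell_functional hM KM) (cdot n.+1 n.+1)).
- by move=> x xK; exact: (pw_lin_jacobian vE p1 p2 KM xK).
- exact: pw_cont_jacobian.
- exact: pw_cont_jacobian.
- exact: pw_cont_jacobian.
Qed.

Lemma jump_form_linl sigma w : pw_C1 w ->
  jump_form sigma v w = a * jump_form sigma v1 w + jump_form sigma v2 w.
Proof.
move=> pw; apply: sum_lin => F FM; apply: mul_lin.
apply: (functional_linl (facet_functional FM) (cdot 1 n.+1)).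
- by move=> x xF; apply: (jump_lin hM hFD) => //; exact: pw_C1_cont.
- by apply: (cont_on_jump hM hFD) => //; exact: pw_C1_cont.
- by apply: (cont_on_jump hM hFD) => //; exact: pw_C1_cont.
- by apply: (cont_on_jump hM hFD) => //; exact: pw_C1_cont.
Qed.

Lemma flux_form_linl w : pw_C1 w ->
  flux_form v w = a * flux_form v1 w + flux_form v2 w.
Proof.
move=> pw; apply: sum_lin => F FM.
apply: (functional_linl (facet_functional FM) (cdot 1 n.+1)).
- by move=> x xF; exact: flux_lin.
- exact: cont_on_flux.
- exact: cont_on_flux.
- by apply: (cont_on_jump hM hFD) => //; exact: pw_C1_cont.
Qed.

Lemma flux_form_linr w : pw_C1 w ->
  flux_form w v = a * flux_form w v1 + flux_form w v2.
Proof.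
move=> pw; apply: sum_lin => F FM.
apply: (functional_linr (facet_functional FM) (cdot 1 n.+1)).
- by move=> x xF; apply: (jump_lin hM hFD) => //; exact: pw_C1_cont.
- by apply: (cont_on_jump hM hFD) => //; exact: pw_C1_cont.
- by apply: (cont_on_jump hM hFD) => //; exact: pw_C1_cont.
- exact: cont_on_flux.
Qed.

Lemma energy_form_linl sigma w : pw_C1 w ->
  energy_form sigma v w = a * energy_form sigma v1 w + energy_form sigma v2 w.
Proof.
by move=> pw; apply: add_lin; [exact: cell_form_linl|exact: jump_form_linl].
Qed.

Lemma a_h_linl sigma w : pw_C1 w ->
  a_h M sigma v w = a * a_h M sigma v1 w + a_h M sigma v2 w.
Proof.
move=> pw; rewrite !a_hE; apply: sub_lin; last exact: flux_form_linr.
by apply: sub_lin; [exact: energy_form_linl|exact: flux_form_linl].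
Qed.

Lemma j_h_linl w : pw_C1 w -> j_h M v w = a * j_h M v1 w + j_h M v2 w.
Proof.
move=> pw; apply: sum_lin => F FM; apply: mul_lin.
apply: (functional_linl (facet_functional FM) inner_mul
  (f := normal_jump M F v : E -> R^o) (f1 := normal_jump M F v1 : E -> R^o)).
- by move=> x xF; exact: normal_jump_lin.
- exact: cont_on_normal_jump.
- exact: cont_on_normal_jump.
- exact: cont_on_normal_jump.
Qed.

Lemma b_h_linl q : pw_cont M (q : E -> R^o) ->
  b_h M v q = a * b_h M v1 q + b_h M v2 q.
Proof.
move=> pq.
have eC : broken_int M (fun x => q x * div v x) =
  a * broken_int M (fun x => q x * div v1 x) + broken_int M (fun x => q x * div v2 x).
  apply: sum_lin => K KM; have I := cell_functional hM KM.
  apply: (functional_linr I inner_mul (g := q : E -> R^o) (f := div v : E -> R^o)).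
  - by move=> x xK; exact: (pw_lin_div vE p1 p2 KM xK).
  - exact: pw_cont_div.
  - exact: pw_cont_div.
  - exact: pq.
have eF : \sum_(F in facets M) facet_int M F (fun x => avg M F q x * normal_jump M F v x) =
  a * \sum_(F in facets M) facet_int M F (fun x => avg M F q x * normal_jump M F v1 x) +
  \sum_(F in facets M) facet_int M F (fun x => avg M F q x * normal_jump M F v2 x).
  apply: sum_lin => F FM; have I := facet_functional FM.
  apply: (functional_linr I inner_mul (g := avg M F q : E -> R^o)
    (f := normal_jump M F v : E -> R^o)).
  - by move=> x xF; exact: normal_jump_lin.
  - exact: cont_on_normal_jump.
  - exact: cont_on_normal_jump.
  - exact: (cont_on_avg hM hFD).
rewrite /b_h; apply: add_lin eF; exact: opp_lin.
Qed.

End Linearity.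

Lemma b_h_linr v q a q1 q2 : pw_lin M (q : E -> R^o) a q1 q2 ->
  pw_cont M (q1 : E -> R^o) -> pw_cont M (q2 : E -> R^o) -> pw_C1 v ->
  b_h M v q = a * b_h M v q1 + b_h M v q2.
Proof.
move=> qE c1 c2 pv.
have eC : broken_int M (fun x => q x * div v x) =
  a * broken_int M (fun x => q1 x * div v x) + broken_int M (fun x => q2 x * div v x).
  apply: sum_lin => K KM; have I := cell_functional hM KM.
  apply: (functional_linl I inner_mul (f := q : E -> R^o)).
  - by move=> x xK; exact: (qE K x KM xK).
  - exact: c1.
  - exact: c2.
  - exact: (@pw_cont_div v pv K KM).
have eF : \sum_(F in facets M) facet_int M F (fun x => avg M F q x * normal_jump M F v x) =
  a * \sum_(F in facets M) facet_int M F (fun x => avg M F q1 x * normal_jump M F v x) +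
  \sum_(F in facets M) facet_int M F (fun x => avg M F q2 x * normal_jump M F v x).
  apply: sum_lin => F FM; have I := facet_functional FM.
  apply: (functional_linl I inner_mul (f := avg M F q : E -> R^o)).
  - by move=> x xF; exact: (avg_lin hM hFD).
  - exact: (cont_on_avg hM hFD).
  - exact: (cont_on_avg hM hFD).
  - exact: cont_on_normal_jump.
rewrite /b_h; apply: add_lin eF; exact: opp_lin.
Qed.

Lemma j_hC v w : j_h M v w = j_h M w v.
Proof.
apply: eq_bigr => F _.
apply: (congr1 (fun g => (hF M F)^-1 * facet_int M F g)).
by apply/funext => x; exact: mulrC.
Qed.

Hypothesis n0 : (0 < n)%N.

Let hF0 F : F \in facets M -> 0 < hF M F.
Proof. by move=> FM; apply: (hF_gt0 hM). Qed.

Lemma energy_form_ge0 sigma v : 0 <= sigma -> pw_C1 v -> 0 <= energy_form sigma v v.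
Proof.
move=> s0 pv; rewrite addr_ge0 // sumr_ge0 // => [K KM|F FM].
  apply: (functional_ge0 (cell_functional hM KM) (cdot n.+1 n.+1)).
  exact: pw_cont_jacobian.
rewrite mulr_ge0 ?divr_ge0 ?(ltW (hF0 FM)) //.
apply: (functional_ge0 (facet_functional FM) (cdot 1 n.+1)).
by apply: (cont_on_jump hM hFD) => //; exact: pw_C1_cont.
Qed.

Lemma j_h_ge0 v : pw_C1 v -> 0 <= j_h M v v.
Proof.
move=> pv; rewrite sumr_ge0 // => F FM; rewrite mulr_ge0 ?invr_ge0 ?(ltW (hF0 FM)) //.
apply: (functional_ge0 (facet_functional FM) inner_mul); exact: cont_on_normal_jump.
Qed.

(** Since [sigma] is positive, zero energy annihilates the squared jump on each facet;
    Cauchy-Schwarz removes its product with any flux. *)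
Lemma energy_form_eq0 sigma v w : 0 < sigma -> pw_C1 v -> pw_C1 w ->
  energy_form sigma v v = 0 -> flux_form w v = 0.
Proof.
move=> s0 pv pw.
have cell0 : 0 <= cell_form v v.
  rewrite sumr_ge0 // => K KM.
  apply: (functional_ge0 (cell_functional hM KM) (cdot n.+1 n.+1)).
  exact: pw_cont_jacobian.
have jc F : F \in facets M -> cont_on (hull M F) (jump M F v).
  by move=> FM; apply: (cont_on_jump hM hFD) => //; exact: pw_C1_cont.
have ge0 F : F \in facets M -> 0 <= sigma / hF M F *
    facet_int M F (fun x => mxdot (jump M F v x) (jump M F v x)).
  move=> FM; rewrite mulr_ge0 ?divr_ge0 ?(ltW (hF0 FM)) ?(ltW s0) //.
  by apply: (functional_ge0 (facet_functional FM) (cdot 1 n.+1)); exact: jc.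
have jump0 : 0 <= jump_form sigma v v by exact: sumr_ge0.
rewrite /energy_form => /eqP; rewrite (paddr_eq0 cell0 jump0) => /andP[_ /eqP].
move=> /(psumr_eq0P ge0) F_eq0; rewrite /flux_form big1 // => F FM.
have /eqP := F_eq0 F FM; rewrite mulf_eq0 gt_eqF ?divr_gt0 ?hF0 //= => /eqP F0.
apply: (etrans (functionalC (facet_functional FM) (cdot 1 n.+1) _ _)).
apply: (functional_eq0 (facet_functional FM) (cdot 1 n.+1) (jc F FM) _ F0).
exact: cont_on_flux.
Qed.

(** The kernel condition under which [psd_dominates] bounds [a_h] by the energy. *)
Lemma energy_form_ker sigma v : 0 < sigma -> pw_C1 v ->
  energy_form sigma v v = 0 -> a_h M sigma v v = 0.
Proof.
by move=> s0 pv e0; rewrite a_hE e0 (energy_form_eq0 s0 pv pv e0) !subr0.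
Qed.

Lemma j_h_eq0_facet v F (g : E -> R) : pw_C1 v -> j_h M v v = 0 -> F \in facets M ->
  cont_on (hull M F) (g : E -> R^o) ->
  facet_int M F (fun x => normal_jump M F v x * g x) = 0.
Proof.
move=> pv j0 FM cg.
have ge0 F' : F' \in facets M -> 0 <= (hF M F')^-1 *
    facet_int M F' (fun x => normal_jump M F' v x * normal_jump M F' v x).
  move=> F'M; rewrite mulr_ge0 ?invr_ge0 ?(ltW (hF0 F'M)) //.
  by apply: (functional_ge0 (facet_functional F'M) inner_mul); exact: cont_on_normal_jump.
have /eqP := psumr_eq0P ge0 j0 FM.
rewrite mulf_eq0 gt_eqF ?invr_gt0 ?hF0 //= => /eqP F0.
apply: (functional_eq0 (facet_functional FM) inner_mul
  (f := normal_jump M F v : E -> R^o) (g := g : E -> R^o) _ cg F0).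
exact: cont_on_normal_jump.
Qed.

Lemma j_h_eq0 v w : pw_C1 v -> pw_C1 w -> j_h M v v = 0 -> j_h M w v = 0.
Proof.
move=> pv pw j0; rewrite j_hC /j_h big1 // => F FM.
rewrite j_h_eq0_facet ?mulr0 //; exact: cont_on_normal_jump.
Qed.

End Forms.

Section PolynomialPieces.
Context {R : realType} {d : nat}.
Implicit Types (A : set 'rV[R]_d) (g : 'rV[R]_d -> R).

Lemma poly_on_lin m A (a : R) g1 g2 : poly_on m A g1 -> poly_on m A g2 ->
  poly_on m A (fun x => a * g1 x + g2 x).
Proof.
move=> [c1 e1] [c2 e2]; exists (fun b => a * c1 b + c2 b) => x Ax.
by rewrite e1 // e2 //; apply/esym/sum_lin => b _; rewrite mulrDl mulrA.
Qed.

Lemma C1_poly m (c : {ffun 'I_d -> 'I_m.+1} -> R) :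
  C1 (fun x : 'rV[R]_d => \sum_(b : {ffun 'I_d -> 'I_m.+1} | (\sum_i b i <= m)%N)
    c b * \prod_i x ord0 i ^+ b i).
Proof.
apply: C1_sum => b _; apply: C1M; first exact: C1_cst.
by apply: C1_prod => i _; apply: C1X; exact: C1_coord.
Qed.

End PolynomialPieces.

Section DiscreteSpaces.
Context {R : realType} {n : nat} {V : finType}.
Local Notation E := 'rV[R]_n.+1.
Local Notation mu := (lebesgue_rV R n.+1).
Variables (M : mesh R n.+1 V) (Omega : set E) (k : nat).
Hypotheses (hOmega : admissible_domain Omega).
Hypotheses (hM : simplicial_partition M Omega) (hFD : facet_data M).
Implicit Types (K F : {set V}) (v w : E -> E) (g q : E -> R).

Let mO := admissible_measurable hOmega.

Lemma V_h_pw_C1 v : V_h Omega M k v -> pw_C1 M v.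
Proof.
move=> [_ pv] K KM; have /choice[c ce] := pv K KM.
exists (fun x => \row_j \sum_(b : {ffun 'I_n.+1 -> 'I_k.+1} | (\sum_i b i <= k)%N)
    c j b * \prod_i x ord0 i ^+ b i).
  by move=> j; under eq_fun do rewrite mxE; exact: C1_poly.
by move=> x xK; apply/rowP => j; rewrite ce // mxE.
Qed.

Lemma Q_h_cell q K : Q_h Omega M k q -> K \in cells M ->
  exists2 h, C1 h & forall x, (hull M K)° x -> q x = h x.
Proof.
move=> [_ pq] /pq[c ce].
by exists (fun x => \sum_(b : {ffun 'I_n.+1 -> 'I_k.-1.+1} | (\sum_i b i <= k.-1)%N)
    c b * \prod_i x ord0 i ^+ b i) => //; exact: C1_poly.
Qed.

Lemma Q_h_pw_cont q : Q_h Omega M k q -> pw_cont M (q : E -> R^o).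
Proof.
by move=> hq K /(Q_h_cell hq)[h h1 e]; exists h => //; exact: C1_continuous.
Qed.

Lemma V_h_lin (a : R) v w : V_h Omega M k v -> V_h Omega M k w ->
  V_h Omega M k (fun x => a *: v x + w x).
Proof.
move=> [v2 pv] [w2 pw]; split; first exact: L2v_lin.
move=> K KM i; under eq_fun do rewrite !mxE.
by apply: poly_on_lin; [exact: pv|exact: pw].
Qed.

Lemma Q_h_lin (a : R) q1 q2 : Q_h Omega M k q1 -> Q_h Omega M k q2 ->
  Q_h Omega M k (fun x => a * q1 x + q2 x).
Proof.
move=> [[l1 z1] p1] [[l2 z2] p2]; split; last first.
  by move=> K KM; apply: poly_on_lin; [exact: p1|exact: p2].
split; first exact: L2_lin.
rewrite RintegralD //.
- rewrite RintegralZl ?z1 ?z2 ?mulr0 ?addr0 //.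
  exact: (L2_integrable hOmega hM).
- exact: (L2_integrable hOmega hM (L2_scale mO a l1)).
- exact: (L2_integrable hOmega hM).
Qed.

Lemma broken_div v : pw_C1 M v -> exists2 g, L2 Omega g &
  forall K x, K \in cells M -> (hull M K)° x -> g x = div v x.
Proof.
move=> pv; have /choice[w wP] K : exists w, K \in cells M ->
    C1v w /\ forall x, (hull M K)° x -> v x = w x.
  case: (boolP (K \in cells M)) => [/pv[w w1 e]|_]; last by exists (fun=> 0).
  by exists w.
exists (piecewise M (fun K => div (w K))).
  by apply: (L2_piecewise hOmega hM) => K /wP[w1 _]; exact: C1v_continuous_div.
move=> K x KM xK; rewrite (piecewiseE hM _ KM xK); have [w1 e] := wP K KM.
by rewrite /div (cell_jacobian w1 e xK).
Qed.

(** [green_jump] for the polynomial representatives of [v], whose values on facets are the traces.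
    The constants are divided by the area because [facet_int], unlike [face_int], contains the area
    element. *)
Lemma green_normal_jump : exists2 c : {set V} -> R, (forall F, F \in facets M -> c F != 0) &
  forall v g phi, L2v Omega v -> pw_C1 M v -> L2 Omega g ->
  (forall K x, K \in cells M -> (hull M K)° x -> g x = div v x) -> C1 phi ->
  normal_trace Omega v g phi =
  \sum_(F in facets M) c F * facet_int M F (fun x => normal_jump M F v x * phi x).
Proof.
have [c c0 cE] := green_jump hM hFD.
exists (fun F => c F / facet_area M F).
  by move=> F FM; rewrite mulf_neq0 ?invr_eq0 ?c0 // gt_eqF // (facet_area_gt0 hM).
move=> v g phi v2 pv g2 gE p1.
have /choice[w wP] K : exists w, K \in cells M ->
    C1v w /\ forall x, (hull M K)° x -> v x = w x.
  case: (boolP (K \in cells M)) => [/pv[w w1 e]|_]; last by exists (fun=> 0).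
  by exists w.
have w1 K : K \in cells M -> C1v (w K) by move=> /wP[].
have vw K x : K \in cells M -> (hull M K)° x -> v x = w K x by move=> /wP[_]; apply.
have gphi : L2v Omega (gradient phi).
  move=> i; apply: (L2_continuous hOmega hM).
  by apply: (@cont_mx_coord _ _ _ _ _ ord0 i); exact: C1_continuous_gradient.
have phi2 : L2 Omega phi by apply: (L2_continuous hOmega hM); exact: C1_continuous.
rewrite /normal_trace (Rintegral_cells hOmega hM); last exact: integrable_mxdot.
rewrite (Rintegral_cells hOmega hM); last exact: L2_mul_integrable.
rewrite /broken_int -big_split /=.
transitivity (\sum_(K in cells M) \int[mu]_(x in (hull M K)°)
     (mxdot (w K x) (gradient phi x) + div (w K) x * phi x)).
  apply: eq_bigr => K KM; have [cI lI _] := cell_functional hM KM.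
  have cg : continuous (fun x => mxdot (w K x) (gradient phi x)).
    by apply: cont_mxdot; [apply: C1v_continuous; exact: w1|exact: C1_continuous_gradient].
  have cd : continuous (fun x => div (w K) x * phi x).
    by apply: cont_mul; [apply: C1v_continuous_div; exact: w1|exact: C1_continuous].
  have -> : \int[mu]_(x in (hull M K)°) mxdot (v x) (gradient phi x) =
      \int[mu]_(x in (hull M K)°) mxdot (w K x) (gradient phi x).
    by apply: cI => x xK; rewrite (vw K).
  have -> : \int[mu]_(x in (hull M K)°) (g x * phi x) =
      \int[mu]_(x in (hull M K)°) (div (w K) x * phi x).
    apply: cI => x xK; apply: (congr1 ( *%R^~ (phi x))); apply: (etrans (gE K x KM xK)).
    exact: (congr1 mxtrace (cell_jacobian (w1 K KM) (fun y => vw K y KM) xK)).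
  have := lI 1 _ _ cg cd; rewrite mul1r => <-.
  by apply: cI => x _; rewrite mul1r.
rewrite cE //; apply: eq_bigr => F FM.
rewrite -mulrA; congr (_ * _); rewrite facet_intE mulKf; last first.
  by rewrite gt_eqF // (facet_area_gt0 hM).
rewrite /face_int /int_simplex; apply: eq_Rintegral => t /set_mem St.
have /facetP[cF _] := FM.
have xF : hull M F (face_pt M F t) by exact: hull_face_pt.
rewrite -/(face_pt M F t) mulrC; congr (mxdot _ _ * _).
rewrite /jump_of /jump; have pM := plus_cell hFD FM.
have tp : trace M (plus M F) v (face_pt M F t) = w (plus M F) (face_pt M F t).
  apply: (trace_eq hM pM); first by apply: C1v_continuous; exact: w1.
    by move=> y; exact: vw.
  exact: hullS (facet_sub_plus hFD FM) _ xF.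
case: ifPn => iF; rewrite tp //; have mM := minus_cell hFD FM iF.
congr (_ - _); apply/esym; apply: (trace_eq hM mM).
- by apply: C1v_continuous; exact: w1.
- by move=> y; exact: vw.
- exact: hullS (facet_sub_minus hFD FM iF) _ xF.
Qed.

(** Without normal jumps, Green's formula for the elementwise divergence has no facet terms for any
    C1 function. This yields the weak divergence and the vanishing boundary trace at once. *)
Lemma W_h_of_j_h_eq0 v : (0 < n)%N -> V_h Omega M k v -> j_h M v v = 0 ->
  W_h Omega M k v.
Proof.
move=> n0 hv j0; split=> //; have pv := V_h_pw_C1 hv.
have [v2 _] := hv; split=> //; have [g g2 gE] := broken_div pv.
have [c _ cE] := green_normal_jump.
have nt phi : C1 phi -> normal_trace Omega v g phi = 0.
  move=> p1; rewrite (cE v g phi) // big1 // => F FM.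
  rewrite (j_h_eq0_facet hM) ?mulr0 //.
  by exists phi => //; exact: C1_continuous.
exists g; split=> //.
- move=> phi [d1 c1 _] _; have : C1 phi by split.
  by move=> /nt; rewrite /normal_trace => /eqP; rewrite addr_eq0 => /eqP.
- by move=> phi [d1 c1 _]; apply: nt; split.
Qed.

End DiscreteSpaces.

(** * Conforming discrete fields *)

Section Cutoff.
Context {R : realType}.

(** A C1 transition from 0 on [s <= 1] to 1 on [2 <= s]. As it starts at 1 and not at 0,
    [cell_cutoff] vanishes in a neighbourhood of every point outside the open cell. *)
Definition cutoff (s : R) : R := sqplus (s - 1) / (sqplus (s - 1) + sqplus (2 - s)).

Lemma cutoff_den (s : R) : 0 < sqplus (s - 1) + sqplus (2 - s).
Proof.
have [s1|s1] := leP s 1; first by rewrite ltr_wpDl ?sqplus_ge0 ?sqplus_gt0 //; lra.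
by rewrite ltr_pwDl ?sqplus_ge0 ?sqplus_gt0 //; lra.
Qed.

Lemma cutoff_eq0 (s : R) : s <= 1 -> cutoff s = 0.
Proof. by move=> s1; rewrite /cutoff sqplus_eq0 ?mul0r //; lra. Qed.

Lemma cutoff_eq1 (s : R) : 2 <= s -> cutoff s = 1.
Proof.
move=> s2; have := cutoff_den s; rewrite /cutoff (@sqplus_eq0 _ (2 - s)); last lra.
by rewrite addr0 => s0; rewrite divff // gt_eqF.
Qed.

Lemma cutoff_bound (s : R) : 0 <= cutoff s <= 1.
Proof.
rewrite /cutoff divr_ge0 ?sqplus_ge0 ?(ltW (cutoff_den s)) //=.
by rewrite ler_pdivrMr ?cutoff_den // mul1r lerDl sqplus_ge0.
Qed.

Lemma C1_cutoff d (g : 'rV[R]_d -> R) : C1 g -> C1 (fun x => cutoff (g x)).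
Proof.
move=> g1; have h1 : C1 (fun x => sqplus (g x - 1)).
  by apply: C1_sqplus; apply: C1B; [exact: g1|exact: C1_cst].
apply: C1M; [exact: h1|apply: C1V => [x|]]; first by rewrite gt_eqF ?cutoff_den.
apply: C1D; [exact: h1|apply: C1_sqplus; apply: C1B; [exact: C1_cst|exact: g1]].
Qed.

End Cutoff.

Section CellCutoff.
Context {R : realType} {n : nat} {V : finType}.
Local Notation E := 'rV[R]_n.+1.
Local Notation mu := (lebesgue_rV R n.+1).
Variables (M : mesh R n.+1 V) (K : {set V}).
Hypotheses (cK : #|K| = n.+2) (uK : row_free (edges M n.+1 K)).

Definition bubble (x : E) : R := \prod_(a in K) sqplus (blam M K a x).

Lemma C1_bubble : C1 bubble.
Proof. by apply: C1_prod => a _; apply: C1_sqplus; exact: C1_blam. Qed.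

Lemma bubble_gt0 x : (hull M K)° x -> 0 < bubble x.
Proof.
move=> xK; apply: prodr_gt0 => a _; apply: sqplus_gt0.
exact: interior_hull_blam_gt0.
Qed.

Lemma bubble_gt0_interior x : 0 < bubble x -> (hull M K)° x.
Proof.
move=> x0; apply: (blam_gt0_interior cK uK) => a aK; rewrite ltNge; apply/negP => ax.
by move: x0; rewrite /bubble (bigD1 a) //= sqplus_eq0 // mul0r ltxx.
Qed.

Lemma bubble_face a x : a \in K -> hull M (K :\ a) x -> bubble x = 0.
Proof.
move=> aK xF; rewrite /bubble (bigD1 a) //= sqplus_eq0 ?mul0r //.
by rewrite (hull_sub_blam0 cK uK (finset.subD1set K a) xF aK) // !inE eqxx.
Qed.

(** At each point of the open cell it equals 1 for all large [m]. *)
Definition cell_cutoff (m : nat) (x : E) : R := cutoff (m%:R * bubble x).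

Lemma C1_cell_cutoff m : C1 (cell_cutoff m).
Proof. by apply: C1_cutoff; apply: C1M; [exact: C1_cst|exact: C1_bubble]. Qed.

Lemma cell_cutoff_near0 m x : ~ (hull M K)° x -> \near x, cell_cutoff m x = 0.
Proof.
move=> xK; have : bubble x <= 0 by rewrite leNgt; apply/negP => /bubble_gt0_interior.
move=> b0; have cb : continuous (fun y => m%:R * bubble y).
  by apply: cont_mul; [exact: cont_cst|apply: C1_continuous; exact: C1_bubble].
have : \near x, m%:R * bubble x < 1.
  have /open_nbhs_nbhs : open_nbhs (m%:R * bubble x) [set r : R | r < 1].
    split; first exact: open_lt.
    by rewrite /= (le_lt_trans _ ltr01) // mulr_ge0_le0.
  exact: cb.
by apply: filterS => y /ltW /cutoff_eq0.
Qed.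

Lemma support_cell_cutoff m (phi : E -> R) :
  support_closure (fun x => phi x * cell_cutoff m x) `<=` (hull M K)°.
Proof.
case: m => [|m] x xs.
  exfalso; have [y [/= yn _]] := xs setT filterT.
  by move: yn; rewrite /cell_cutoff mul0r cutoff_eq0 ?mulr0 ?eqxx.
apply: contrapT => /(cell_cutoff_near0 m.+1) /xs[y [/= yn y0]].
by move: yn; rewrite y0 mulr0 eqxx.
Qed.

Lemma test_fun_cell_cutoff m (phi : E -> R) : C1 phi ->
  test_fun (fun x => phi x * cell_cutoff m x).
Proof.
move=> p1; have [d1 c1] := C1M p1 (C1_cell_cutoff m); split=> //.
have [r Kr] := (bounded_set_cube _).1 (bounded_interior_cell cK uK).
apply: (@subclosed_compact _ _ (cube 0 r)); first exact: closed_closure.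
  exact: compact_cube.
by apply: subset_trans Kr; exact: support_cell_cutoff.
Qed.

(** Green's formula for the product of [w] with the cut-off function; the bubble vanishes on every
    face, which removes the boundary terms. *)
Lemma cell_cutoff_green m (phi : E -> R) (w : E -> E) : C1 phi -> C1v w ->
  \int[mu]_(x in (hull M K)°)
    mxdot (w x) (gradient (fun x => phi x * cell_cutoff m x) x) =
  - \int[mu]_(x in (hull M K)°) (div w x * (phi x * cell_cutoff m x)).
Proof.
move=> p1 w1; have pc1 := C1M p1 (C1_cell_cutoff m).
set psi := fun x => _ in pc1 *.
have mK := measurable_interior_cell M K; have bK := bounded_interior_cell cK uK.
have c1 : continuous (fun x => mxdot (w x) (gradient psi x)).
  by apply: cont_mxdot; [exact: C1v_continuous|exact: C1_continuous_gradient].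
have c2 : continuous (fun x => div w x * psi x).
  by apply: cont_mul; [exact: C1v_continuous_div|exact: C1_continuous].
apply/eqP; rewrite -addr_eq0 -RintegralD //; [|exact: integrable_continuous_bounded..].
have := green_cell cK uK (C1v_scale pc1 w1).
rewrite big1 => [|a aK]; last first.
  transitivity (\int[lebesgue_rV R n]_(t in @ref_simplex R n) (0 : R)).
    apply: eq_Rintegral => t /set_mem St; set y := simplex_pt _ _.
    have cF : #|K :\ a| = n.+1.
      by have := cardsD1 a K; rewrite aK cK add1n => -[].
    have yF : hull M (K :\ a) y by rewrite (hull_image M cF); exists t.
    rewrite /psi /cell_cutoff (bubble_face aK yF) mulr0 cutoff_eq0 ?mulr0 ?scale0r //.
    exact: mxdot0l.
  by rewrite Rintegral_cst ?mul0r //; exact: measurable_ref_simplex.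
move=> e; apply/eqP; rewrite -[RHS]e; apply: eq_Rintegral => x _.
by apply: (etrans _ (esym (div_scale x pc1 w1))); rewrite addrC mulrC.
Qed.

(** Dominated convergence, with [|h|] as dominating function. *)
Lemma cell_cutoff_limit (h : E -> R) : mu.-integrable (hull M K)° (EFin \o h) ->
  (forall m, \int[mu]_(x in (hull M K)°) (h x * cell_cutoff m x) = 0) ->
  \int[mu]_(x in (hull M K)°) h x = 0.
Proof.
move=> hi h0; have mK := measurable_interior_cell M K.
have mh : measurable_fun (hull M K)° h by apply/measurable_EFinP; case/integrableP: hi.
have mc m : measurable_fun (hull M K)° (cell_cutoff m).
  apply: measurable_funTS; apply: continuous_measurable_rV; apply: C1_continuous.
  exact: C1_cell_cutoff.
have hm m : mu.-integrable (hull M K)° (EFin \o (fun x => h x * cell_cutoff m x)).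
  apply: le_integrable hi => //; first by apply/measurable_EFinP; exact: measurable_funM.
  move=> x _ /=; rewrite lee_fin normrM ler_piMr //.
  by have /andP[a b] := cutoff_bound (m%:R * bubble x); rewrite ger0_norm.
have lim0 : (\int[mu]_(x in (hull M K)°) (h x)%:E)%E = 0%E; last first.
  by rewrite /Rintegral lim0.
have cv : (\int[mu]_(x in (hull M K)°) (h x * cell_cutoff m x)%:E)%E @[m --> \oo] -->
    (\int[mu]_(x in (hull M K)°) (h x)%:E)%E.
  apply: (@dominated_cvg _ _ _ mu _ mK (fun m x => (h x * cell_cutoff m x)%:E)
    (EFin \o h) (fun x => `|h x|%:E)).
  - by move=> m; apply/measurable_EFinP; exact: measurable_funM.
  - move=> x xK; have b0 := bubble_gt0 xK.
    apply: cvg_near_cst; near=> m.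
    rewrite /= /cell_cutoff cutoff_eq1 ?mulr1 //.
    rewrite -ler_pdivrMr //; near: m; exact: nbhs_infty_ger.
  - by [].
  - by have := integrable_abse hi.
  - move=> m x _ /=; rewrite lee_fin normrM ler_piMr //.
    by have /andP[a b] := cutoff_bound (m%:R * bubble x); rewrite ger0_norm.
apply: (cvg_unique _ cv); first exact: ereal_hausdorff.
rewrite (_ : (fun m => _) = fun=> 0%E); first exact: cvg_cst.
apply/funext => m; have e := h0 m; rewrite /Rintegral in e.
rewrite -[LHS]fineK; first by rewrite e.
exact: (integrable_fin_num mK (hm m)).
Unshelve. all: by end_near. Qed.

End CellCutoff.

Section Conforming.
Context {R : realType} {n : nat} {V : finType}.
Local Notation E := 'rV[R]_n.+1.
Local Notation mu := (lebesgue_rV R n.+1).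
Variables (M : mesh R n.+1 V) (Omega : set E) (k : nat).
Hypotheses (hOmega : admissible_domain Omega).
Hypotheses (hM : simplicial_partition M Omega) (hFD : facet_data M).
Implicit Types (K F : {set V}) (v w : E -> E) (g q : E -> R).

Let mO := admissible_measurable hOmega.

Lemma broken_int_cell f K : K \in cells M ->
  (forall x, ~ (hull M K)° x -> f x = 0) ->
  broken_int M f = \int[mu]_(x in (hull M K)°) f x.
Proof.
move=> KM f0; rewrite /broken_int (bigD1 K) //= big1 ?addr0 // => K' /andP[K'M neq].
rewrite (@eq_Rintegral _ _ _ mu _ (fun=> 0)); last first.
  move=> x /set_mem xK'; apply: f0 => xK.
  have : ((hull M K')° `&` (hull M K)°) x by [].
  by rewrite (interior_cell_disjoint hM).
by rewrite Rintegral_cst ?mul0r //; exact: measurable_interior_cell.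
Qed.

(** [phi] times a cutoff is an admissible test function supported in the cell, and the cutoff is
    then removed in the limit. Equality is stated against C1 functions, which include the discrete
    pressures on a cell. *)
Lemma weak_div_cell w g phi K : L2v Omega w -> pw_C1 M w -> L2 Omega g ->
  is_weak_div Omega w g -> C1 phi -> K \in cells M ->
  \int[mu]_(x in (hull M K)°) (g x * phi x) =
  \int[mu]_(x in (hull M K)°) (div w x * phi x).
Proof.
move=> w2 pw g2 wd p1 KM; have [u u1 wu] := pw K KM.
have cK := card_cell hM KM; have uK := free_cell hM KM.
have mK := measurable_interior_cell M K; have bK := bounded_cell hM KM.
have KO : (hull M K)° `<=` Omega by exact: (interior_cell_sub hOmega hM).
have phi2 : L2 Omega phi by apply: (L2_continuous hOmega hM); exact: C1_continuous.
have i1 : mu.-integrable (hull M K)° (EFin \o (fun x => g x * phi x)).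
  by apply: integrableS (L2_mul_integrable mO g2 phi2).
have i2 : mu.-integrable (hull M K)° (EFin \o (fun x => div u x * phi x)).
  apply: integrable_continuous_bounded => //.
  by apply: cont_mul; [exact: C1v_continuous_div|exact: C1_continuous].
transitivity (\int[mu]_(x in (hull M K)°) (div u x * phi x)); last first.
  apply: eq_Rintegral => x /set_mem xK; apply: (congr1 ( *%R^~ (phi x))).
  exact: (esym (congr1 mxtrace (cell_jacobian u1 wu xK))).
pose h x := g x * phi x - div u x * phi x.
have hi : mu.-integrable (hull M K)° (EFin \o h).
  by have := integrableB mK i1 i2.
suff : \int[mu]_(x in (hull M K)°) h x = 0.
  by rewrite /h RintegralB // => /eqP; rewrite subr_eq0 => /eqP.
apply: (cell_cutoff_limit cK uK hi) => m.
have pc1 := C1M p1 (C1_cell_cutoff M K m).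
set psi := fun x => _ in pc1.
have psi2 : L2 Omega psi by apply: (L2_continuous hOmega hM); exact: C1_continuous.
have := wd psi (test_fun_cell_cutoff cK uK m p1)
  (subset_trans (@support_cell_cutoff _ _ _ M K cK uK m phi) KO).
have out x : ~ (hull M K)° x -> \near x, psi x = 0.
  by move=> /(cell_cutoff_near0 cK uK m); apply: filterS => y y0; rewrite /psi y0 mulr0.
have out0 x : ~ (hull M K)° x -> psi x = 0 by move=> /out/nbhs_singleton.
have gpsi2 : L2v Omega (gradient psi).
  move=> i; apply: (L2_continuous hOmega hM).
  by apply: (@cont_mx_coord _ _ _ _ _ ord0 i); exact: C1_continuous_gradient.
rewrite (Rintegral_cells hOmega hM); last exact: integrable_mxdot.
rewrite (Rintegral_cells hOmega hM); last exact: L2_mul_integrable.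
rewrite (broken_int_cell KM); last first.
  move=> x /out psi0; rewrite (_ : gradient psi x = 0) ?mxdot0r //.
  apply/rowP => i; rewrite !mxE.
  by rewrite (@partial_near _ _ i psi (cst 0)) ?partial_cst.
rewrite (broken_int_cell KM); last by move=> x /out0 ->; rewrite mulr0.
have -> : \int[mu]_(x in (hull M K)°) mxdot (w x) (gradient psi x) =
    \int[mu]_(x in (hull M K)°) mxdot (u x) (gradient psi x).
  by apply: eq_Rintegral => x /set_mem xK; rewrite wu.
rewrite (cell_cutoff_green cK uK m p1 u1) => /oppr_inj e.
transitivity (\int[mu]_(x in (hull M K)°) (g x * psi x - div u x * psi x)).
  by apply: eq_Rintegral => x _; rewrite /h /psi; ring.
rewrite RintegralB ?e ?subrr //.
- by apply: integrableS (L2_mul_integrable mO g2 psi2).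
- apply: integrable_continuous_bounded => //.
  by apply: cont_mul; [exact: C1v_continuous_div|exact: C1_continuous].
Qed.

Lemma Rintegral_simplex_eq0 m (f : 'rV[R]_m -> R) : continuous f ->
  (forall t, 0 <= f t) -> \int[lebesgue_rV R m]_(t in @ref_simplex R m) f t = 0 ->
  forall t, open_simplex t -> f t = 0.
Proof.
move=> cf f0 + t0 tS; apply: contraPP => /eqP ft0.
have ft : 0 < f t0 by rewrite lt_neqAle eq_sym ft0 f0.
pose U := @open_simplex R m `&` [set t | f t0 / 2 < f t].
have oU : open U.
  apply: openI; first exact: open_open_simplex.
  by apply: (open_comp (f := f) (D := [set r | f t0 / 2 < r])) => [t _|]; [exact: cf|exact: open_gt].
have mS := @measurable_ref_simplex R m.
have mU : measurable U by exact: open_measurable_rV.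
have US : U `<=` @ref_simplex R m by move=> t [/sub_open_simplex].
have U0 : (0 < lebesgue_rV R m U)%E.
  apply: lebesgue_rV_open_gt0 => //; exists t0; split=> //=.
  by rewrite ltr_pdivrMr // ltr_pMr // ltr1n.
have fi := integrable_continuous_bounded mS (@bounded_ref_simplex R m) cf.
have mf : measurable_fun (@ref_simplex R m) (EFin \o f) by case/integrableP: fi.
have pos : (0 < \int[lebesgue_rV R m]_(t in @ref_simplex R m) (f t)%:E)%E.
  apply: (@lt_le_trans _ _ (\int[lebesgue_rV R m]_(t in U) (f t)%:E)%E); last first.
    by apply: ge0_subset_integral => // t _; rewrite lee_fin.
  apply: (@lt_le_trans _ _ (\int[lebesgue_rV R m]_(t in U) (f t0 / 2)%:E)%E).
    by rewrite integral_cst // mule_gt0 // lte_fin divr_gt0.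
  apply: ge0_le_integral => //.
  - by move=> t _; rewrite lee_fin ltW ?divr_gt0.
  - exact: measurable_funS mf.
  - by move=> t [_ /= /ltW]; rewrite lee_fin.
by apply/eqP; rewrite gt_eqF // /Rintegral fine_gt0 // pos ltey_eq integrable_fin_num.
Qed.

Definition bump (x0 : E) (e : R) (y : E) : R :=
  \prod_i sqplus (e ^+ 2 - (y ord0 i - x0 ord0 i) ^+ 2).

Lemma C1_bump x0 e : C1 (bump x0 e).
Proof.
apply: C1_prod => i _; apply: C1_sqplus; apply: C1B; first exact: C1_cst.
by apply: C1X; apply: C1B; [exact: C1_coord|exact: C1_cst].
Qed.

Lemma bump_ge0 x0 e y : 0 <= bump x0 e y.
Proof. by apply: prodr_ge0 => i _; exact: sqplus_ge0. Qed.

Lemma bump_gt0 x0 e : 0 < e -> 0 < bump x0 e x0.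
Proof.
by move=> e0; apply: prodr_gt0 => i _; rewrite sqplus_gt0 // subrr expr0n subr0 exprn_gt0.
Qed.

Lemma bump_neq0 x0 e y : 0 < e -> bump x0 e y != 0 -> forall i, `|x0 ord0 i - y ord0 i| < e.
Proof.
move=> e0 + i; apply: contraNT; rewrite -leNgt => ei.
rewrite /bump (bigD1 i) //= sqplus_eq0 ?mul0r // subr_le0.
by rewrite -(real_normK (num_real (y ord0 i - _))) distrC lerXn2r ?nnegrE // ltW.
Qed.

Lemma test_fun_bump phi x0 e : 0 < e -> C1 phi -> test_fun (fun y => phi y * bump x0 e y).
Proof.
move=> e0 p1; have [d1 c1] := C1M p1 (C1_bump x0 e); split=> //.
apply: (@subclosed_compact _ _ (cube x0 e)); [exact: closed_closure|exact: compact_cube|].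
rewrite [X in _ `<=` X](closure_id _).1; last exact: closed_cube.
apply: closureS => y /= yn i; rewrite ltW //; apply: bump_neq0 => //.
by apply: contraNneq yn => ->; rewrite mulr0.
Qed.

(** An extension of the normal jump beyond the facet, so that it can be a factor of a test
    function. *)
Lemma normal_jump_C1 v F : pw_C1 M v -> F \in facets M ->
  exists2 P, C1 P & forall x, hull M F x -> normal_jump M F v x = P x.
Proof.
move=> pv FM; have pM := plus_cell hFD FM; have [u u1 vu] := pv _ pM.
have tp x : hull M F x -> trace M (plus M F) v x = u x.
  move=> xF; apply: (trace_eq hM pM) => //; first exact: C1v_continuous.
  exact: hullS (facet_sub_plus hFD FM) _ xF.
case: (boolP (interior_facet M F)) => iF; last first.
  exists (fun x => mxdot (u x) (Defs.normal M F)); first exact: C1_mxdot_cst.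
  by move=> x xF; rewrite /normal_jump /jump (negbTE iF) tp.
have mM := minus_cell hFD FM iF; have [u' u1' vu'] := pv _ mM.
exists (fun x => mxdot (u x + -1 *: u' x) (Defs.normal M F)).
  by apply: C1_mxdot_cst; apply: C1vD; [exact: u1|exact: C1vZ].
move=> x xF; rewrite /normal_jump /jump iF tp // scaleN1r.
rewrite (trace_eq hM mM (C1v_continuous u1') vu') //.
exact: hullS (facet_sub_minus hFD FM iF) _ xF.
Qed.

(** Replacing [g] by the elementwise divergence turns the vanishing trace into a relation between
    normal jumps alone, which can be localized. *)
Lemma normal_trace_facets w g : L2v Omega w -> pw_C1 M w -> L2 Omega g ->
  is_weak_div Omega w g -> (forall phi, test_fun phi -> normal_trace Omega w g phi = 0) ->
  exists2 c : {set V} -> R, (forall F, F \in facets M -> c F != 0) &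
  forall phi, test_fun phi ->
  \sum_(F in facets M) c F * facet_int M F (fun x => normal_jump M F w x * phi x) = 0.
Proof.
move=> w2 pw g2 wd nt; have [c c0 cE] := green_normal_jump hOmega hM hFD.
exists c => // phi tphi; have p1 : C1 phi by case: tphi.
have [h h2 hE] := broken_div hOmega hM pw.
rewrite -(cE w h phi) // -[RHS](nt phi tphi) /normal_trace.
have phi2 : L2 Omega phi by apply: (L2_continuous hOmega hM); exact: C1_continuous.
have e f : L2 Omega f -> \int[mu]_(x in Omega) (f x * phi x) = broken_int M (fun x => f x * phi x).
  by move=> f2; apply: (Rintegral_cells hOmega hM); exact: L2_mul_integrable.
rewrite (e h h2) (e g g2); apply: congr1; apply: eq_bigr => K KM.
apply: (etrans _ (esym (weak_div_cell w2 pw g2 wd p1 KM))).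
by apply: eq_Rintegral => x /set_mem xK; apply: (congr1 ( *%R^~ (phi x))); exact: (hE K x KM xK).
Qed.

Lemma closed_hull_facet F : F \in facets M -> closed (hull M F).
Proof. by move=> /facetP[cF _]; exact: closed_hull cF. Qed.

(** The other facets form a closed set that misses the relative interior of [F]. *)
Lemma facet_isolated F t : F \in facets M -> open_simplex t ->
  exists2 e : R, 0 < e & forall F' y, F' \in facets M -> F' != F ->
    hull M F' y -> ~ ball (face_pt M F t) e y.
Proof.
move=> FM tS; set x0 := face_pt M F t.
pose Z := \bigcup_(F' in [set` [set F' in facets M | F' != F]%SET]) hull M F'.
have cZ : closed Z.
  apply: closed_bigcup => [|F' /=]; first exact: finite_finset.
  by rewrite inE => /andP[F'M _]; exact: closed_hull_facet.
have : nbhs x0 (~` Z).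
  have := closed_openC cZ; rewrite openE; apply => -[F' /=].
  rewrite inE => /andP[F'M neq]; apply: (facet_interior_disjoint hM) => //.
  by rewrite eq_sym.
move=> /nbhs_ballP[e /= e0 eZ]; exists e => // F' y F'M neq yF' /eZ; apply.
by exists F' => //=; rewrite inE F'M.
Qed.

(** The test function is the extended jump [P] times a bump that meets no other facet. What remains
    of the relation is the integral over [F] of [P ^+ 2] times the bump, so [P] vanishes at the
    centre of the bump. *)
Lemma j_h_W_h w : W_h Omega M k w -> j_h M w w = 0.
Proof.
move=> [hw [w2 [g [g2 wd nt]]]]; have pw := V_h_pw_C1 hw.
have [c c0 cE] := normal_trace_facets w2 pw g2 wd nt.
rewrite /j_h big1 // => F FM; have [P P1 PE] := normal_jump_C1 pw FM.
suff P0 t : open_simplex t -> P (face_pt M F t) = 0.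
  have [cI _ _] := facet_functional FM.
  rewrite (cI _ (fun x => P x * P x)) => [|x xF]; last by rewrite PE.
  have cP : continuous (fun t => P (face_pt M F t) * P (face_pt M F t)).
    have cf : continuous (fun t => P (face_pt M F t)).
      move=> t; apply: continuous_comp; [exact: cont_simplex_pt|exact: C1_continuous].
    exact: cont_mul.
  rewrite facet_intE (Rintegral_ref_simplex_open cP).
  rewrite (@eq_Rintegral _ _ _ _ _ (fun=> 0)); last by move=> t /set_mem/P0 ->; rewrite mulr0.
  by rewrite Rintegral_cst ?mul0r ?mulr0 //; exact: measurable_open_simplex.
move=> tS; apply/eqP/negPn/negP => Pt; set x0 := face_pt M F t in Pt.
have [e e0 eF] := facet_isolated FM tS.
have := cE _ (test_fun_bump x0 e0 P1).
rewrite (bigD1 F) //= big1 ?addr0; last first.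
  move=> F' /andP[F'M neq]; have [cI _ _] := facet_functional F'M.
  rewrite (cI _ (fun=> 0 * 0)); last first.
    move=> x xF'; have [->|b0] := eqVneq (bump x0 e x) 0; first by rewrite !mulr0.
    exfalso; apply: (eF F' x) => //; apply/rV_ball => //; exact: bump_neq0.
  by rewrite facet_intE mulr0 Rintegral_cst ?mul0r ?mulr0 //; exact: measurable_ref_simplex.
move/eqP; rewrite mulf_eq0 (negbTE (c0 F FM)) /=.
have [cI _ _] := facet_functional FM.
rewrite (cI _ (fun x => P x ^+ 2 * bump x0 e x)) => [|x xF]; last by rewrite PE // mulrA.
rewrite facet_intE mulf_eq0 gt_eqF ?(facet_area_gt0 hM) //= => /eqP f0.
suff : P x0 ^+ 2 * bump x0 e x0 = 0.
  by move/eqP; rewrite mulf_eq0 expf_eq0 (negbTE Pt) /= gt_eqF // bump_gt0.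
apply: (Rintegral_simplex_eq0 (f := fun t => P (face_pt M F t) ^+ 2 * bump x0 e (face_pt M F t))
  _ _ f0 tS).
- move=> s; apply: (@continuous_comp _ _ _ (face_pt M F) (fun x => P x ^+ 2 * bump x0 e x)).
    exact: cont_simplex_pt.
  by apply: C1_continuous; apply: C1M; [exact: C1X|exact: C1_bump].
- by move=> s; rewrite mulr_ge0 ?sqr_ge0 ?bump_ge0.
Qed.

(** The facet terms of [b_h] vanish with the normal jumps. In the cells, whichever representative
    [weak_div] selects may be replaced by the elementwise divergence, because [q] is a polynomial
    there. *)
Lemma b_cont_W_h w q : (0 < n)%N -> W_h Omega M k w -> Q_h Omega M k q ->
  b_cont Omega w q = b_h M w q.
Proof.
move=> n0 ww hq; have j0 := j_h_W_h ww; have [hw [w2 [g [g2 wd nt]]]] := ww.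
have pw := V_h_pw_C1 hw; have [[q2 _] _] := hq.
have [wd2 wdE] : L2 Omega (weak_div Omega w) /\ is_weak_div Omega w (weak_div Omega w).
  by apply: (@xgetPex _ (fun=> 0) [set g | L2 Omega g /\ is_weak_div Omega w g]); exists g.
rewrite /b_cont (Rintegral_cells hOmega hM); last exact: L2_mul_integrable.
rewrite /b_h [X in _ = _ + X]big1 ?addr0; last first.
  move=> F FM.
  apply: (etrans (functionalC (facet_functional FM) inner_mul (avg M F q : E -> R^o)
    (normal_jump M F w : E -> R^o))).
  apply: (j_h_eq0_facet hM hFD n0 pw j0 FM); apply: (cont_on_avg hM hFD) => //.
  exact: Q_h_pw_cont hq.
apply: congr1; apply: eq_bigr => K KM; have [h h1 qh] := Q_h_cell hq KM.
transitivity (\int[mu]_(x in (hull M K)°) (weak_div Omega w x * h x)).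
  by apply: eq_Rintegral => x /set_mem xK; rewrite qh // mulrC.
apply: (etrans (weak_div_cell w2 pw wd2 wdE h1 KM)).
by apply: eq_Rintegral => x /set_mem xK; rewrite qh // mulrC.
Qed.

End Conforming.

(** * Finite-dimensional estimates *)

Section SemidefiniteForms.
Context {R : realType} {L : vectType R}.
Implicit Types (x y z : L) (J : L -> L -> R).

Definition psd_form J := [/\ forall (a : R) x y z, J (a *: x + y) z = a * J x z + J y z,
  forall x y, J x y = J y x & forall x, 0 <= J x x].

Lemma psd_expand J (a : R) x y : psd_form J ->
  J (a *: x + y) (a *: x + y) = J y y + 2 * J y x * a + J x x * a ^+ 2.
Proof.
move=> [Jl JC _]; rewrite Jl (JC x) (JC y) !Jl (JC x y); ring.
Qed.

Lemma psd_cauchy_schwarz J x y : psd_form J -> J x y ^+ 2 <= J x x * J y y.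
Proof.
move=> hJ; apply: discriminant_le => t.
by rewrite -(psd_expand t y x hJ); case: hJ.
Qed.

Lemma psd_seminorm J (a : R) x y : psd_form J ->
  Num.sqrt (J (a *: x + y) (a *: x + y)) <= `|a| * Num.sqrt (J x x) + Num.sqrt (J y y).
Proof.
move=> hJ; have [_ _ J0] := hJ.
set r := (X in _ <= X); have r0 : 0 <= r by rewrite addr_ge0 ?mulr_ge0 ?sqrtr_ge0.
rewrite -(ger0_norm r0) -sqrtr_sqr ler_wsqrtr // psd_expand //.
have -> : r ^+ 2 = J y y + 2 * (`|a| * (Num.sqrt (J x x) * Num.sqrt (J y y))) + J x x * a ^+ 2.
  rewrite /r sqrrD exprMn !sqr_sqrtr // real_normK ?num_real //; ring.
rewrite lerD2r lerD2l -mulrA ler_pM2l ?ltr0n // (le_trans (ler_norm _)) // normrM mulrC.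
rewrite ler_wpM2l // mulrC -sqrtrM // -sqrtr_sqr ler_wsqrtr //.
exact: psd_cauchy_schwarz.
Qed.

Definition subspace (S : set L) := S 0 /\ forall (a : R) x y, S x -> S y -> S (a *: x + y).

Definition seminorm_on (S : set L) (s : L -> R) := (forall x, 0 <= s x) /\
  forall (a : R) x y, S x -> S y -> s (a *: x + y) <= `|a| * s x + s y.

(* The quotients [s y / sqrt (J y y)] vanish, rather than blow up, when
   [J y y = 0]: [s] is then assumed to vanish at [y]. *)
Definition psd_bound J (e : seq L) (s : L -> R) : R :=
  \sum_(y <- e) s y / Num.sqrt (J y y).

Lemma psd_bound_ge0 J e s : (forall x, 0 <= s x) -> 0 <= psd_bound J e s.
Proof. by move=> s0; apply: sumr_ge0 => y _; rewrite divr_ge0 ?sqrtr_ge0. Qed.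

(* Along a J-orthogonal spanning family of a subspace, a coordinate of x is at
   most [sqrt (J x x) / sqrt (J y y)]. *)
Lemma psd_dominates J (S : set L) : psd_form J -> subspace S ->
  exists2 e : seq L, (forall y, y \in e -> S y) & forall s : L -> R, seminorm_on S s ->
    (forall x, S x -> J x x = 0 -> s x = 0) ->
    forall x, S x -> s x <= psd_bound J e s * Num.sqrt (J x x).
Proof.
move=> hJ [S0 SL]; have [Jl JC J0] := hJ.
(* Invariant of a Gram-Schmidt process: [U] lies in [S], every vector has a [J]-orthogonal
   projection on [U], and the bound holds on [U] for a family chosen before [s]. *)
pose good (U : {vspace L}) := [/\ forall x, x \in U -> S x,
  forall z, exists2 p, p \in U & forall y, y \in U -> J (z - p) y = 0 &
  exists2 e : seq L, (forall y, y \in e -> S y) & forall s : L -> R, seminorm_on S s ->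
    (forall x, S x -> J x x = 0 -> s x = 0) ->
    forall x, x \in U -> s x <= psd_bound J e s * Num.sqrt (J x x)].
have Jl0 y : J 0 y = 0 by have := Jl 1 0 0 y; rewrite scaler0 addr0 mul1r; lra.
have JB x y z : J (x - y) z = J x z - J y z.
  by rewrite addrC -scaleN1r Jl mulN1r addrC.
have good0 : good 0%VS.
  split=> [x|z|]; first by rewrite memv0 => /eqP ->.
    by exists 0; [exact: mem0v|move=> y; rewrite memv0 => /eqP ->; rewrite JC].
  exists [::] => // s _ sJ x; rewrite memv0 => /eqP ->.
  by rewrite sJ ?Jl0 // mulr_ge0 ?sqrtr_ge0 // /psd_bound big_nil.
have goodS U b : good U -> S b -> b \notin U -> good (U + <[b]>)%VS.
  move=> [US proj [e eS eP]] Sb bU; have [p pU bp] := proj b.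
  set b' := b - p in bp; have Sb' : S b'.
    by rewrite /b' addrC -scaleN1r; apply: SL => //; exact: US.
  have b'U : b' \in (U + <[b]>)%VS.
    by rewrite /b' addrC memv_add ?memv_line // memvN.
  have dec x : x \in (U + <[b]>)%VS -> exists2 x', x' \in U & exists t, x = t *: b' + x'.
    move=> /memv_addP[u uU [_ /vlineP[t ->] ->]]; exists (u + t *: p).
      by rewrite memvD ?memvZ.
    by exists t; rewrite /b' scalerBr addrCA -addrA addNr addr0.
  have Jb'0 z : J b' b' = 0 -> J z b' = 0.
    move=> e0; have := psd_cauchy_schwarz z b' hJ.
    by rewrite e0 mulr0 => h; apply/eqP; rewrite -sqrf_eq0 eq_le h sqr_ge0.
  split.
  - move=> x /dec[x' x'U [t ->]]; apply: SL => //; exact: US.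
  - move=> z; have [p' p'U zp'] := proj z.
    (* When [J b' b' = 0] the quotient is 0 by convention, and rightly so: Cauchy-Schwarz gives
       [J z b' = 0]. *)
    exists (J z b' / J b' b' *: b' + p').
      by rewrite memvD ?memvZ // (subvP (addvSl U <[b]>)).
    move=> y /dec[y' y'U [t ->]]; set tau := J z b' / _.
    have JZ (a : R) u v : J (a *: u) v = a * J u v.
      by rewrite -[a *: u]addr0 Jl Jl0 addr0.
    have zb : J (z - p') (t *: b' + y') = t * J z b'.
      by rewrite JC Jl (JC y') (zp' _ y'U) addr0 (JC b') JB (JC p') (bp _ p'U) subr0.
    have bb : J b' (t *: b' + y') = t * J b' b'.
      by rewrite JC Jl (JC y') (bp _ y'U) addr0.
    rewrite opprD addrA addrAC JB JZ zb bb mulrCA /tau.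
    have [e0|e0] := eqVneq (J b' b') 0; first by rewrite (Jb'0 z e0) e0 !mul0r !mulr0 subrr.
    by rewrite divfK // subrr.
  - exists (b' :: e) => [y|s [s0 sL] sJ x]; first by rewrite inE => /predU1P[->|/eS].
    move=> /dec[x' x'U [t ->]]; have Sx' := US x' x'U.
    apply: (le_trans (sL t b' x' Sb' Sx')).
    have Jx : J (t *: b' + x') (t *: b' + x') = J b' b' * t ^+ 2 + J x' x'.
      by rewrite psd_expand // JC bp // mulr0 mul0r addr0 addrC.
    rewrite /psd_bound big_cons mulrDl lerD //.
      have [e0|e0] := eqVneq (J b' b') 0.
        by rewrite (sJ b') // mulr0 mul0r mul0r.
      have b0 : 0 < Num.sqrt (J b' b') by rewrite sqrtr_gt0 lt_neqAle eq_sym e0 J0.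
      rewrite mulrC -mulrA ler_wpM2l // ler_pdivlMl // -sqrtr_sqr -sqrtrM // Jx.
      by rewrite ler_wsqrtr // lerDl.
    apply: (le_trans (eP s (conj s0 sL) sJ x' x'U)); rewrite ler_wpM2l ?psd_bound_ge0 //.
    by rewrite ler_wsqrtr // Jx lerDr mulr_ge0 ?sqr_ge0.
suff [U [US _ [e eS eP]] SU] : exists2 U, good U & forall x, S x -> x \in U.
  by exists e => // s hs sJ x Sx; apply: eP => //; exact: SU.
(* The induction runs on a bound for the codimension of [U], starting from the zero space. *)
have : (\dim (fullv : {vspace L}) <= \dim (fullv : {vspace L}) + \dim (0 : {vspace L})%VS)%N.
  by rewrite leq_addr.
move: (X in (_ <= X + _)%N) good0 => m; move: (0%VS : {vspace L}) => U.
elim: m U => [|m IH] U gU dU.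
  exists U => // x _; have : U == fullv by rewrite eqEdim subvf.
  by move=> /eqP ->; exact: memvf.
have [SU|/existsNP[b /not_implyP[Sb /negP bU]]] := pselect (forall x, S x -> x \in U).
  by exists U.
apply: (IH _ (goodS U b gU Sb bU)).
apply: (leq_trans dU); rewrite addSnnS leq_add2l.
have [le eq] := dimv_leqif_sup (addvSl U <[b]>).
rewrite ltn_neqAle le andbT eq; apply: contra bU => /subvP; apply.
by apply: (subvP (addvSr U <[b]>)); exact: memv_line.
Qed.

End SemidefiniteForms.

(** * Finite coordinates on the discrete space *)

Section Coordinates.
Context {R : realType} {n : nat} {V : finType}.
Local Notation E := 'rV[R]_n.+1.
Variables (M : mesh R n.+1 V) (Omega : set E) (k : nat).
Hypotheses (hOmega : admissible_domain Omega).
Hypotheses (hM : simplicial_partition M Omega) (hFD : facet_data M).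
Implicit Types (K F : {set V}) (v w : E -> E).

Let monomial := {ffun 'I_n.+1 -> 'I_k.+1}.

(** Redundant: every subset of [V] and every exponent bounded by [k] has a coordinate, although only
    cells and total degree at most [k] enter [of_coord]. Surplus coordinates lie in the kernel of
    the forms, which are only required to be semidefinite. *)
Definition dof : finType := ({set V} * 'I_n.+1 * monomial)%type.

Implicit Types c : 'rV[R]_#|dof|.

Definition of_coord c : E -> E := fun x => \row_i piecewise M (fun K y =>
  \sum_(b : monomial | (\sum_j b j <= k)%N)
    c ord0 (enum_rank (K, i, b) : 'I_#|dof|) * \prod_j y ord0 j ^+ b j) x.

Lemma of_coord_lin (a : R) c c' :
  of_coord (a *: c + c') = fun x => a *: of_coord c x + of_coord c' x.
Proof.
apply/funext => x; apply/rowP => i; rewrite !mxE; apply: sum_lin => K _.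
apply: mul_lin; apply: sum_lin => b _; rewrite !mxE; ring.
Qed.

Lemma of_coord0 : of_coord 0 = fun=> 0.
Proof.
have := of_coord_lin (-1) 0 0; rewrite scaler0 addr0 => e.
by apply/funext => x; rewrite e scaleN1r addNr.
Qed.

Lemma V_h_of_coord c : V_h Omega M k (of_coord c).
Proof.
split=> [i|K KM i]; under eq_fun do rewrite mxE.
  apply: (L2_piecewise hOmega hM) => K KM; apply: C1_continuous.
  exact: (C1_poly (fun b => c ord0 (enum_rank (K, i, b) : 'I_#|dof|))).
exists (fun b => c ord0 (enum_rank (K, i, b) : 'I_#|dof|)) => x xK.
exact: (piecewiseE hM _ KM xK).
Qed.

Lemma of_coord_onto v : V_h Omega M k v -> exists c, forall K x, K \in cells M ->
  (hull M K)° x -> v x = of_coord c x.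
Proof.
move=> [_ pv].
have /choice[C CE] (Ki : {set V} * 'I_n.+1) : exists C : monomial -> R,
    Ki.1 \in cells M -> forall x, (hull M Ki.1)° x -> v x ord0 Ki.2 =
    \sum_(b : monomial | (\sum_j b j <= k)%N) C b * \prod_j x ord0 j ^+ b j.
  case: (boolP (Ki.1 \in cells M)) => [/pv/(_ Ki.2)[C CE]|_]; last by exists (fun=> 0).
  by exists C.
exists (\row_s C (enum_val s).1 (enum_val s).2) => K x KM xK.
apply/rowP => i; rewrite mxE (piecewiseE hM _ KM xK) (CE (K, i) KM x xK).
by apply: eq_bigr => b _; rewrite mxE enum_rankK.
Qed.

(** The relation in which coordinates represent a field: values on the skeleton of the mesh are
    arbitrary. *)
Definition cell_eq v w := forall K x, K \in cells M -> (hull M K)° x -> v x = w x.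

(** Writing equality as a combination with coefficient 0 lets the linearity lemmas also prove
    invariance of the forms. *)
Lemma cell_eq_lin v w : cell_eq v w -> pw_lin M v 0 w w.
Proof. by move=> vw K x KM xK; rewrite scale0r add0r; exact: vw xK. Qed.

Lemma a_h_cell_eq sigma v v' w : cell_eq v v' -> pw_C1 M v' -> pw_C1 M w ->
  a_h M sigma v w = a_h M sigma v' w.
Proof.
move=> /cell_eq_lin vE pv pw.
by rewrite (a_h_linl hM hFD vE pv pv) // mul0r add0r.
Qed.

Lemma b_h_cell_eq v v' q : cell_eq v v' -> pw_C1 M v' -> pw_cont M (q : E -> R^o) ->
  b_h M v q = b_h M v' q.
Proof.
move=> /cell_eq_lin vE pv pq.
by rewrite (b_h_linl hM hFD vE pv pv) // mul0r add0r.
Qed.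

Lemma ipL2_cell_eq f v v' : cell_eq v v' -> L2v Omega f -> L2v Omega v -> L2v Omega v' ->
  ipL2 Omega f v = ipL2 Omega f v'.
Proof.
move=> vE f2 v2 v2'; have mO := admissible_measurable hOmega.
rewrite /ipL2 (Rintegral_cells hOmega hM); last exact: integrable_mxdot.
rewrite (Rintegral_cells hOmega hM); last exact: integrable_mxdot.
apply: eq_bigr => K KM; apply: eq_Rintegral => x /set_mem xK.
by rewrite (vE K).
Qed.

Section PullBack.
Variable Q : (E -> E) -> (E -> E) -> R.
Hypothesis Q_linl : forall v (a : R) v1 v2 w, pw_lin M v a v1 v2 ->
  pw_C1 M v1 -> pw_C1 M v2 -> pw_C1 M w -> Q v w = a * Q v1 w + Q v2 w.
Hypothesis QC : forall v w, Q v w = Q w v.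

Definition coord_form c c' : R := Q (of_coord c) (of_coord c').

Let pc c : pw_C1 M (of_coord c).
Proof. by apply: V_h_pw_C1; exact: V_h_of_coord. Qed.

Lemma coord_formE v c : pw_C1 M v -> cell_eq v (of_coord c) -> Q v v = coord_form c c.
Proof.
move=> pv /cell_eq_lin vE; rewrite (Q_linl vE) // mul0r add0r QC.
by rewrite (Q_linl vE) // mul0r add0r.
Qed.

Lemma psd_coord_form : (forall v, V_h Omega M k v -> 0 <= Q v v) -> psd_form coord_form.
Proof.
move=> Q0; split=> [a x y z|x y|x]; last by apply: Q0; exact: V_h_of_coord.
  by rewrite /coord_form of_coord_lin; exact: Q_linl.
exact: QC.
Qed.

End PullBack.
End Coordinates.

(** * Convergence *)

Section Convergence.
Context {R : realType} {n : nat} {V : finType}.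
Local Notation E := 'rV[R]_n.+1.
Variables (M : mesh R n.+1 V) (Omega : set E) (k : nat).
Hypotheses (hOmega : admissible_domain Omega).
Hypotheses (hM : simplicial_partition M Omega) (hFD : facet_data M).
Hypothesis n0 : (0 < n)%N.
Variables (sigma Csigma beta : R).
Hypothesis sigma1 : 1 <= sigma.
Hypothesis Csigma0 : 0 < Csigma.
Hypothesis hcoer : coercive Omega M k sigma Csigma.
Hypothesis beta0 : 0 < beta.
Hypothesis hstab : inf_sup_stable Omega M k sigma beta.
Implicit Types (v w : E -> E) (q : E -> R).

Let mO := admissible_measurable hOmega.
Let sigma0 : 0 < sigma := lt_le_trans ltr01 sigma1.
Let VC1 v : V_h Omega M k v -> pw_C1 M v := @V_h_pw_C1 _ _ _ M Omega k v.
Let vc := @of_coord R n V M k.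
Let Vvc c : V_h Omega M k (vc c) := V_h_of_coord hOmega hM c.

Let a_linl v (a : R) v1 v2 w : pw_lin M v a v1 v2 -> pw_C1 M v1 -> pw_C1 M v2 ->
  pw_C1 M w -> a_h M sigma v w = a * a_h M sigma v1 w + a_h M sigma v2 w.
Proof. by move=> vE p1 p2; exact: (a_h_linl hM hFD vE p1 p2). Qed.

Let energy_linl v (a : R) v1 v2 w : pw_lin M v a v1 v2 -> pw_C1 M v1 -> pw_C1 M v2 ->
  pw_C1 M w ->
  energy_form M sigma v w = a * energy_form M sigma v1 w + energy_form M sigma v2 w.
Proof. by move=> vE p1 p2; exact: (energy_form_linl hM hFD vE p1 p2). Qed.

Let j_linl v (a : R) v1 v2 w : pw_lin M v a v1 v2 -> pw_C1 M v1 -> pw_C1 M v2 ->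
  pw_C1 M w -> j_h M v w = a * j_h M v1 w + j_h M v2 w.
Proof. by move=> vE p1 p2; exact: (j_h_linl hM hFD vE p1 p2). Qed.

Lemma a_h_lin v1 v2 w (a : R) : V_h Omega M k v1 -> V_h Omega M k v2 ->
  V_h Omega M k w ->
  a_h M sigma (fun x => a *: v1 x + v2 x) w = a * a_h M sigma v1 w + a_h M sigma v2 w.
Proof. by move=> h1 h2 h; apply: a_linl => //; exact: VC1. Qed.

Lemma energy_ge0 v : V_h Omega M k v -> 0 <= energy_form M sigma v v.
Proof. by move=> hv; apply: (energy_form_ge0 hM hFD n0 (ltW sigma0)); exact: VC1. Qed.

Lemma energy_norm_sqr v : V_h Omega M k v ->
  energy_norm M sigma v ^+ 2 = energy_form M sigma v v.
Proof. by move=> hv; rewrite energy_normE sqr_sqrtr ?energy_ge0. Qed.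

Lemma a_h_ge0 v : V_h Omega M k v -> 0 <= a_h M sigma v v.
Proof. by move=> hv; apply: le_trans (hcoer hv); rewrite mulr_ge0 ?sqr_ge0 // ltW. Qed.

Lemma a_h_cauchy_schwarz v w : V_h Omega M k v -> V_h Omega M k w ->
  a_h M sigma v w ^+ 2 <= a_h M sigma v v * a_h M sigma w w.
Proof.
move=> hv hw; apply: discriminant_le => t; have hu := V_h_lin hOmega t hw hv.
suff <- : a_h M sigma (fun x => t *: w x + v x) (fun x => t *: w x + v x) =
  a_h M sigma v v + 2 * a_h M sigma v w * t + a_h M sigma w w * t ^+ 2 by exact: a_h_ge0.
rewrite a_h_lin // (a_hC M sigma w) (a_hC M sigma v (fun x => t *: w x + v x)).
rewrite !a_h_lin // (a_hC M sigma w v).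
move: (a_h M sigma w w) (a_h M sigma v v) (a_h M sigma v w) => A B C; ring.
Qed.

(** [psd_dominates] compares the square root of [a_h v v] with the energy norm, both seminorms of
    the coordinates; Cauchy-Schwarz for [a_h], positive by coercivity, then separates [v] and
    [w]. *)
Lemma a_h_bounded : exists2 C : R, 0 <= C & forall v w, V_h Omega M k v -> V_h Omega M k w ->
  `|a_h M sigma v w| <= C * (energy_norm M sigma v * energy_norm M sigma w).
Proof.
have psdE : psd_form (coord_form M (k := k) (energy_form M sigma)).
  apply: (psd_coord_form hOmega hM) => [v a v1 v2 w vE p1 p2 p|v w|v].
  - exact: energy_linl vE p1 p2 p.
  - exact: energy_formC.
  - exact: energy_ge0.
have psdA : psd_form (coord_form M (k := k) (a_h M sigma)).
  apply: (psd_coord_form hOmega hM) => [v a v1 v2 w vE p1 p2 p|v w|v].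
  - exact: a_linl vE p1 p2 p.
  - exact: a_hC.
  - exact: a_h_ge0.
have [e _ eP] := psd_dominates psdE (conj I (fun _ _ _ _ _ => I) : subspace setT).
pose s c := Num.sqrt (coord_form M (k := k) (a_h M sigma) c c).
pose C := psd_bound (coord_form M (k := k) (energy_form M sigma)) e s.
have C0 : 0 <= C by apply: psd_bound_ge0 => c; exact: sqrtr_ge0.
have bd v : V_h Omega M k v -> Num.sqrt (a_h M sigma v v) <= C * energy_norm M sigma v.
  move=> hv; have [c vE] := of_coord_onto hM hv; have pv := VC1 hv.
  rewrite energy_normE (coord_formE hOmega hM a_linl
    (a_hC M sigma) pv vE).
  rewrite (coord_formE hOmega hM energy_linl
    (energy_formC M sigma) pv vE).
  apply: (eP s) => //.
    by split=> [x|a x y _ _]; [exact: sqrtr_ge0|exact: psd_seminorm].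
  move=> x _ x0; apply/eqP; rewrite /s sqrtr_eq0.
  by rewrite [coord_form _ _ _ _](energy_form_ker hM hFD n0 sigma0 (VC1 (Vvc x)) x0).
exists (C ^+ 2) => [|v w hv hw]; first exact: sqr_ge0.
apply: (@le_trans _ _ (Num.sqrt (a_h M sigma v v) * Num.sqrt (a_h M sigma w w))).
  by rewrite -(sqrtrM _ (a_h_ge0 hv)) -sqrtr_sqr; exact: ler_wsqrtr (a_h_cauchy_schwarz hv hw).
by rewrite expr2 mulrACA ler_pM ?sqrtr_ge0 ?bd.
Qed.

Definition div_free v := forall q, Q_h Omega M k q -> b_h M v q = 0.

(* A member of this space without normal jumps is H(div)-conforming, hence one of
   the test fields [w] to which it is orthogonal. *)
Definition defect v := [/\ V_h Omega M k v, div_free v &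
  forall w, W_h Omega M k w -> div_free w -> a_h M sigma v w = 0].

Lemma defect_ker v : defect v -> j_h M v v = 0 ->
  [/\ W_h Omega M k v, energy_form M sigma v v = 0 & a_h M sigma v v = 0].
Proof.
move=> [hv bv av] j0; have wv := W_h_of_j_h_eq0 hOmega hM hFD n0 hv j0.
have a0 := av v wv bv; split=> //; apply/eqP; rewrite eq_le energy_ge0 // andbT.
have := hcoer hv; rewrite a0 energy_norm_sqr // => h.
by rewrite -(ler_pM2l Csigma0) mulr0.
Qed.

Lemma defect_coord v c : defect v -> cell_eq M v (vc c) -> defect (vc c).
Proof.
move=> [hv bv av] vE; have pv := VC1 hv.
have vE' : cell_eq M (vc c) v by move=> K x KM xK; rewrite (vE K).
split; first exact: Vvc.
  move=> q hq; rewrite (b_h_cell_eq hM hFD vE') ?bv //; exact: Q_h_pw_cont hq.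
move=> w ww bw; rewrite (a_h_cell_eq hM hFD _ vE') ?av //; exact: (VC1 ww.1).
Qed.

Lemma W_h0 : W_h Omega M k (fun=> 0).
Proof.
have z : vc 0 = fun=> 0 by exact: of_coord0.
apply: (W_h_of_j_h_eq0 hOmega hM hFD n0); first by rewrite -z.
have p0 : pw_C1 M (fun=> 0) by rewrite -z; exact: VC1.
(* Zero is minus itself plus itself, so linearity gives [x = - x' + x'] and every form vanishes at
   the zero field. *)
have lin : pw_lin M (fun=> 0 : E) (-1) (fun=> 0) (fun=> 0).
  by move=> K x _ _; rewrite scaleN1r addNr.
by rewrite (j_h_linl hM hFD lin p0 p0 p0) mulN1r addNr.
Qed.

Lemma subspace_defect : subspace [set c | defect (vc c)].
Proof.
split=> [|a x y [hx bx ax] [hy by' ay]] /=.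
  have z : vc 0 = fun=> 0 by exact: of_coord0.
  rewrite z; have [h0 _] := W_h0; have p0 := VC1 h0.
  have lin : pw_lin M (fun=> 0 : E) (-1) (fun=> 0) (fun=> 0).
    by move=> K x _ _; rewrite scaleN1r addNr.
  split=> // [q hq|w [hw _] _].
    by rewrite (b_h_linl hM hFD lin p0 p0 (Q_h_pw_cont hq)) mulN1r addNr.
  by rewrite (a_h_linl hM hFD lin p0 p0 _ (VC1 hw)) mulN1r addNr.
rewrite /vc of_coord_lin; split; first exact: (V_h_lin hOmega).
  move=> q hq; have pq := Q_h_pw_cont hq.
  by rewrite (b_h_linl hM hFD (fun _ _ _ _ => erefl) (VC1 hx) (VC1 hy) pq) bx // by' // mulr0 addr0.
by move=> w ww bw; rewrite a_h_lin ?ax ?ay ?mulr0 ?addr0 //; exact: ww.1.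
Qed.

(** One [j_h]-orthogonal family serves both estimates, and it is fixed before [f], which enters the
    second one only through its norm. *)
Lemma defect_bounds : exists2 C : R * R, 0 <= C.1 /\ 0 <= C.2 &
  (forall v, defect v -> energy_norm M sigma v <= C.1 * Num.sqrt (j_h M v v)) /\
  (forall f, L2v Omega f ->
    (forall v, defect v -> j_h M v v = 0 -> ipL2 Omega f v = 0) ->
    forall v, defect v ->
      `|ipL2 Omega f v| <= C.2 * normL2v Omega f * Num.sqrt (j_h M v v)).
Proof.
pose J := coord_form M (k := k) (j_h M).
have psdJ : psd_form J.
  apply: (psd_coord_form hOmega hM) => [v a v1 v2 w vE p1 p2 p|v w|v hv].
  - exact: j_linl vE p1 p2 p.
  - exact: j_hC.
  - by apply: (j_h_ge0 hM hFD n0); exact: VC1.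
have psdE : psd_form (coord_form M (k := k) (energy_form M sigma)).
  apply: (psd_coord_form hOmega hM) => [v a v1 v2 w vE p1 p2 p|v w|v].
  - exact: energy_linl vE p1 p2 p.
  - exact: energy_formC.
  - exact: energy_ge0.
have [e eS eP] := psd_dominates psdJ subspace_defect.
pose s1 c := Num.sqrt (coord_form M (k := k) (energy_form M sigma) c c).
pose A1 := psd_bound J e s1.
(* The L2 norm may be nonzero on the kernel of [J], but summands with [J y y = 0] are 0 anyway; in
   the others it dominates [|(f, y)|] up to the norm of [f]. *)
pose A2 := psd_bound J e (fun c => normL2v Omega (vc c)).
have jE v c : defect v -> cell_eq M v (vc c) -> j_h M v v = J c c.
  move=> [hv _ _] vE; have pv := VC1 hv.
  exact: (coord_formE hOmega hM j_linl (j_hC M) pv vE).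
exists (A1, A2); first by split; apply: psd_bound_ge0 => c; exact: sqrtr_ge0.
split=> [v dv|f f2 fv v dv]; have [hv _ _] := dv; have [c vE] := of_coord_onto hM hv;
  rewrite (jE v c) //; have dc := defect_coord dv vE.
  have pv := VC1 hv; rewrite energy_normE.
  rewrite (coord_formE hOmega hM energy_linl
    (energy_formC M sigma) pv vE).
  apply: (eP s1) => //.
    by split=> [x|a x y _ _]; [exact: sqrtr_ge0|exact: psd_seminorm].
  move=> x dx x0; have [_ ex _] := defect_ker dx x0.
  by apply/eqP; rewrite /s1 sqrtr_eq0 [coord_form _ _ _ _]ex.
rewrite (ipL2_cell_eq hOmega hM vE f2 hv.1 (Vvc c).1).
have := eP (fun c => `|ipL2 Omega f (vc c)|).
have hs : seminorm_on [set c | defect (vc c)] (fun c => `|ipL2 Omega f (vc c)|).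
  split=> [x|a x y _ _]; first exact: normr_ge0.
  rewrite /vc of_coord_lin ipL2_linr //; [|exact: (Vvc _).1..].
  by rewrite (le_trans (ler_normD _ _)) // normrM.
move=> /(_ hs) hb; apply: le_trans (hb _ c dc) _.
  by move=> x dx x0; rewrite fv ?normr0.
rewrite ler_wpM2r ?sqrtr_ge0 // /A2 /psd_bound mulr_suml ler_sum // => y _.
rewrite mulrAC ler_wpM2r ?invr_ge0 ?sqrtr_ge0 // mulrC.
exact: (ipL2_cauchy_schwarz mO f2 (Vvc y).1).
Qed.

Section Solutions.
Variables (nu gamma : R) (f u uhat : E -> E) (p phat : E -> R).
Hypotheses (nu0 : 0 < nu) (gamma0 : 0 < gamma).
Hypothesis hu : stabilized_DG Omega M k sigma nu gamma f u p.
Hypothesis hhat : Hdiv_DG Omega M k sigma nu f uhat phat.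

Let e : E -> E := fun x => u x - uhat x.
Let r : E -> R := fun x => p x - phat x.

Let hVu : V_h Omega M k u. Proof. by case: hu. Qed.
Let hQp : Q_h Omega M k p. Proof. by case: hu. Qed.
Let hWhat : W_h Omega M k uhat. Proof. by case: hhat. Qed.
Let hVhat : V_h Omega M k uhat. Proof. by case: hWhat. Qed.
Let hQhat : Q_h Omega M k phat. Proof. by case: hhat. Qed.

Let eE : pw_lin M e (-1) uhat u.
Proof. by move=> K x _ _; rewrite scaleN1r addrC. Qed.

Let hVe : V_h Omega M k e.
Proof.
rewrite (_ : e = fun x => -1 *: uhat x + u x); first exact: (V_h_lin hOmega).
by apply/funext => x; rewrite scaleN1r addrC.
Qed.

Let rE : r = fun x => -1 * phat x + p x.
Proof. by apply/funext => x; rewrite mulN1r addrC. Qed.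

Let hQr : Q_h Omega M k r.
Proof. by rewrite rE; exact: (Q_h_lin hOmega hM). Qed.

Lemma stabilized_momentum v : V_h Omega M k v ->
  nu * a_h M sigma u v + b_h M v p + gamma * j_h M u v = ipL2 Omega f v.
Proof. by move=> hv; case: hu => _ _ /(_ v p hv hQp)[]. Qed.

Lemma stabilized_div_free : div_free u.
Proof.
by move=> q hq; case: hu => _ _ /(_ u q hVu hq)[_ /eqP]; rewrite oppr_eq0 => /eqP.
Qed.

Lemma b_cont_div_free w : W_h Omega M k w -> div_free w ->
  forall q, Q_h Omega M k q -> b_cont Omega w q = 0.
Proof. by move=> ww bw q hq; rewrite (b_cont_W_h hOmega hM hFD n0 ww hq) bw. Qed.

(** The method is one equation in the pair [(w, q)]; the choice [w = 0] isolates the constraint. *)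
Lemma Hdiv_div_free : div_free uhat.
Proof.
move=> q hq; have h0 := W_h0; have p0 := VC1 h0.1.
have lin : pw_lin M (fun=> 0 : E) (-1) (fun=> 0) (fun=> 0).
  by move=> K x _ _; rewrite scaleN1r addNr.
have b0 : div_free (fun=> 0).
  by move=> s hs; rewrite (b_h_linl hM hFD lin p0 p0 (Q_h_pw_cont hs)) mulN1r addNr.
have a0 : a_h M sigma uhat (fun=> 0) = 0.
  by rewrite a_hC (a_linl lin p0 p0 (VC1 hVhat)) mulN1r addNr.
have f0 : ipL2 Omega f (fun=> 0) = 0.
  rewrite /ipL2 (@eq_Rintegral _ _ _ _ _ (fun=> 0)).
    by rewrite Rintegral_cst // mul0r.
  by move=> x _; rewrite mxdot0r.
case: hhat => _ _ /(_ _ q h0 hq); rewrite a0 mulr0 add0r (b_cont_div_free h0 b0 hQhat) f0.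
rewrite sub0r => /eqP; rewrite oppr_eq0 (b_cont_W_h hOmega hM hFD n0 hWhat hq).
by move/eqP.
Qed.

(** Here [q] is [phat], whose term vanishes by [Hdiv_div_free]. *)
Lemma Hdiv_momentum w : W_h Omega M k w ->
  nu * a_h M sigma uhat w + b_h M w phat = ipL2 Omega f w.
Proof.
move=> ww; rewrite -(b_cont_W_h hOmega hM hFD n0 ww hQhat).
case: hhat => _ _ /(_ w phat ww hQhat) <-.
by rewrite (b_cont_div_free hWhat Hdiv_div_free hQhat) subr0.
Qed.

Lemma j_h_W_h_r v w : V_h Omega M k v -> W_h Omega M k w -> j_h M v w = 0.
Proof.
move=> hv ww; apply: (j_h_eq0 hM hFD n0); [exact: VC1 ww.1|exact: VC1|].
exact: (j_h_W_h hOmega hM hFD ww).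
Qed.

Lemma a_h_error w : V_h Omega M k w ->
  a_h M sigma e w = a_h M sigma u w - a_h M sigma uhat w.
Proof.
by move=> hw; rewrite (a_linl eE (VC1 hVhat) (VC1 hVu) (VC1 hw)) mulN1r addrC.
Qed.

Lemma error_momentum w : W_h Omega M k w ->
  nu * a_h M sigma e w + b_h M w p - b_h M w phat = 0.
Proof.
move=> ww; have hw := ww.1.
have comb (c g x y z t s j D : R) : c * x + z + g * j = s -> j = 0 -> c * y + t = s ->
    D = x - y -> c * D + z - t = 0.
  by move=> h j0 h' ->; move: h; rewrite j0 mulr0 addr0 mulrBr => h; lra.
exact: comb (stabilized_momentum hw) (j_h_W_h_r hVu ww) (Hdiv_momentum ww) (a_h_error hw).
Qed.

Lemma error_defect : defect e.
Proof.
split=> // [q hq|w ww bw].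
  rewrite (b_h_linl hM hFD eE (VC1 hVhat) (VC1 hVu) (Q_h_pw_cont hq)).
  by rewrite Hdiv_div_free // stabilized_div_free // mulr0 addr0.
have := error_momentum ww; rewrite bw // bw // addr0 subr0 => /eqP.
by rewrite mulf_eq0 gt_eqF //= => /eqP.
Qed.

(** In the equation tested with [e], both forms see [e] in place of [u]: [uhat] is [a_h]-orthogonal
    to [e] and has no normal jumps. The term [nu * a_h e e] is nonnegative and is dropped. *)
Lemma j_h_error : gamma * j_h M e e <= ipL2 Omega f e.
Proof.
have [_ be ae] := error_defect; have pe := VC1 hVe.
rewrite -(stabilized_momentum hVe) be // addr0.
have aue : a_h M sigma u e = a_h M sigma e e.
  by rewrite (a_h_error hVe) (a_hC M sigma uhat e) (ae uhat hWhat Hdiv_div_free) subr0.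
have jue : j_h M u e = j_h M e e.
  rewrite (j_linl eE (VC1 hVhat) (VC1 hVu) pe) (j_hC M uhat).
  by rewrite (j_h_W_h_r hVe hWhat) mulr0 add0r.
rewrite aue jue lerDr; apply: mulr_ge0; [exact: ltW|exact: a_h_ge0].
Qed.

(** In the momentum equation tested with [v], the viscous term vanishes as well, by Cauchy-Schwarz
    for [a_h] and [a_h v v = 0]. *)
Lemma load_ker v : defect v -> j_h M v v = 0 -> ipL2 Omega f v = 0.
Proof.
move=> dv j0; have [hv bv _] := dv; have [wv _ a0] := defect_ker dv j0.
rewrite -(stabilized_momentum hv) bv // (j_h_W_h_r hVu wv) mulr0 !addr0.
have := a_h_cauchy_schwarz hVu hv; rewrite a0 mulr0 => h.
by have /eqP : a_h M sigma u v ^+ 2 = 0; [apply/eqP; rewrite eq_le h sqr_ge0|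
  rewrite sqrf_eq0 => /eqP ->; rewrite mulr0].
Qed.

Lemma velocity_error (c1 c2 : R) : 0 <= c1 -> 0 <= c2 ->
  energy_norm M sigma e <= c1 * Num.sqrt (j_h M e e) ->
  `|ipL2 Omega f e| <= c2 * normL2v Omega f * Num.sqrt (j_h M e e) ->
  energy_norm M sigma e <= c1 * c2 * gamma^-1 * normL2v Omega f.
Proof.
move=> c10 c20 b1 b2; apply: (le_trans b1).
rewrite -!mulrA ler_wpM2l // mulrCA ler_pdivlMl //.
have j0 : 0 <= j_h M e e by apply: (j_h_ge0 hM hFD n0); exact: VC1.
have [->|s0] := eqVneq (Num.sqrt (j_h M e e)) 0.
  by rewrite mulr0 mulr_ge0 ?sqrtr_ge0.
have spos : 0 < Num.sqrt (j_h M e e) by rewrite lt_neqAle eq_sym s0 sqrtr_ge0.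
rewrite -(ler_pM2r spos); apply: le_trans b2; apply: le_trans (ler_norm _).
by rewrite -mulrA -expr2 sqr_sqrtr // j_h_error.
Qed.

Lemma pressure_error (c3 : R) : 0 <= c3 ->
  (forall v w, V_h Omega M k v -> V_h Omega M k w ->
    `|a_h M sigma v w| <= c3 * (energy_norm M sigma v * energy_norm M sigma w)) ->
  beta * normL2 Omega r <= nu * c3 * energy_norm M sigma e.
Proof.
move=> c30 ab; have [h _] := hstab hQr; apply: (le_trans h).
have B0 : 0 <= nu * c3 * energy_norm M sigma e.
  by rewrite mulr_ge0 ?sqrtr_ge0 // mulr_ge0 // ltW.
set S := [set _ | _ in _].
have ubS : ubound S (nu * c3 * energy_norm M sigma e).
  move=> _ [w [ww _] <-]; have hw := ww.1.
  rewrite (b_cont_W_h hOmega hM hFD n0 ww hQr).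
  have -> : b_h M w r = - (nu * a_h M sigma e w).
    have rlin : pw_lin M (r : E -> R^o) (-1) (phat : E -> R^o) p.
      by move=> K x _ _; rewrite rE.
    rewrite (b_h_linr hM hFD rlin (Q_h_pw_cont hQhat) (Q_h_pw_cont hQp) (VC1 hw)).
    have := error_momentum ww.
    move: (nu * _) (b_h M w p) (b_h M w phat) => x y z xyz; lra.
  (* A quotient by a zero energy norm is 0 by convention. *)
  have [->|w0] := eqVneq (energy_norm M sigma w) 0; first by rewrite invr0 mulr0.
  have wpos : 0 < energy_norm M sigma w by rewrite lt_neqAle eq_sym w0 sqrtr_ge0.
  move: wpos (ab _ _ hVe hw).
  move: (energy_norm M sigma w) (energy_norm M sigma e) (a_h M sigma e w) => x y z x0 zxy.
  rewrite ler_pdivrMr // -mulrN; apply: (@le_trans _ _ (nu * (c3 * (y * x)))).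
    by rewrite ler_pM2l //; apply: le_trans zxy; rewrite -normrN ler_norm.
  by rewrite !mulrA.
(* The supremum of the empty set is 0. *)
have [S0|S0] := pselect (S !=set0); first exact: ge_sup.
by rewrite sup_out // => -[].
Qed.

End Solutions.

Lemma stabilized_convergence : exists2 C : R, 0 < C &
  forall (nu gamma : R) (f u uhat : E -> E) (p phat : E -> R),
    0 < nu -> 0 < gamma -> L2v Omega f ->
    stabilized_DG Omega M k sigma nu gamma f u p ->
    Hdiv_DG Omega M k sigma nu f uhat phat ->
    energy_norm M sigma (fun x => u x - uhat x) <= C * gamma^-1 * normL2v Omega f /\
    normL2 Omega (fun x => p x - phat x) <= C * gamma^-1 * nu * normL2v Omega f.
Proof.
have [[c1 c2] /= [c10 c20] [b1 b2]] := defect_bounds.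
have [c3 c30 b3] := a_h_bounded.
(* One summand for the velocity, one for the pressure, and 1 to make the constant positive. *)
pose C := 1 + c1 * c2 + beta^-1 * c3 * (c1 * c2).
have c120 : 0 <= c1 * c2 by rewrite mulr_ge0.
have b3c : 0 <= beta^-1 * c3 * (c1 * c2).
  by rewrite mulr_ge0 // mulr_ge0 // invr_ge0 ltW.
exists C; first by rewrite /C; lra.
move=> nu gamma f u uhat p phat nu0 gamma0 f2 hu hhat.
have de := error_defect nu0 hu hhat.
have fe := b2 f f2 (load_ker hu) _ de.
have ve := velocity_error nu0 gamma0 hu hhat c10 c20 (b1 _ de) fe.
have gf0 : 0 <= gamma^-1 * normL2v Omega f by rewrite mulr_ge0 ?sqrtr_ge0 // invr_ge0 ltW.
have pe := pressure_error nu0 hu hhat c30 b3.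
move: gf0 ve pe; move: (energy_norm M sigma _) (normL2 Omega _) (normL2v Omega f) => x y z.
rewrite -!mulrA; move: (gamma^-1) => g gz ve bpe.
have pe : y <= beta^-1 * (nu * (c3 * x)) by rewrite ler_pdivlMl.
have cgz (a : R) : a <= C -> a * (g * z) <= C * (g * z) by move=> aC; rewrite ler_wpM2r.
split.
  by apply: (le_trans ve); rewrite mulrA; apply: cgz; rewrite /C; lra.
apply: (le_trans pe); apply: (@le_trans _ _ (nu * (beta^-1 * c3 * (c1 * c2) * (g * z)))).
  have -> : beta^-1 * (nu * (c3 * x)) = nu * (beta^-1 * c3 * x) by ring.
  rewrite ler_wpM2l ?(ltW nu0) // -!mulrA ler_wpM2l ?invr_ge0 ?(ltW beta0) //.
  by rewrite ler_wpM2l.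
have -> : C * (g * (nu * z)) = nu * (C * (g * z)) by ring.
by rewrite ler_wpM2l ?(ltW nu0) //; apply: cgz; rewrite /C; lra.
Qed.

End Convergence.

Theorem theorem3p8 (R : realType) (d : nat) (hd : d = 2%N \/ d = 3%N)
    (Omega : set 'rV[R]_d) (hOmega : admissible_domain Omega)
    (V : finType) (M : mesh R d V)
    (hM : simplicial_partition M Omega) (hfacets : facet_data M)
    (kappa : R) (hkappa : shape_regular M kappa)
    (k : nat) (hk : (1 <= k)%N)
    (sigma : R) (hsigma : 1 <= sigma)
    (Csigma : R) (hCsigma : 0 < Csigma)
    (hcoer : coercive Omega M k sigma Csigma)
    (beta : R) (hbeta : 0 < beta)
    (hstab : inf_sup_stable Omega M k sigma beta) :
  exists2 C : R, 0 < C &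
    forall (nu gamma : R) (f u uhat : 'rV[R]_d -> 'rV[R]_d)
      (p phat : 'rV[R]_d -> R),
      0 < nu -> 0 < gamma -> L2v Omega f ->
      stabilized_DG Omega M k sigma nu gamma f u p ->
      Hdiv_DG Omega M k sigma nu f uhat phat ->
      energy_norm M sigma (fun x => u x - uhat x)
        <= C * gamma^-1 * normL2v Omega f /\
      normL2 Omega (fun x => p x - phat x)
        <= C * gamma^-1 * nu * normL2v Omega f.
Proof.
case: hd => dE; subst d.
  exact: (stabilized_convergence hOmega hM hfacets (isT : (0 < 1)%N) hsigma hCsigma hcoer
    hbeta hstab).
exact: (stabilized_convergence hOmega hM hfacets (isT : (0 < 2)%N) hsigma hCsigma hcoer
  hbeta hstab).
Qed.
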